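(* Let $B$ be an algebra, $P_0$ a projective $B$-module and $A=B[P_0]$. The functors $\mathcal{E}$ and $\mathcal{R}$ induce two maps: $$e:\mathrm{s}\tau\text{-}\mathrm{tilt}\,B\to\mathrm{s}\tau\text{-}\mathrm{tilt}\,A,\quad (M,Q)\mapsto(\mathcal{E}M\oplus S,\,Q),$$ $$r:\mathrm{s}\tau\text{-}\mathrm{tilt}\,A\to\mathrm{s}\tau\text{-}\mathrm{tilt}\,B,\quad (T,P)\mapsto(\widehat T,\,P^* ),$$ where $\widehat T$ is the (unique up to isomorphism) basic $\tau$-rigid $B$-module such that $\mathrm{add}\,\widehat T=\mathrm{add}\,\mathcal{R}T$, and $P^*$ is the projective $B$-module obtained from $P$ by removing the projective $A$-module $\widetilde P$. Moreover, the composition satisfies $re=\mathrm{id}_{\mathrm{s}\tau\text{-}\mathrm{tilt}\,B}$.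
   Context: All algebras are basic connected finite dimensional algebras over an algebraically closed field $k$; $\mathrm{mod}\,C$ is the category of finitely generated left $C$-modules. The one-point extension of $B$ by the projective $B$-module $P_0$ is $A=B[P_0]=\begin{pmatrix} B & P_0\\ 0 & k\end{pmatrix}$. There is a unique indecomposable projective $A$-module $\widetilde P$ which is not a projective $B$-module, and $S$ is its simple top. $\mathrm{mod}\,B$ is regarded as embedded in $\mathrm{mod}\,A$ in the usual way (via the projection $A\to B$); projective $B$-modules are then projective $A$-modules. Let $U=e_BA$ with $e_B$ the identity of $B$, a $B$-$A$-bimodule; $\mathcal{R}=U\otimes_A-:\mathrm{mod}\,A\to\mathrm{mod}\,B$ and $\mathcal{E}=\mathrm{Hom}_B(U,-):\mathrm{mod}\,B\to\mathrm{mod}\,A$. For an algebra $C$, $|M|$ is the number of pairwise non-isomorphic indecomposable direct summands of $M$, and $\mathrm{add}\,M$ is the class of direct sums of direct summands of $M$. A $C$-module $M$ is $\tau$-rigid if $\mathrm{Hom}_C(M,\tau_C M)=0$. A pair $(M,P)$ with $P$ a projective $C$-module is a support $\tau$-tilting pair if $M$ is $\tau$-rigid, $\mathrm{Hom}_C(P,M)=0$ and $|M|+|P|=|C|$. $\mathrm{s}\tau\text{-}\mathrm{tilt}\,C$ is the set of isomorphism classes of basic support $\tau$-tilting $C$-modules (modules that are $\tau$-rigid over $C/\langle e\rangle$ with $|M|=|C/\langle e\rangle|$ for some idempotent $e$), identified with isomorphism classes of basic support $\tau$-tilting pairs. *)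

(* Defs.v *)
From HB Require Import structures.
From mathcomp Require Import all_boot all_algebra all_field.

Set Implicit Arguments.
Unset Strict Implicit.
Unset Printing Implicit Defensive.

Import GRing.Theory.
Local Open Scope ring_scope.

Local Obligation Tactic := idtac.

(* Finitely generated left modules over a finite dimensional algebra C are
   represented by finite dimensional k-spaces with a compatible C-action. *)
Record fdmod (k : fieldType) (C : falgType k) := FdMod {
  mod_sort :> vectType k;
  mact : C -> mod_sort -> mod_sort;
  mact_linearl : forall x, linear (mact^~ x);
  mact_linearr : forall a, linear (mact a);
  mact1 : forall x, mact 1 x = x;
  mactM : forall a b x, mact (a * b) x = mact a (mact b x)
}.

Record rmod (k : fieldType) (C : falgType k) := RMod {
  rmod_sort :> vectType k;
  ract : rmod_sort -> C -> rmod_sort;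
  ract_linearr : forall x, linear (ract x);
  ract_linearl : forall a, linear (ract^~ a);
  ract1 : forall x, ract x 1 = x;
  ractM : forall a b x, ract x (a * b) = ract (ract x a) b
}.

Record bimod (k : fieldType) (B A : falgType k) := BiMod {
  bimod_left :> fdmod B;
  bract : bimod_left -> A -> bimod_left;
  bract_linearr : forall x, linear (bract x);
  bract_linearl : forall a, linear (bract^~ a);
  bract1 : forall x, bract x 1 = x;
  bractM : forall a b x, bract x (a * b) = bract (bract x a) b;
  bract_mact : forall b x a, bract (mact b x) a = mact b (bract x a)
}.

Lemma linfunE (k : fieldType) (V W : vectType k) (f : V -> W) :
  linear f -> linfun f =1 f.
Proof.
move=> fL; pose F := GRing.isLinear.Build k V W *:%R f fL.
pose g : {linear V -> W} := HB.pack f F.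
exact: (lfunE g).
Qed.

Section ModuleCategory.

Variables (k : fieldType) (C : falgType k).
Implicit Types M N P X Y : fdmod C.

Definition is_hom M N (f : 'Hom(M, N)) : Prop :=
  forall a x, f (mact a x) = mact a (f x).

Definition surj (V W : vectType k) (f : 'Hom(V, W)) : Prop :=
  forall y, exists x, f x = y.

Definition iso M N : Prop :=
  exists f : 'Hom(M, N), is_hom f /\ bijective f.

Definition hom_zero M N : Prop := forall f : 'Hom(M, N), is_hom f -> f = 0.

Definition homs M N : {vspace 'Hom(M, N)} :=
  lker (linfun (fun f : 'Hom(M, N) => linfun (fun a : C =>
    (f \o linfun (mact a))%VF - (linfun (mact a) \o f)%VF))).

Lemma homsP M N (f : 'Hom(M, N)) : reflect (is_hom f) (f \in homs M N).
Proof.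
pose d (f : 'Hom(M, N)) (a : C) :=
  (f \o linfun (@mact _ _ M a))%VF - (linfun (@mact _ _ N a) \o f)%VF.
have dE g a x : d g a x = g (mact a x) - mact a (g x).
  rewrite add_lfunE opp_lfunE !comp_lfunE.
  by rewrite !(linfunE (mact_linearr a)).
have dL g : linear (d g).
  move=> c a b; apply/lfunP=> x; rewrite [RHS]add_lfunE [X in _ = X + _]scale_lfunE !dE.
  rewrite (mact_linearl x c a b) (mact_linearl (g x) c a b) linearP.
  by rewrite scalerBr opprD addrACA.
have dL2 : linear (fun g => linfun (d g)).
  move=> c g h; apply/lfunP=> a.
  rewrite [RHS]add_lfunE [X in _ = X + _]scale_lfunE !(linfunE (dL _)).
  apply/lfunP=> x.
  rewrite [RHS]add_lfunE [X in _ = X + _]scale_lfunE !dE !add_lfunE !scale_lfunE.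
  by rewrite mact_linearr scalerBr opprD addrACA.
rewrite memv_ker -/d (linfunE dL2).
apply: (iffP eqP) => [f0 a x | fh].
  by apply/eqP; rewrite -subr_eq0 -dE -(linfunE (dL f)) f0 !lfunE.
apply/lfunP=> a; rewrite (linfunE (dL f)); apply/lfunP=> x.
by rewrite dE fh subrr !lfunE.
Qed.

Definition submod M (L : {vspace M}) : Prop :=
  forall a x, x \in L -> mact a x \in L.

Program Definition mod0 : fdmod C :=
  @FdMod k C 'rV[k]_0 (fun _ x => x) _ _ _ _.
Next Obligation. by move=> x c a b; apply/rowP; case. Qed.
Next Obligation. by []. Qed.
Next Obligation. by []. Qed.
Next Obligation. by []. Qed.

Program Definition dsum M N : fdmod C :=
  @FdMod k C (M * N)%type (fun a x => (mact a x.1, mact a x.2)) _ _ _ _.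
Next Obligation.
by move=> M N [x y] c a b /=; rewrite !mact_linearl.
Qed.
Next Obligation.
by move=> M N a c [x y] [x' y'] /=; rewrite !mact_linearr.
Qed.
Next Obligation. by move=> M N [x y] /=; rewrite !mact1. Qed.
Next Obligation. by move=> M N a b [x y] /=; rewrite !mactM. Qed.

Program Definition regmod : fdmod C := @FdMod k C C *%R _ _ _ _.
Next Obligation. by move=> x c a b /=; rewrite mulrDl scalerAl. Qed.
Next Obligation. by move=> a c x y /=; rewrite mulrDr scalerAr. Qed.
Next Obligation. exact: mul1r. Qed.
Next Obligation. by move=> a b x; rewrite mulrA. Qed.

Definition summand X M : Prop := exists Y, iso M (dsum X Y).

Definition indecomposable M : Prop :=
  (exists x : M, x <> 0) /\
  forall X Y, iso M (dsum X Y) -> iso X mod0 \/ iso Y mod0.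

Definition in_add X M : Prop :=
  exists n (Y : 'I_n -> fdmod C),
    (forall i, summand (Y i) M) /\ iso X (\big[dsum/mod0]_(i < n) Y i).

Definition same_add M N : Prop := forall X, in_add X M <-> in_add X N.

Definition basic M : Prop :=
  exists n (X : 'I_n -> fdmod C),
    [/\ forall i, indecomposable (X i),
        forall i j, iso (X i) (X j) -> i = j
      & iso M (\big[dsum/mod0]_(i < n) X i)].

(* |M| = n *)
Definition num_indec M (n : nat) : Prop :=
  exists X : 'I_n -> fdmod C,
    [/\ forall i, indecomposable (X i) /\ summand (X i) M,
        forall i j, iso (X i) (X j) -> i = j
      & forall Y, indecomposable Y -> summand Y M -> exists i, iso Y (X i)].

Definition projective P : Prop :=
  forall M N (g : 'Hom(M, N)) (f : 'Hom(P, N)),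
    is_hom g -> surj g -> is_hom f ->
    exists h : 'Hom(P, M), is_hom h /\ (g \o h)%VF = f.

Definition superfluous M (K : {vspace M}) : Prop :=
  forall L : {vspace M}, submod L -> (L + K = fullv)%VS -> L = fullv.

Definition min_proj_pres (P1 P0 M : fdmod C)
    (d : 'Hom(P1, P0)) (p : 'Hom(P0, M)) : Prop :=
  [/\ projective P1 /\ projective P0, is_hom d /\ is_hom p,
      surj p /\ limg d = lker p & superfluous (lker p) /\ superfluous (lker d)].

Definition maximal_submod M (L : {vspace M}) : Prop :=
  [/\ submod L, L <> fullv &
      forall L' : {vspace M}, submod L' -> (L <= L')%VS -> L' = L \/ L' = fullv].

(* S is isomorphic to M / rad M *)
Definition is_top M (S : fdmod C) : Prop :=
  exists p : 'Hom(M, S), [/\ is_hom p, surj p &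
    forall x, p x = 0 <-> forall L, maximal_submod L -> x \in L].

Definition simple M : Prop :=
  (exists x : M, x <> 0) /\
  forall L : {vspace M}, submod L -> L = 0%VS \/ L = fullv.

(* Hom_C(M, C) with (f.c)(x) = f(x) c. *)
Section HomReg.
Variable M : fdmod C.
Let H := subvs_of (homs M regmod).

Definition hom_reg_act (f : H) (c : C) : H :=
  vsproj (homs M regmod) (amulr c \o (vsval f : 'Hom(M, C)))%VF.

Lemma hom_reg_actE f c (x : M) :
  (vsval (hom_reg_act f c) : 'Hom(M, C)) x = (vsval f : 'Hom(M, C)) x * c.
Proof.
rewrite vsprojK; first by rewrite comp_lfunE lfunE.
apply/homsP=> a y; have /homsP fh := subvsP f.
by rewrite !comp_lfunE !lfunE /= (fh a y) /= mulrA.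
Qed.

Program Definition hom_reg : rmod C := @RMod k C H hom_reg_act _ _ _ _.
Next Obligation.
move=> f c a b; apply/val_inj/(@lfunP _ M C)=> x /=.
rewrite add_lfunE scale_lfunE !hom_reg_actE.
by rewrite mulrDr scalerAr.
Qed.
Next Obligation.
move=> a c f g; apply/val_inj/(@lfunP _ M C)=> x /=.
rewrite add_lfunE scale_lfunE !hom_reg_actE.
by rewrite add_lfunE scale_lfunE mulrDl scalerAl.
Qed.
Next Obligation.
by move=> f; apply/val_inj/(@lfunP _ M C)=> x /=; rewrite hom_reg_actE mulr1.
Qed.
Next Obligation.
move=> a b f; apply/val_inj/(@lfunP _ M C)=> x /=.
by rewrite !hom_reg_actE mulrA.
Qed.
End HomReg.

(* X is a cokernel of Hom_C(d, C) : Hom_C(P0, C) -> Hom_C(P1, C) for some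
   minimal projective presentation P1 -d-> P0 -> M -> 0. *)
Definition is_transpose M (X : rmod C) : Prop :=
  exists (P1 P0 : fdmod C) (d : 'Hom(P1, P0)) (p : 'Hom(P0, M)),
    min_proj_pres d p /\
    exists q : 'Hom(hom_reg P1, X),
      [/\ forall f c, q (ract f c) = ract (q f) c, surj q &
          forall g : hom_reg P1, q g = 0 <->
            exists f : hom_reg P0,
              vsval g = ((vsval f : 'Hom(P0, regmod)) \o d)%VF].

(* D X = Hom_k(X, k) with (c.f)(x) = f(x c). *)
Program Definition dual (X : rmod C) : fdmod C :=
  @FdMod k C 'Hom(X, k^o) (fun c f => (f \o linfun ((@ract _ _ X)^~ c))%VF)
    _ _ _ _.
Next Obligation.
move=> X f c a b; apply/lfunP=> x.
rewrite add_lfunE scale_lfunE !comp_lfunE !(linfunE (ract_linearl _)).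
by rewrite ract_linearr linearP.
Qed.
Next Obligation.
move=> X a c f g; apply/lfunP=> x.
by rewrite !(add_lfunE, scale_lfunE, comp_lfunE).
Qed.
Next Obligation.
move=> X f; apply/lfunP=> x.
by rewrite comp_lfunE (linfunE (ract_linearl _)) ract1.
Qed.
Next Obligation.
move=> X a b f; apply/lfunP=> x.
by rewrite !comp_lfunE !(linfunE (ract_linearl _)) ractM.
Qed.

(* N is isomorphic to tau M = D Tr M *)
Definition is_tau M N : Prop :=
  exists X : rmod C, is_transpose M X /\ iso N (dual X).

Definition tau_rigid M : Prop := exists N, is_tau M N /\ hom_zero M N.

Definition stau_pair M P : Prop :=
  [/\ projective P, tau_rigid M, hom_zero P M &
      exists m p c, [/\ num_indec M m, num_indec P p, num_indec regmod c
                      & (m + p = c)%N]].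

Definition basic_stau_pair M P : Prop :=
  [/\ stau_pair M P, basic M & basic P].

(* Isomorphism classes are represented as predicates on pairs. *)
Definition stau_tilt : Type :=
  {c : fdmod C -> fdmod C -> Prop |
    exists M P, basic_stau_pair M P /\ c = (fun N Q => iso M N /\ iso P Q)}.

Definition in_class (c : stau_tilt) M P : Prop := sval c M P.

Definition basic_algebra : Prop := basic regmod.

Definition connected_algebra : Prop :=
  forall e : C, e * e = e -> (forall a, e * a = a * e) -> e = 0 \/ e = 1.

End ModuleCategory.

(* Hom_B(U, M) with (a.f)(u) = f(u a). *)
Section HomBimod.
Variables (k : fieldType) (B A : falgType k) (U : bimod B A) (M : fdmod B).
Let H := subvs_of (homs U M).

Definition hom_bimod_act (a : A) (f : H) : H :=
  vsproj (homs U M) (vsval f \o linfun ((@bract _ _ _ U)^~ a))%VF.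

Lemma hom_bimod_actE a f (u : U) :
  vsval (hom_bimod_act a f) u = vsval f (bract u a).
Proof.
rewrite vsprojK; first by rewrite comp_lfunE (linfunE (bract_linearl _)).
apply/homsP=> b x; have /homsP fh := subvsP f.
by rewrite !comp_lfunE !(linfunE (bract_linearl _)) bract_mact fh.
Qed.

Program Definition hom_bimod : fdmod A := @FdMod k A H hom_bimod_act _ _ _ _.
Next Obligation.
move=> f c a b; apply/val_inj/lfunP=> x /=.
rewrite add_lfunE scale_lfunE !hom_bimod_actE.
by rewrite bract_linearr linearP.
Qed.
Next Obligation.
move=> a c f g; apply/val_inj/lfunP=> x /=.
rewrite add_lfunE scale_lfunE !hom_bimod_actE.
by rewrite add_lfunE scale_lfunE.
Qed.
Next Obligation.
by move=> f; apply/val_inj/lfunP=> x /=; rewrite hom_bimod_actE bract1.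
Qed.
Next Obligation.
move=> a b f; apply/val_inj/lfunP=> x /=.
by rewrite !hom_bimod_actE bractM.
Qed.
End HomBimod.

(* X is isomorphic to the B-module U (x)_A M: it carries a universal
   A-balanced bilinear map from U x M, compatible with the B-actions. *)
Definition is_tensor (k : fieldType) (B A : falgType k) (U : bimod B A)
    (M : fdmod A) (X : fdmod B) : Prop :=
  exists t : 'Hom(U, 'Hom(M, X)),
    [/\ forall u a m, t (bract u a) m = t u (mact a m),
        forall b u m, t (mact b u) m = mact b (t u m)
      & forall (Z : vectType k) (s : 'Hom(U, 'Hom(M, Z))),
          (forall u a m, s (bract u a) m = s u (mact a m)) ->
          exists! g : 'Hom(X, Z), forall u m, s u m = g (t u m)].

(* The one-point extension B[P0]: ((b, p), c) is the matrix [b p; 0 c]. *)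
Definition opext (k : fieldType) (B : falgType k) (P0 : fdmod B) : Type :=
  (B * P0 * k^o)%type.

Section OnePointExtension.

Variables (k : fieldType) (B : falgType k) (P0 : fdmod B).
Local Notation A := (opext P0).

HB.instance Definition _ := Vector.copy A (B * P0 * k^o)%type.

Definition opext_one : A := (1, 0, 1).
Definition opext_mul (x y : A) : A :=
  (x.1.1 * y.1.1, mact x.1.1 y.1.2 + (y.2 : k) *: x.1.2,
   (x.2 : k) * (y.2 : k)).

Let actD (b : B) (p q : P0) : mact b (p + q) = mact b p + mact b q.
Proof. by have := mact_linearr b 1 p q; rewrite !scale1r. Qed.
Let act0 (b : B) : mact b 0 = 0 :> P0.
Proof. by apply: (addrI (mact b 0)); rewrite -actD !addr0. Qed.
Let actZ (b : B) c (p : P0) : mact b (c *: p) = c *: mact b p.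
Proof. by have := mact_linearr b c p 0; rewrite act0 !addr0. Qed.
Let actDl (a b : B) (p : P0) : mact (a + b) p = mact a p + mact b p.
Proof. by have := mact_linearl p 1 a b; rewrite !scale1r. Qed.
Let act0l (p : P0) : mact 0 p = 0.
Proof. by apply: (addrI (mact 0 p)); rewrite -actDl !addr0. Qed.
Let actZl c (b : B) (p : P0) : mact (c *: b) p = c *: mact b p.
Proof. by have := mact_linearl p c b 0; rewrite act0l !addr0. Qed.

Fact opext_mulA : associative opext_mul.
Proof.
move=> [[a p] c] [[b q] d] [[b' r] e]; rewrite /opext_mul /=.
congr (_, _, _); rewrite ?mulrA //.
by rewrite actD actZ mactM scalerDr scalerA addrA (mulrC e).
Qed.
Fact opext_mul1r : left_id opext_one opext_mul.
Proof.
by move=> [[a p] c]; rewrite /opext_mul /= !mul1r mact1 scaler0 addr0.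
Qed.
Fact opext_mulr1 : right_id opext_one opext_mul.
Proof.
by move=> [[a p] c]; rewrite /opext_mul /= !mulr1 act0 scale1r add0r.
Qed.
Fact opext_mulDl : left_distributive opext_mul +%R.
Proof.
move=> [[a p] c] [[b q] d] [[b' r] e]; rewrite /opext_mul /=.
by congr (_, _, _); rewrite /= ?mulrDl // actDl scalerDr addrACA.
Qed.
Fact opext_mulDr : right_distributive opext_mul +%R.
Proof.
move=> [[a p] c] [[b q] d] [[b' r] e]; rewrite /opext_mul /=.
by congr (_, _, _); rewrite /= ?mulrDr // actD scalerDl addrACA.
Qed.
Fact opext_one_neq0 : opext_one != 0.
Proof. by apply/eqP=> -[] /eqP; rewrite oner_eq0. Qed.

HB.instance Definition _ := GRing.Zmodule_isNzRing.Build A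
  opext_mulA opext_mul1r opext_mulr1 opext_mulDl opext_mulDr opext_one_neq0.

Fact opext_scalerAl (c : k) (x y : A) : c *: (x * y) = (c *: x) * y.
Proof.
case: x y => [[a p] d] [[b q] e]; congr (_, _, _) => /=.
- by rewrite scalerAl.
- by rewrite actZl scalerDr !scalerA mulrC.
- exact: mulrA.
Qed.
HB.instance Definition _ := GRing.Lmodule_isLalgebra.Build k A opext_scalerAl.

Fact opext_scalerAr (c : k) (x y : A) : c *: (x * y) = x * (c *: y).
Proof.
case: x y => [[a p] d] [[b q] e]; congr (_, _, _) => /=.
- by rewrite scalerAr.
- by rewrite actZ scalerDr scalerA.
- exact: mulrCA.
Qed.
HB.instance Definition _ := GRing.Lalgebra_isAlgebra.Build k A opext_scalerAr.
HB.instance Definition _ := Algebra_isFalgebra.Build k A.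

(* mod B -> mod A along the projection A -> B *)
Program Definition inflate (M : fdmod B) : fdmod A :=
  @FdMod k A M (fun a x => mact a.1.1 x) _ _ _ _.
Next Obligation. by move=> M x c a b /=; rewrite mact_linearl. Qed.
Next Obligation. by move=> M a; exact: mact_linearr. Qed.
Next Obligation. by move=> M x; exact: mact1. Qed.
Next Obligation. by move=> M a b x; exact: mactM. Qed.

Definition opext_incl (b : B) : A := (b, 0, 0).
Definition eB : A := opext_incl 1.

Let inclM a b : opext_incl (a * b) = opext_incl a * opext_incl b.
Proof. by congr (_, _, _); rewrite /= ?act0 ?scaler0 ?addr0 ?mulr0. Qed.
Let inclL : linear opext_incl.
Proof. by move=> c a b; congr (_, _, _); rewrite /= ?scaler0 ?addr0. Qed.

(* U = e_B A *)
Definition eBA : {vspace A} := limg (amull eB).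

Let eBA_P x : reflect (eB * x = x) (x \in eBA).
Proof.
apply: (iffP memv_imgP) => [[y _ ->] | <-]; last first.
  by exists x; rewrite ?memvf // lfunE.
by rewrite lfunE /= mulrA -inclM mulr1.
Qed.

Definition U_lact (b : B) (u : subvs_of eBA) : subvs_of eBA :=
  vsproj eBA (opext_incl b * vsval u).
Definition U_ract (u : subvs_of eBA) (a : A) : subvs_of eBA :=
  vsproj eBA (vsval u * a).

Lemma U_lactE b u : vsval (U_lact b u) = opext_incl b * vsval u.
Proof. by apply/vsprojK/eBA_P; rewrite mulrA -inclM mul1r. Qed.
Lemma U_ractE u a : vsval (U_ract u a) = vsval u * a.
Proof. by apply/vsprojK/eBA_P; rewrite mulrA (eBA_P _ (subvsP u)). Qed.

Program Definition U_left : fdmod B :=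
  @FdMod k B (subvs_of eBA) U_lact _ _ _ _.
Next Obligation.
move=> x c a b; apply/val_inj; rewrite /= !U_lactE.
by rewrite inclL mulrDl scalerAl.
Qed.
Next Obligation.
move=> a c x y; apply/val_inj; rewrite /= !U_lactE.
by rewrite mulrDr scalerAr.
Qed.
Next Obligation.
by move=> x; apply/val_inj; rewrite /= U_lactE (eBA_P _ (subvsP x)).
Qed.
Next Obligation.
by move=> a b x; apply/val_inj; rewrite /= !U_lactE inclM mulrA.
Qed.

Program Definition U : bimod B A := @BiMod k B A U_left U_ract _ _ _ _ _.
Next Obligation.
move=> x c a b; apply/val_inj; rewrite /= !U_ractE.
by rewrite mulrDr scalerAr.
Qed.
Next Obligation.
move=> a c x y; apply/val_inj; rewrite /= !U_ractE.
by rewrite mulrDl scalerAl.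
Qed.
Next Obligation. by move=> x; apply/val_inj; rewrite /= U_ractE mulr1. Qed.
Next Obligation.
by move=> a b x; apply/val_inj; rewrite /= !U_ractE mulrA.
Qed.
Next Obligation.
by move=> b x a; apply/val_inj; rewrite /= !(U_ractE, U_lactE) mulrA.
Qed.

Definition functE (M : fdmod B) : fdmod A := hom_bimod U M.

Definition is_functR (T : fdmod A) (X : fdmod B) : Prop := is_tensor U T X.

Definition is_Ptilde (Pt : fdmod A) : Prop :=
  [/\ indecomposable Pt, projective Pt &
      forall Q : fdmod B, projective Q -> ~ iso Pt (inflate Q)].

Definition is_That (T : fdmod A) (That : fdmod B) : Prop :=
  [/\ basic That, tau_rigid That &
      exists X, is_functR T X /\ same_add That X].

Definition is_Pstar (Pt P : fdmod A) (Pstar : fdmod B) : Prop :=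
  projective Pstar /\
  (iso P (inflate Pstar) \/ iso P (dsum (inflate Pstar) Pt)).

End OnePointExtension.

(* Main.v *)
(* An A-module is a triple (X, V, P0 (x) V -> X), and R and E are the adjoint
   functors (X, V) |-> X and M |-> (M, Hom(P0, M)). The condition
   Hom(N, tau M) = 0 means that for a minimal projective presentation
   d : P1 -> Q0 of M every map P1 -> N factors through d. Over A the module P1
   has no part at the new vertex, so R and the adjunction carry this condition
   from A to B and back; this gives tau-rigidity in both directions. For e the
   number of summands is immediate. For r it rests on g-vectors: those of the
   indecomposable summands of a tau-rigid pair are linearly independent, so over A
   they form a basis, and R maps them onto a spanning set of K_0(proj B) that lies
   in the span of the g-vectors of the restricted pair.
   Linear independence is elementary: in a tau-rigid family some member X has a
   proper submodule K, generated by the family, that contains the image of every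
   non-invertible map from the family to X. The functional
   dim Hom(-, X) - dim Hom(-, K) is linear in g-vectors and isolates X. *)

Require Import Defs.
From mathcomp Require Import all_boot all_algebra all_field.
From mathcomp Require Import boolp.

Set Implicit Arguments.
Unset Strict Implicit.
Unset Printing Implicit Defensive.

Import GRing.Theory.
Local Open Scope ring_scope.

(** Two features of [R] shape the development. Next, the count by g-vectors serves only when Ptilde
    is not a summand of P. If it is, Hom(Ptilde, T) = e_oo T vanishes, with e_oo the idempotent at
    the new vertex, so T is already a B-module and both sides of the count drop by one. The
    dimension of Hom(-, N) is linear in g-vectors because Hom(-, N) keeps a presentation exact once
    every map P1 -> N factors through d. As P1 is projective, this passes to quotients of N, which
    is why the test submodule has to be generated by the family. Algebraic closure enters through
    End(Y)/rad End(Y) = k: multiplicities become differences of dimensions of Hom spaces, and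
    Krull-Schmidt becomes a computation with additive functions. *)

Section Linear.
Variable k : fieldType.
Implicit Types U V W : vectType k.

Lemma lfD V W (f : 'Hom(V, W)) x y : f (x + y) = f x + f y.
Proof. exact: linearD. Qed.
Lemma lfB V W (f : 'Hom(V, W)) x y : f (x - y) = f x - f y.
Proof. exact: linearB. Qed.
Lemma lf0 V W (f : 'Hom(V, W)) : f 0 = 0.
Proof. exact: linear0. Qed.
Lemma lf_sum V W (f : 'Hom(V, W)) I (r : seq I) (P : pred I) (F : I -> V) :
  f (\sum_(i <- r | P i) F i) = \sum_(i <- r | P i) f (F i).
Proof. exact: linear_sum. Qed.

Lemma sub_lfunE V W (f g : 'Hom(V, W)) x : (f - g) x = f x - g x.
Proof. by rewrite add_lfunE opp_lfunE. Qed.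

Lemma surj_limg V W (f : 'Hom(V, W)) : surj f <-> limg f = fullv.
Proof.
split=> [fs | ff y].
  apply/vspaceP=> y; rewrite memvf; have [x <-] := fs y.
  by rewrite memv_img ?memvf.
have: y \in limg f by rewrite ff memvf.
by case/memv_imgP=> x _ ->; exists x.
Qed.

Lemma mem_limg V W (f : 'Hom(V, W)) x : f x \in limg f.
Proof. by rewrite memv_img ?memvf. Qed.

Lemma limg_sub V W (f : 'Hom(V, W)) (L : {vspace W}) :
  (forall x, f x \in L) -> (limg f <= L)%VS.
Proof. by move=> h; apply/subvP=> _ /memv_imgP[x _ ->]. Qed.

Lemma dim_limg V W (f : 'Hom(V, W)) : (\dim (lker f) + \dim (limg f) = dim V)%N.
Proof. by have := limg_ker_dim f fullv; rewrite capfv dimvf. Qed.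

Lemma surj_endo_bij V (f : 'Hom(V, V)) : surj f -> bijective f.
Proof.
move/surj_limg=> ff.
have k0 : lker f == 0%VS.
  by rewrite -dimv_eq0; have := dim_limg f; rewrite ff dimvf addnC -[RHS]addn0 => /addnI/eqP.
exists (f^-1)%VF; [exact: lker0_lfunK | exact: lker0_lfunVK].
Qed.

Lemma inj_endo_bij V (f : 'Hom(V, V)) : injective f -> bijective f.
Proof.
move/lker0P=> k0.
exists (f^-1)%VF; [exact: lker0_lfunK | exact: lker0_lfunVK].
Qed.

Lemma surj_dim_bij V W (f : 'Hom(V, W)) :
  surj f -> (dim V <= dim W)%N -> bijective f.
Proof.
move=> fs le; have ff := (surj_limg f).1 fs.
have k0 : lker f == 0%VS.
  rewrite -dimv_eq0 -leqn0 -(leq_add2r (dim W)) add0n -{1}(dimvf W) -ff.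
  by rewrite dim_limg.
exists (f^-1)%VF; first exact: lker0_lfunK.
by move=> y; rewrite limg_lfunVK // ff memvf.
Qed.

Lemma bij_linv V W (f : 'Hom(V, W)) : bijective f ->
  (forall x, (f^-1)%VF (f x) = x) /\ (forall y, f ((f^-1)%VF y) = y).
Proof.
move=> [g gK fK]; split=> [x | y].
  by apply: lker0_lfunK; apply/lker0P/(can_inj gK).
by apply: limg_lfunVK; rewrite -(fK y) mem_limg.
Qed.

(** A subspace of largest dimension inside [P] contains every [x] in [P], since adding the line of
    [x] stays inside [P]. This turns sets given by a proposition, such as radical maps or the image
    of Hom(d, C), into subspaces. *)
Lemma vspace_of_pred V (P : V -> Prop) :
  P 0 -> (forall c x y, P x -> P y -> P (c *: x + y)) ->
  exists W : {vspace V}, forall x, x \in W <-> P x.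
Proof.
move=> P0 PL.
pose ok n := `[< exists W : {vspace V}, \dim W = n /\ forall x, x \in W -> P x >].
have ok0 : exists n, ok n.
  exists 0%N; apply/asboolP; exists 0%VS; rewrite dimv0; split=> // x.
  by rewrite memv0 => /eqP->.
have okb n : ok n -> (n <= dim V)%N.
  by move=> /asboolP[W [<- _]]; rewrite -(dimvf V) dimvS ?subvf.
case: (ex_maxnP ok0 okb) => n /asboolP[W [dW WP]] nmax.
exists W => x; split=> [/WP //|Px].
have okW : ok (\dim (W + <[x]>)).
  apply/asboolP; exists (W + <[x]>)%VS; split=> // _ /memv_addP[u /WP Pu [_ /vlineP[c ->] ->]].
  by rewrite addrC; apply: PL.
have := nmax _ okW; rewrite -dW => le.
have := dimv_leqif_sup (addvSl W <[x]>); case=> _ /esym.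
rewrite eqn_leq le dimvS ?addvSl // => /subvP-> //.
by apply: (subvP (addvSr _ _)); exact: memv_line.
Qed.

Lemma lfun_ext0 V W (f : 'Hom(V, W)) : (forall x, f x = 0) -> f = 0.
Proof. by move=> h; apply/lfunP=> x; rewrite h lfunE. Qed.

End Linear.

(** * Homomorphisms, direct sums, submodules and retracts *)

Section Modules.
Variables (k : fieldType) (C : falgType k).
Implicit Types M N P Q X Y Z G : fdmod C.

Section Act.
Variable M : fdmod C.
Implicit Types (a b : C) (x y : M).
Lemma mactD a x y : mact a (x + y) = mact a x + mact a y.
Proof. by have := mact_linearr a 1 x y; rewrite !scale1r. Qed.
Lemma mactr0 a : mact a 0 = 0 :> M.
Proof. by apply: (addrI (mact a 0)); rewrite -mactD !addr0. Qed.
Lemma mactZ a c x : mact a (c *: x) = c *: mact a x.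
Proof. by have := mact_linearr a c x 0; rewrite mactr0 !addr0. Qed.
Lemma mactN a x : mact a (- x) = - mact a x.
Proof. by rewrite -!scaleN1r mactZ. Qed.
Lemma mactDl a b x : mact (a + b) x = mact a x + mact b x.
Proof. by have := mact_linearl x 1 a b; rewrite !scale1r. Qed.
Lemma mactl0 x : mact 0 x = 0.
Proof. by apply: (addrI (mact 0 x)); rewrite -mactDl !addr0. Qed.
Lemma mactZl c a x : mact (c *: a) x = c *: mact a x.
Proof. by have := mact_linearl x c a 0; rewrite mactl0 !addr0. Qed.
Definition actl a : 'Hom(M, M) := linfun (mact a).
Lemma actlE a x : actl a x = mact a x.
Proof. exact: (linfunE (mact_linearr a)). Qed.
End Act.

Section HomClosure.
Variables M N : fdmod C.
Implicit Types f g : 'Hom(M, N).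
Lemma is_hom0 : is_hom (0 : 'Hom(M, N)).
Proof. by move=> a x; rewrite !lfunE /= mactr0. Qed.
Lemma is_homD f g : is_hom f -> is_hom g -> is_hom (f + g).
Proof. by move=> hf hg a x; rewrite !add_lfunE hf hg mactD. Qed.
Lemma is_homN f : is_hom f -> is_hom (- f).
Proof. by move=> hf a x; rewrite !opp_lfunE hf mactN. Qed.
Lemma is_homB f g : is_hom f -> is_hom g -> is_hom (f - g).
Proof. by move=> hf hg; apply/is_homD/is_homN. Qed.
Lemma is_homZ c f : is_hom f -> is_hom (c *: f).
Proof. by move=> hf a x; rewrite !scale_lfunE hf mactZ. Qed.
End HomClosure.

Lemma is_hom1 M : is_hom (\1%VF : 'Hom(M, M)).
Proof. by move=> a x; rewrite !lfunE. Qed.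
Lemma is_hom_comp M N P (f : 'Hom(N, P)) (g : 'Hom(M, N)) :
  is_hom f -> is_hom g -> is_hom (f \o g)%VF.
Proof. by move=> hf hg a x; rewrite !comp_lfunE hg hf. Qed.
Lemma is_hom_inv M N (f : 'Hom(M, N)) :
  is_hom f -> bijective f -> is_hom (f^-1)%VF.
Proof.
move=> hf /bij_linv[fK fVK] a y.
by rewrite -{1}(fVK y) -hf fK.
Qed.
Lemma bij_comp_lfun (U V W : vectType k) (f : 'Hom(V, W)) (g : 'Hom(U, V)) :
  bijective f -> bijective g -> bijective (f \o g)%VF.
Proof.
move=> bf bg; apply: (eq_bij (bij_comp bf bg)) => x.
by rewrite comp_lfunE.
Qed.
Lemma bij_inv_lfun (V W : vectType k) (f : 'Hom(V, W)) :
  bijective f -> bijective (f^-1)%VF.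
Proof. by move=> /bij_linv[fK fVK]; exists f. Qed.
Lemma bij_id_lfun (V : vectType k) : bijective (\1%VF : 'Hom(V, V)).
Proof. by exists id => x; rewrite lfunE. Qed.

Lemma iso_refl M : iso M M.
Proof. by exists \1%VF; split; [exact: is_hom1 | exact: bij_id_lfun]. Qed.
Lemma iso_sym M N : iso M N -> iso N M.
Proof.
by move=> [f [hf bf]]; exists (f^-1)%VF; split; [exact: is_hom_inv | exact: bij_inv_lfun].
Qed.
Lemma iso_trans N M P : iso M N -> iso N P -> iso M P.
Proof.
move=> [f [hf bf]] [g [hg bg]]; exists (g \o f)%VF.
by split; [exact: is_hom_comp | exact: bij_comp_lfun].
Qed.

Lemma isoP M N : iso M N <-> exists (f : 'Hom(M, N)) (g : 'Hom(N, M)),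
  [/\ is_hom f, is_hom g, (g \o f = \1)%VF & (f \o g = \1)%VF].
Proof.
split=> [[f [hf bf]] | [f [g [hf hg gf fg]]]].
  exists f, (f^-1)%VF; have [fK fVK] := bij_linv bf.
  split=> //; first exact: is_hom_inv.
    by apply/lfunP=> x; rewrite comp_lfunE lfunE fK.
  by apply/lfunP=> x; rewrite comp_lfunE lfunE fVK.
exists f; split=> //; exists g => x.
  by rewrite -comp_lfunE gf lfunE.
by rewrite -comp_lfunE fg lfunE.
Qed.

(** * Direct sums *)

Section DSum.
Variables M N : fdmod C.
Definition dinl : 'Hom(M, dsum M N) := linfun (fun x : M => ((x, 0) : (M * N)%type)).
Definition dinr : 'Hom(N, dsum M N) := linfun (fun x : N => ((0, x) : (M * N)%type)).
Definition dfst : 'Hom(dsum M N, M) := linfun (fun x : (M * N)%type => x.1).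
Definition dsnd : 'Hom(dsum M N, N) := linfun (fun x : (M * N)%type => x.2).
Lemma dinlE x : dinl x = (x, 0).
Proof. by rewrite linfunE // => c y z; congr (_, _) => /=; rewrite scaler0 addr0. Qed.
Lemma dinrE x : dinr x = (0, x).
Proof. by rewrite linfunE // => c y z; congr (_, _) => /=; rewrite scaler0 addr0. Qed.
Lemma dfstE x : dfst x = x.1.
Proof. by rewrite linfunE. Qed.
Lemma dsndE x : dsnd x = x.2.
Proof. by rewrite linfunE. Qed.
Lemma dinl_hom : is_hom dinl.
Proof. by move=> a x; rewrite !dinlE /= mactr0. Qed.
Lemma dinr_hom : is_hom dinr.
Proof. by move=> a x; rewrite !dinrE /= mactr0. Qed.
Lemma dfst_hom : is_hom dfst.
Proof. by move=> a x; rewrite !dfstE. Qed.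
Lemma dsnd_hom : is_hom dsnd.
Proof. by move=> a x; rewrite !dsndE. Qed.
Lemma dfst_inl : (dfst \o dinl = \1)%VF.
Proof. by apply/lfunP=> x; rewrite comp_lfunE dfstE dinlE lfunE. Qed.
Lemma dsnd_inr : (dsnd \o dinr = \1)%VF.
Proof. by apply/lfunP=> x; rewrite comp_lfunE dsndE dinrE lfunE. Qed.
Lemma dfst_inr : (dfst \o dinr = 0)%VF.
Proof. by apply/lfunP=> x; rewrite comp_lfunE dfstE dinrE lfunE. Qed.
Lemma dsnd_inl : (dsnd \o dinl = 0)%VF.
Proof. by apply/lfunP=> x; rewrite comp_lfunE dsndE dinlE lfunE. Qed.
Lemma dsum_id : ((dinl \o dfst) + (dinr \o dsnd) = \1)%VF.
Proof.
apply/lfunP=> -[x y]; rewrite add_lfunE !comp_lfunE dfstE dsndE dinlE dinrE lfunE.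
by congr (_, _); rewrite /= ?addr0 ?add0r.
Qed.
End DSum.
Arguments dinl {M N}.
Arguments dinr {M N}.
Arguments dfst {M N}.
Arguments dsnd {M N}.

Definition pairh X M N (f : 'Hom(X, M)) (g : 'Hom(X, N)) : 'Hom(X, dsum M N) :=
  ((dinl \o f) + (dinr \o g))%VF.
Definition copairh X M N (f : 'Hom(M, X)) (g : 'Hom(N, X)) : 'Hom(dsum M N, X) :=
  ((f \o dfst) + (g \o dsnd))%VF.
Lemma pairhE X M N (f : 'Hom(X, M)) (g : 'Hom(X, N)) x : pairh f g x = (f x, g x).
Proof.
rewrite add_lfunE !comp_lfunE dinlE dinrE.
by congr (_, _); rewrite /= ?addr0 ?add0r.
Qed.
Lemma copairhE X M N (f : 'Hom(M, X)) (g : 'Hom(N, X)) x :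
  copairh f g x = f x.1 + g x.2.
Proof. by rewrite add_lfunE !comp_lfunE dfstE dsndE. Qed.
Lemma pairh_hom X M N (f : 'Hom(X, M)) (g : 'Hom(X, N)) :
  is_hom f -> is_hom g -> is_hom (pairh f g).
Proof.
by move=> hf hg; apply: is_homD; apply: is_hom_comp => //; [exact: dinl_hom | exact: dinr_hom].
Qed.
Lemma copairh_hom X M N (f : 'Hom(M, X)) (g : 'Hom(N, X)) :
  is_hom f -> is_hom g -> is_hom (copairh f g).
Proof.
by move=> hf hg; apply: is_homD; apply: is_hom_comp => //; [exact: dfst_hom | exact: dsnd_hom].
Qed.

(* The equational form of a direct sum, which additive functors preserve. *)
Lemma iso_dsumP M X Y : iso M (dsum X Y) <->
  exists (i : 'Hom(X, M)) (p : 'Hom(M, X)) (j : 'Hom(Y, M)) (q : 'Hom(M, Y)),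
  [/\ [/\ is_hom i, is_hom p, is_hom j & is_hom q],
      [/\ (p \o i = \1)%VF, (q \o j = \1)%VF, (p \o j = 0)%VF & (q \o i = 0)%VF]
    & ((i \o p) + (j \o q) = \1)%VF].
Proof.
split=> [/isoP[f [g [hf hg gf fg]]] | [i [p [j [q [[hi hp hj hq] [pi qj pj qi] e]]]]]].
  exists (g \o dinl)%VF, (dfst \o f)%VF, (g \o dinr)%VF, (dsnd \o f)%VF.
  have cancel (Z W : vectType k) (u : 'Hom(dsum X Y, W)) (v : 'Hom(Z, dsum X Y)) :
      ((u \o f) \o (g \o v) = u \o v)%VF.
    by rewrite -comp_lfunA [(f \o (_ \o _))%VF]comp_lfunA fg comp_lfun1l.
  split; first by split; apply: is_hom_comp => //;
    [exact: dinl_hom | exact: dfst_hom | exact: dinr_hom | exact: dsnd_hom].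
    by split; rewrite cancel (dfst_inl, dsnd_inr, dfst_inr, dsnd_inl).
  rewrite -!comp_lfunA -comp_lfunDr [(dinl \o _)%VF]comp_lfunA.
  by rewrite [(dinr \o _)%VF]comp_lfunA -comp_lfunDl dsum_id comp_lfun1l.
apply/isoP; exists (pairh p q), (copairh i j).
split; [exact: pairh_hom | exact: copairh_hom | |].
  by apply/lfunP=> x; rewrite comp_lfunE copairhE pairhE /= -e add_lfunE !comp_lfunE.
have [piE qjE] : cancel i p /\ cancel j q.
  by split=> z; rewrite -comp_lfunE (pi, qj) lfunE.
have [pjE qiE] : (forall z, p (j z) = 0) /\ (forall z, q (i z) = 0).
  by split=> z; rewrite -comp_lfunE (pj, qi) lfunE.
apply/lfunP=> -[x y]; rewrite comp_lfunE copairhE pairhE id_lfunE /= !lfD.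
by rewrite piE qjE pjE qiE addr0 add0r.
Qed.

Lemma dsum_iso M M' N N' : iso M M' -> iso N N' -> iso (dsum M N) (dsum M' N').
Proof.
move=> [f [hf [f' fK fK']]] [g [hg [g' gK gK']]].
exists (pairh (f \o dfst) (g \o dsnd))%VF; split.
  by apply: pairh_hom; apply: is_hom_comp => //; [exact: dfst_hom | exact: dsnd_hom].
exists (fun x => (f' x.1, g' x.2)) => -[x y];
  by rewrite pairhE !comp_lfunE dfstE dsndE /= (fK, fK') (gK, gK').
Qed.
Lemma dsumC M N : iso (dsum M N) (dsum N M).
Proof.
exists (pairh dsnd dfst); split.
  by apply: pairh_hom; [exact: dsnd_hom | exact: dfst_hom].
by exists (fun x => (x.2, x.1)) => -[x y]; rewrite pairhE dfstE dsndE.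
Qed.
Lemma dsumA M N P : iso (dsum M (dsum N P)) (dsum (dsum M N) P).
Proof.
exists (pairh (pairh dfst (dfst \o dsnd)) (dsnd \o dsnd))%VF; split.
  by do !apply: pairh_hom; do ?apply: is_hom_comp; (exact: dsnd_hom || exact: dfst_hom).
exists (fun x => (x.1.1, (x.1.2, x.2))) => [[x [y z]] | [[x y] z]];
  by rewrite !pairhE !comp_lfunE !(dsndE, dfstE).
Qed.
Lemma mod0_eq0 (x : mod0 C) : x = 0.
Proof. by apply/rowP; case. Qed.
Lemma dsum0 M : iso (dsum M (mod0 C)) M.
Proof.
exists dfst; split; first exact: dfst_hom.
by exists (fun x => (x, 0)) => [[x y] | x]; rewrite dfstE //= (mod0_eq0 y).
Qed.
Lemma zero_iso M : (forall x : M, x = 0) -> iso M (mod0 C).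
Proof.
move=> h; exists 0; split; first exact: is_hom0.
by exists (fun => 0) => x; [rewrite (h x) | rewrite (mod0_eq0 x) zero_lfunE].
Qed.
Lemma iso0_zero M : iso M (mod0 C) -> forall x : M, x = 0.
Proof.
by move=> [f [hf [g gK _]]] x; apply: (can_inj gK); rewrite lf0 (mod0_eq0 (f x)).
Qed.
Lemma iso_dim M N : iso M N -> dim M = dim N.
Proof.
move=> [f [_ /bij_linv[fK fVK]]]; rewrite -!dimvf -(limg_dim_eq (f := f)).
  by congr (\dim _); apply/surj_limg => y; exists ((f^-1)%VF y).
by apply/eqP; rewrite capfv; apply/lker0P/(can_inj fK).
Qed.
Lemma dim0_zero M : dim M = 0%N -> forall x : M, x = 0.
Proof.
move=> d0 x; apply/eqP; rewrite -memv0.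
suff <- : fullv = 0%VS :> {vspace M} by rewrite memvf.
by apply/eqP; rewrite -dimv_eq0 dimvf d0.
Qed.
Lemma dim_dsum M N : dim (dsum M N) = (dim M + dim N)%N.
Proof. by []. Qed.

Lemma iso_summand X M N : iso M N -> summand X M -> summand X N.
Proof. by move=> /iso_sym mn [Y e]; exists Y; apply: iso_trans mn e. Qed.
Lemma summand_iso X Y M : iso X Y -> summand X M -> summand Y M.
Proof.
move=> xy [Z e]; exists Z; apply: (iso_trans e).
by apply: dsum_iso => //; exact: iso_refl.
Qed.
Lemma summand_dsuml M N : summand M (dsum M N).
Proof. by exists N; exact: iso_refl. Qed.
Lemma summand_dsumr M N : summand N (dsum M N).
Proof. by exists M; exact: dsumC. Qed.
Lemma summand_refl M : summand M M.
Proof. by exists (mod0 C); apply/iso_sym/dsum0. Qed.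
Lemma summand_trans N M P : summand M N -> summand N P -> summand M P.
Proof.
move=> [X e] [Y e']; exists (dsum X Y); apply: (iso_trans e').
apply: (iso_trans (dsum_iso e (iso_refl Y))).
by apply/iso_sym/dsumA.
Qed.

(** * Submodules *)

Section Subm.
Variables (M : fdmod C) (L : {vspace M}) (HL : submod L).
Definition subm_act (a : C) (x : subvs_of L) : subvs_of L := vsproj L (mact a (vsval x)).
Lemma subm_actE a x : vsval (subm_act a x) = mact a (vsval x).
Proof. by rewrite vsprojK // HL // subvsP. Qed.
Fact subm_linearl x : linear (subm_act^~ x).
Proof. by move=> c a b; apply/val_inj; rewrite /= !subm_actE mact_linearl. Qed.
Fact subm_linearr a : linear (subm_act a).
Proof. by move=> c x y; apply/val_inj; rewrite /= !subm_actE mact_linearr. Qed.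
Fact subm_act1 x : subm_act 1 x = x.
Proof. by apply/val_inj; rewrite /= subm_actE mact1. Qed.
Fact subm_actM a b x : subm_act (a * b) x = subm_act a (subm_act b x).
Proof. by apply/val_inj; rewrite /= !subm_actE mactM. Qed.
Definition subm : fdmod C := FdMod subm_linearl subm_linearr subm_act1 subm_actM.

Definition incl : 'Hom(subm, M) := linfun (fun x : subvs_of L => vsval x).
Lemma inclE (x : subvs_of L) : incl x = vsval x.
Proof. by rewrite linfunE. Qed.
Lemma incl_hom : is_hom incl.
Proof. by move=> a x; rewrite !inclE subm_actE. Qed.
Lemma incl_inj : injective incl.
Proof. by move=> x y; rewrite !inclE => /val_inj. Qed.
Lemma limg_incl : limg incl = L.
Proof.
apply/vspaceP=> y; apply/memv_imgP/idP=> [[x _ ->] | yL].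
  by rewrite inclE subvsP.
by exists (vsproj L y); rewrite ?memvf // inclE vsprojK.
Qed.
Definition corestr X (f : 'Hom(X, M)) : 'Hom(X, subm) :=
  ((linfun (vsproj L) : 'Hom(M, subvs_of L)) \o f)%VF.
Lemma corestrE X (f : 'Hom(X, M)) x : f x \in L -> vsval (corestr f x) = f x.
Proof. by move=> h; rewrite comp_lfunE lfunE vsprojK. Qed.
Section Corestr.
Variables (X : fdmod C) (f : 'Hom(X, M)).
Hypothesis fL : forall x, f x \in L.
Lemma incl_corestr : (incl \o corestr f)%VF = f.
Proof. by apply/lfunP=> x; rewrite comp_lfunE inclE corestrE. Qed.
Lemma corestr_hom : is_hom f -> is_hom (corestr f).
Proof. by move=> hf a x; apply/val_inj; rewrite /= subm_actE !corestrE. Qed.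
End Corestr.
Lemma dim_subm : dim subm = \dim L.
Proof. by []. Qed.
End Subm.

Lemma submod_limg M N (f : 'Hom(M, N)) : is_hom f -> submod (limg f).
Proof. by move=> hf a _ /memv_imgP[x _ ->]; rewrite -hf mem_limg. Qed.
Lemma submod_lker M N (f : 'Hom(M, N)) : is_hom f -> submod (lker f).
Proof. by move=> hf a x; rewrite !memv_ker hf => /eqP->; rewrite mactr0. Qed.
Lemma submod_add M (L L' : {vspace M}) : submod L -> submod L' -> submod (L + L').
Proof.
move=> h h' a _ /memv_addP[x xL [y yL ->]].
by rewrite mactD memv_add ?h ?h'.
Qed.

Lemma internal_dsum M (L L' : {vspace M}) (hL : submod L) (hL' : submod L') :
  (L :&: L' = 0)%VS -> (L + L' = fullv)%VS -> iso M (dsum (subm hL) (subm hL')).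
Proof.
move=> c0 cf; apply: iso_sym; exists (copairh (incl hL) (incl hL')).
split; first by apply: copairh_hom; exact: incl_hom.
apply: surj_dim_bij; last first.
  by rewrite dim_dsum !dim_subm -dimv_disjoint_sum // cf dimvf.
move=> y; have: y \in (L + L')%VS by rewrite cf memvf.
case/memv_addP=> u uL [v vL ->]; exists (vsproj L u, vsproj L' v).
by rewrite copairhE !inclE !vsprojK.
Qed.

(** With [r'] the map [r] followed by the inverse of [r \o i], [M] splits as the image of [i] plus
    the kernel of [r']. *)
Lemma retract_summand X M (i : 'Hom(X, M)) (r : 'Hom(M, X)) :
  is_hom i -> is_hom r -> bijective (r \o i)%VF -> summand X M.
Proof.
move=> hi hr /bij_linv[bK bVK]; set b := (r \o i)%VF in bK bVK.
have hbV : is_hom (b^-1)%VF.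
  by apply: is_hom_inv; [exact: is_hom_comp | exists (b^-1)%VF].
pose r' := (b^-1 \o r)%VF; have r'i x : r' (i x) = x by rewrite comp_lfunE -[r (i x)]comp_lfunE bK.
have hr' : is_hom r' by exact: is_hom_comp.
exists (subm (submod_lker hr')); apply: iso_trans (dsum_iso _ (iso_refl _)).
  apply: (internal_dsum (submod_limg hi)).
    apply/eqP; rewrite -subv0; apply/subvP=> _ /memv_capP[/memv_imgP[x _ ->]].
    by rewrite memv_ker r'i => /eqP->; rewrite lf0 mem0v.
  apply/vspaceP=> y; rewrite memvf; apply/memv_addP.
  exists (i (r' y)); first exact: mem_limg.
  exists (y - i (r' y)); last by rewrite addrC subrK.
  by rewrite memv_ker lfB r'i subrr.
apply: iso_sym; exists (corestr (submod_limg hi) i).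
split; first by apply: corestr_hom => // x; exact: mem_limg.
exists (fun y => r' (vsval y)) => [x | y].
  by rewrite corestrE ?mem_limg.
apply: val_inj; rewrite /= corestrE ?mem_limg //.
by case/memv_imgP: (subvsP y) => x _ ->; rewrite r'i.
Qed.

Lemma summandP X M : summand X M <-> exists (i : 'Hom(X, M)) (r : 'Hom(M, X)),
  [/\ is_hom i, is_hom r & (r \o i = \1)%VF].
Proof.
split=> [[Y /iso_dsumP[i [p [j [q [[hi hp _ _] [pi _ _ _] _]]]]]] | [i [r [hi hr e]]]].
  by exists i, p.
by apply: (retract_summand hi hr); rewrite e; exact: bij_id_lfun.
Qed.

End Modules.
Arguments dinl {k C M N}.
Arguments dinr {k C M N}.
Arguments dfst {k C M N}.
Arguments dsnd {k C M N}.
Arguments incl_hom {k C M L} HL.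
#[export] Hint Resolve is_hom0 is_homD is_homB is_homN is_hom_comp is_hom1 : core.
#[export] Hint Resolve dinl_hom dinr_hom dfst_hom dsnd_hom pairh_hom copairh_hom : core.
#[export] Hint Resolve incl_hom iso_refl : core.

(** * Fitting's lemma for a linear endomorphism *)

Section Fitting.
Variable k : fieldType.
Implicit Types V : vectType k.

Definition lpow V (f : 'Hom(V, V)) n : 'Hom(V, V) := iter n (fun g => f \o g)%VF \1%VF.

Lemma lpowD V (f : 'Hom(V, V)) m n x : lpow f (m + n) x = lpow f m (lpow f n x).
Proof.
elim: m => [|m IH]; first by rewrite add0n id_lfunE.
by rewrite addSn /= !comp_lfunE IH.
Qed.

(** Take a positive power of least rank; its square has the same rank, hence the same kernel, so
    kernel and image meet in 0. The exponent is a successor so that the power kills ker f and has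
    its image inside im f; both facts are used later. *)
Lemma fitting V (f : 'Hom(V, V)) : exists n,
  (lker (lpow f n.+1) :&: limg (lpow f n.+1) = 0)%VS /\
  (lker (lpow f n.+1) + limg (lpow f n.+1) = fullv)%VS.
Proof.
pose ok m := `[< exists n, \dim (limg (lpow f n.+1)) = m >].
have ok_ex : exists m, ok m by exists (\dim (limg (lpow f 1))); apply/asboolP; exists 0%N.
case: (ex_minnP ok_ex) => m /asboolP[n dn] mmin; exists n.
set g := lpow f n.+1 in dn *.
have ggE x : lpow f (n + n.+1).+1 x = g (g x) by rewrite -addSn lpowD.
have le : (\dim (limg g) <= \dim (limg (lpow f (n + n.+1).+1)))%N.
  by rewrite dn; apply: mmin; apply/asboolP; exists (n + n.+1)%N.
have kk : lker (lpow f (n + n.+1).+1) = lker g.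
  apply/esym/eqP; rewrite eqEdim; apply/andP; split.
    by apply/subvP=> x; rewrite !memv_ker ggE => /eqP->; rewrite lf0.
  by rewrite -(leq_add2r (\dim (limg g))) dim_limg -(dim_limg (lpow f (n + n.+1).+1)) leq_add2l.
have c0 : (lker g :&: limg g = 0)%VS.
  apply/eqP; rewrite -subv0; apply/subvP=> y /memv_capP[h /memv_imgP[x _ e]].
  move: h; rewrite e memv_ker -ggE -memv_ker kk memv_ker => /eqP->.
  by rewrite mem0v.
split=> //; apply/eqP; rewrite eqEdim subvf /=.
by rewrite dimv_disjoint_sum // dim_limg dimvf.
Qed.

Lemma nil_one_sub V (f : 'Hom(V, V)) n : lpow f n = 0 -> bijective (\1 - f)%VF.
Proof.
move=> fn0; apply: inj_endo_bij => x y /eqP; rewrite -subr_eq0 -lfB => /eqP.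
rewrite sub_lfunE id_lfunE => /eqP; rewrite subr_eq0 => /eqP e.
have: forall m, lpow f m (x - y) = x - y.
  by elim=> [|m IH] /=; rewrite ?id_lfunE // comp_lfunE IH -e.
by move/(_ n); rewrite fn0 zero_lfunE => /esym/eqP; rewrite subr_eq0 => /eqP.
Qed.

End Fitting.

(** * Local endomorphism rings, projectives, presentations, and the vanishing of Hom(N, tau M) *)

Section Projective.
Variables (k : fieldType) (C : falgType k).
Implicit Types M N P Q X Y Z G : fdmod C.

Lemma lpow_hom M (f : 'Hom(M, M)) n : is_hom f -> is_hom (lpow f n).
Proof. by move=> hf; elim: n => [|n IH] /=; auto. Qed.

Lemma indec_endo Y (f : 'Hom(Y, Y)) : indecomposable Y -> is_hom f ->
  bijective f \/ exists n, lpow f n = 0.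
Proof.
move=> [_ Yi] hf; have [n [c0 cf]] := fitting f.
have hg := lpow_hom n.+1 hf; set g := lpow f n.+1 in c0 cf hg.
have [/iso0_zero z | /iso0_zero z] :=
  Yi _ _ (internal_dsum (submod_lker hg) (submod_limg hg) c0 cf).
  left; apply: inj_endo_bij => x y /eqP; rewrite -subr_eq0 -lfB => /eqP e.
  have h : x - y \in lker g.
    by rewrite memv_ker /g -addn1 lpowD /= comp_lfunE id_lfunE e lf0.
  by apply/eqP; rewrite -subr_eq0 -(vsprojK h) (z (vsproj _ _)) linear0.
right; exists n.+1; apply/lfun_ext0=> x.
by rewrite -(vsprojK (mem_limg g x)) (z (vsproj _ _)) linear0.
Qed.

(** Put u = (f + g)^-1 f. If u is not bijective it is nilpotent, and then 1 - u = (f + g)^-1 g is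
    bijective. *)
Lemma indec_local Y (f g : 'Hom(Y, Y)) : indecomposable Y -> is_hom f -> is_hom g ->
  bijective (f + g) -> bijective f \/ bijective g.
Proof.
move=> Yi hf hg bfg; have [fgK fgVK] := bij_linv bfg.
have hV : is_hom ((f + g)^-1)%VF by apply: is_hom_inv; auto.
have [|bf|[n nf]] := indec_endo Yi (f := ((f + g)^-1 \o f)%VF); auto.
  left; have := bij_comp_lfun bfg bf; congr bijective; apply: funext => x.
  by rewrite !comp_lfunE fgVK.
right; have := bij_comp_lfun bfg (nil_one_sub nf); congr bijective; apply: funext => x.
rewrite comp_lfunE sub_lfunE id_lfunE comp_lfunE lfB fgVK.
by rewrite add_lfunE addrAC subrr add0r.
Qed.

Lemma proj_lift P M N (v : 'Hom(M, N)) (f : 'Hom(P, N)) :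
  projective P -> is_hom v -> is_hom f -> (limg f <= limg v)%VS ->
  exists h : 'Hom(P, M), is_hom h /\ (v \o h)%VF = f.
Proof.
move=> Pp hv hf /subvP le; pose I := submod_limg hv.
have fI x : f x \in limg v by apply: le; exact: mem_limg.
have vI x : v x \in limg v by exact: mem_limg.
have [|||h [hh e]] := Pp _ _ (corestr I v) (corestr I f).
- exact: corestr_hom.
- move=> y; case/memv_imgP: (subvsP y) => x _ e; exists x.
  by apply: val_inj; rewrite /= corestrE.
- exact: corestr_hom.
exists h; split=> //.
by rewrite -(incl_corestr I vI) -comp_lfunA e (incl_corestr I fI).
Qed.

Lemma projective_retract X P (i : 'Hom(X, P)) (r : 'Hom(P, X)) :
  is_hom i -> is_hom r -> (r \o i = \1)%VF -> projective P -> projective X.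
Proof.
move=> hi hr e Pp M N g f hg gs hf.
have [|h [hh eh]] := Pp _ _ g (f \o r)%VF hg gs; first by auto.
by exists (h \o i)%VF; split; [auto | rewrite comp_lfunA eh -comp_lfunA e comp_lfun1r].
Qed.

Lemma projective_summand X P : summand X P -> projective P -> projective X.
Proof. by move=> /summandP[i [r [hi hr e]]]; exact: (projective_retract hi hr e). Qed.

Lemma projective_iso X P : iso X P -> projective P -> projective X.
Proof.
by move=> e; apply: projective_summand; exact: summand_iso (iso_sym e) (summand_refl P).
Qed.

Lemma projective_dsum P Q : projective P -> projective Q -> projective (dsum P Q).
Proof.
move=> Pp Qp M N g f hg gs hf.
have [|h1 [hh1 e1]] := Pp _ _ g (f \o dinl)%VF hg gs; first by auto.
have [|h2 [hh2 e2]] := Qp _ _ g (f \o dinr)%VF hg gs; first by auto.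
exists (copairh h1 h2); split; first by auto.
rewrite comp_lfunDr !comp_lfunA e1 e2 -!comp_lfunA -comp_lfunDr dsum_id.
by rewrite comp_lfun1r.
Qed.

Lemma projective0 : projective (mod0 C).
Proof.
move=> M N g f hg gs hf; exists 0; split; first exact: is_hom0.
by apply/lfunP=> x; rewrite (mod0_eq0 x) !lf0.
Qed.

Definition genh M (x : M) : 'Hom(regmod C, M) := linfun (fun a : C => mact a x).
Lemma genhE M (x : M) a : genh x a = mact a x.
Proof. exact: (linfunE (mact_linearl x)). Qed.
Lemma genh_hom M (x : M) : is_hom (genh x).
Proof. by move=> a b; rewrite !genhE /= mactM. Qed.

Lemma projective_reg : projective (regmod C).
Proof.
move=> M N g f hg gs hf; have [x ex] := gs (f (1 : C)).
exists (genh x); split; first exact: genh_hom.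
apply/lfunP=> a; rewrite comp_lfunE genhE hg ex -hf /=.
by rewrite mulr1.
Qed.

Definition freemod n : fdmod C := iter n (dsum (regmod C)) (mod0 C).

Lemma projective_free n : projective (freemod n).
Proof.
by elim: n => [|n IH]; [exact: projective0 | exact: projective_dsum projective_reg IH].
Qed.

Lemma free_cover M : exists n (f : 'Hom(freemod n, M)), is_hom f /\ surj f.
Proof.
have H (s : seq M) : exists n (f : 'Hom(freemod n, M)), is_hom f /\ {subset s <= limg f}.
  elim: s => [|x s [n [f [hf fs]]]].
    by exists 0%N, 0; split; [exact: is_hom0 | move=> ?].
  exists n.+1, (copairh (genh x) f); split; first by apply: copairh_hom; [exact: genh_hom|].
  move=> y; rewrite inE => /predU1P[->|/fs/memv_imgP[z _ ->]].
    have e : copairh (genh x) f ((1 : C), 0) = x.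
      by rewrite copairhE /= lf0 addr0 genhE mact1.
    by rewrite -{1}e mem_limg.
  have -> : f z = copairh (genh x) f ((0 : C), z) by rewrite copairhE /= lf0 add0r.
  exact: mem_limg.
have [n [f [hf fs]]] := H (vbasis {:M}); exists n, f; split=> //.
apply/surj_limg/eqP; rewrite eqEsubv subvf -(span_basis (vbasisP {:M})).
exact/span_subvP.
Qed.

Lemma projective_summand_free P : projective P -> exists n, summand P (freemod n).
Proof.
move=> Pp; have [n [f [hf fs]]] := free_cover P.
have [|s [hs e]] := Pp _ _ f \1%VF hf fs; first by auto.
by exists n; apply/summandP; exists s, f.
Qed.

Lemma dual_basis P : projective P -> exists s : seq ('Hom(P, regmod C) * P),
  (forall u, u \in s -> is_hom u.1) /\
  forall x, x = \sum_(u <- s) mact (u.1 x : C) u.2.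
Proof.
move=> Pp; have [n /summandP[i [r [hi hr e]]]] := projective_summand_free Pp.
have [s [sh sE]] : exists s : seq ('Hom(freemod n, regmod C) * freemod n),
  (forall u, u \in s -> is_hom u.1) /\
  forall x, x = \sum_(u <- s) mact (u.1 x : C) u.2.
  elim: n {i r hi hr e} => [|n [s [sh sE]]].
    by exists [::]; split=> // x; rewrite big_nil (mod0_eq0 x).
  pose F := dsum (regmod C) (freemod n).
  pose u0 : 'Hom(F, regmod C) * F := (dfst, @dinl _ _ (regmod C) (freemod n) (1 : C)).
  pose up (u : 'Hom(freemod n, regmod C) * freemod n) : 'Hom(F, regmod C) * F :=
    ((u.1 \o dsnd)%VF, dinr u.2).
  exists (u0 :: [seq up u | u <- s]); split=> [u|[a y]].
    by rewrite inE => /predU1P[->|/mapP[v /sh hv ->]] /=; auto.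
  rewrite big_cons big_map.
  have -> : \sum_(u <- s) mact ((up u).1 (a, y) : C) (up u).2 =
            dinr (\sum_(u <- s) mact (u.1 y : C) u.2).
    rewrite lf_sum; apply: eq_bigr => u _.
    by rewrite [(up u).1]/= [(up u).2]/= comp_lfunE dsndE dinr_hom.
  have -> : mact (u0.1 (a, y) : C) u0.2 = @dinl _ _ (regmod C) (freemod n) a.
    by rewrite /u0 [u0.1]/= dfstE -dinl_hom /= mulr1.
  rewrite -sE dinrE dinlE; congr (_, _) => /=; by rewrite ?addr0 ?add0r.
exists [seq ((u.1 \o i)%VF, r u.2) | u <- s]; split=> [u|x].
  by case/mapP=> v /sh hv -> /=; auto.
rewrite big_map -[LHS](id_lfunE x) -e comp_lfunE {1}(sE (i x)) lf_sum.
by apply: eq_bigr => u _; rewrite hr comp_lfunE.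
Qed.

(** * Projective covers and presentations *)

Lemma superfluous_surj M N P (p : 'Hom(P, N)) (h : 'Hom(M, P)) :
  is_hom h -> superfluous (lker p) -> (limg p <= limg (p \o h))%VS -> surj h.
Proof.
move=> hh sp /subvP le; apply/surj_limg/sp; first exact: submod_limg.
apply/vspaceP=> x; rewrite memvf; have /le/memv_imgP[y _ ey] := mem_limg p x.
apply/memv_addP; exists (h y); first exact: mem_limg.
exists (x - h y); last by rewrite addrC subrK.
by rewrite memv_ker lfB ey comp_lfunE subrr.
Qed.

Lemma superfluous_endo N P (p : 'Hom(P, N)) (h : 'Hom(P, P)) :
  is_hom h -> superfluous (lker p) -> (p \o h)%VF = p -> bijective h.
Proof.
by move=> hh sp e; apply/surj_endo_bij/(superfluous_surj hh sp); rewrite e subvv.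
Qed.

(** A projective of least dimension mapping onto [M] is a projective cover. *)
Lemma proj_cover M : exists P (p : 'Hom(P, M)),
  [/\ projective P, is_hom p, surj p & superfluous (lker p)].
Proof.
pose ok n := `[< exists P (p : 'Hom(P, M)),
  [/\ projective P, is_hom p, surj p & dim P = n] >].
have ok_ex : exists n, ok n.
  have [n [f [hf fs]]] := free_cover M; exists (dim (freemod n)).
  by apply/asboolP; exists (freemod n), f; split=> //; exact: projective_free.
case: (ex_minnP ok_ex) => n /asboolP[P [p [Pp hp ps dP]]] nmin.
exists P, p; split=> // L hL LK.
(* As L + ker p is everything, [p] restricted to [L] is still onto, so [p] lifts through [L]. The
   result is an endomorphism [f] of [P] with image in [L] and p f = p. *)
have [|h [hh eh]] := proj_lift Pp (is_hom_comp hp (incl_hom hL)) hp.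
  apply/subvP=> y _; have [x <-] := ps y.
  have: x \in (L + lker p)%VS by rewrite LK memvf.
  case/memv_addP=> u uL [v]; rewrite memv_ker => /eqP pv ->.
  rewrite lfD pv addr0; have -> : p u = (p \o incl hL)%VF (vsproj L u).
    by rewrite comp_lfunE inclE vsprojK.
  exact: mem_limg.
pose f := (incl hL \o h)%VF; have hf : is_hom f by rewrite /f; auto.
have pf x : p (f x) = p x by rewrite -comp_lfunE comp_lfunA eh.
have [m [c0 cf]] := fitting f; have hg := lpow_hom m.+1 hf.
set g := lpow f m.+1 in c0 cf hg.
have pg x : p (g x) = p x.
  by rewrite /g; elim: m.+1 x => [|j IH] x /=; rewrite ?id_lfunE // comp_lfunE pf IH.
have e := internal_dsum (submod_limg hg) (submod_lker hg) (etrans (capvC _ _) c0)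
  (etrans (addvC _ _) cf).
have sm : summand (subm (submod_limg hg)) P by exists (subm (submod_lker hg)).
have gL : (limg g <= L)%VS.
  by apply: limg_sub => x; rewrite /g /= comp_lfunE comp_lfunE inclE subvsP.
(* The stable image of [f] is a summand of [P], hence projective, and still maps onto [M].
   Minimality of [dim P] makes it, and therefore [L], everything. *)
have : ok (\dim (limg g)).
  apply/asboolP; exists _, (p \o incl (submod_limg hg))%VF; split; auto.
    exact: projective_summand sm Pp.
  move=> y; have [x <-] := ps y; exists (vsproj _ (g x)).
  by rewrite comp_lfunE inclE vsprojK ?mem_limg // pg.
move/nmin; rewrite -dP -dimvf => le; apply/eqP.
by rewrite eqEdim subvf (leq_trans le) // dimvS.
Qed.

Definition pres P1 P0 M (d : 'Hom(P1, P0)) (p : 'Hom(P0, M)) : Prop :=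
  [/\ projective P1 /\ projective P0, is_hom d /\ is_hom p & surj p /\ limg d = lker p].

Lemma min_pres M : exists P1 P0 (d : 'Hom(P1, P0)) (p : 'Hom(P0, M)), min_proj_pres d p.
Proof.
have [P0 [p [P0p hp ps sp]]] := proj_cover M.
have [P1 [q [P1p hq qs sq]]] := proj_cover (subm (submod_lker hp)).
exists P1, P0, (incl (submod_lker hp) \o q)%VF, p; split; [by [] | by auto | |].
  split=> //; rewrite limg_comp; move/surj_limg: qs => ->; exact: limg_incl.
split=> //; suff -> : lker (incl (submod_lker hp) \o q)%VF = lker q by [].
apply/vspaceP=> x; rewrite !memv_ker comp_lfunE -(inj_eq (@incl_inj _ _ _ _ (submod_lker hp))).
by rewrite lf0.
Qed.

Lemma min_presW P1 P0 M (d : 'Hom(P1, P0)) (p : 'Hom(P0, M)) :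
  min_proj_pres d p -> pres d p.
Proof. by case. Qed.

Definition rig P1 P0 (d : 'Hom(P1, P0)) N : Prop :=
  forall h : 'Hom(P1, N), is_hom h -> exists f : 'Hom(P0, N), is_hom f /\ h = (f \o d)%VF.

(* Let a : d' -> d and b : d -> d' lift r and i. Then 1 - a b is homotopic to an
   endomorphism z of P1 with image in ker d; as ker d is superfluous, 1 - z is
   invertible, and d (1 - z) = d. *)
Lemma rig_retract X M P1 P0 Q1 Q0 (i : 'Hom(X, M)) (r : 'Hom(M, X))
    (d : 'Hom(P1, P0)) (p : 'Hom(P0, X)) (d' : 'Hom(Q1, Q0)) (p' : 'Hom(Q0, M)) N :
  is_hom i -> is_hom r -> (r \o i = \1)%VF ->
  pres d p -> superfluous (lker d) -> pres d' p' -> rig d' N -> rig d N.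
Proof.
move=> hi hr ri [[P1p P0p] [hd hp] [ps dk]] sd [[Q1p Q0p] [hd' hp'] [ps' dk']] rg h hh.
have pd x : p (d x) = 0 by apply/eqP; rewrite -memv_ker -dk mem_limg.
have pd' x : p' (d' x) = 0 by apply/eqP; rewrite -memv_ker -dk' mem_limg.
have [|a0 [ha0 ea0]] := Q0p _ _ p (r \o p')%VF hp ps; first by auto.
have [|b0 [hb0 eb0]] := P0p _ _ p' (i \o p)%VF hp' ps'; first by auto.
have a0E x : p (a0 x) = r (p' x) by rewrite -comp_lfunE ea0 comp_lfunE.
have b0E x : p' (b0 x) = i (p x) by rewrite -comp_lfunE eb0 comp_lfunE.
have riE x : r (i x) = x by rewrite -comp_lfunE ri id_lfunE.
have [|||a1 [ha1 ea1]] := proj_lift Q1p (v := d) (f := (a0 \o d')%VF); auto.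
  by rewrite dk; apply: limg_sub => x; rewrite memv_ker comp_lfunE a0E pd' lf0.
have [|||b1 [hb1 eb1]] := proj_lift P1p (v := d') (f := (b0 \o d)%VF); auto.
  by rewrite dk'; apply: limg_sub => x; rewrite memv_ker comp_lfunE b0E pd lf0.
have [|||s [hs es]] := proj_lift P0p (v := d) (f := (\1 - (a0 \o b0))%VF); auto.
  rewrite dk; apply: limg_sub => x; rewrite memv_ker sub_lfunE comp_lfunE id_lfunE.
  by rewrite lfB a0E b0E riE subrr.
pose z := (\1 - (a1 \o b1) - (s \o d))%VF; have hz : is_hom z by rewrite /z; auto 7.
have a1E x : d (a1 x) = a0 (d' x) by rewrite -comp_lfunE ea1 comp_lfunE.
have b1E x : d' (b1 x) = b0 (d x) by rewrite -comp_lfunE eb1 comp_lfunE.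
have sE x : d (s x) = x - a0 (b0 x).
  by rewrite -comp_lfunE es sub_lfunE comp_lfunE id_lfunE.
have zE x : z x = x - a1 (b1 x) - s (d x).
  by rewrite !sub_lfunE !comp_lfunE id_lfunE.
have dz x : d (z x) = 0.
  by rewrite zE !lfB a1E b1E sE subrr.
pose u := (\1 - z)%VF; have hu : is_hom u by rewrite /u; auto.
have uE x : u x = x - z x by rewrite sub_lfunE id_lfunE.
have ud : (d \o u)%VF = d by apply/lfunP=> x; rewrite comp_lfunE uE lfB dz subr0.
have bu : bijective u := superfluous_endo hu sd ud.
have [uK uVK] := bij_linv bu; clearbody u.
have [|f [hf ef]] := rg (h \o a1)%VF; first by auto.
exists ((f \o b0) + (h \o s))%VF; split; first by auto.
(* Here u y = a1 (b1 y) + s (d y) and d (u y) = d y, while [h \o a1] factors through [d']; so [h] is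
   computed on the vectors u y, which are all vectors. *)
apply/lfunP=> x; rewrite -(uVK x); set y := (u^-1)%VF x.
rewrite !(comp_lfunE, add_lfunE).
have -> : d (u y) = d y by rewrite -comp_lfunE ud.
rewrite -b1E -[f _]comp_lfunE -ef comp_lfunE uE zE opprB opprB addrA.
by rewrite -lfD; congr (h _); rewrite addrC addrA subrK addrC.
Qed.

(* Equivalent to Hom(N, tau M) = 0, but independent of a choice of tau M. *)
Definition trig M N : Prop := exists P1 P0 (d : 'Hom(P1, P0)) (p : 'Hom(P0, M)),
  pres d p /\ rig d N.

(** The presentation hidden in [trig] is arbitrary. Summands of [P1] mapped to zero only make
    factorization harder, and superfluity of ker d excludes them, so [rig] descends to such a
    presentation. *)
Lemma trig_pres X M P1 P0 (d : 'Hom(P1, P0)) (p : 'Hom(P0, X)) N :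
  summand X M -> pres d p -> superfluous (lker d) -> trig M N -> rig d N.
Proof.
move=> /summandP[i [r [hi hr ri]]] dp sd [Q1 [Q0 [d' [p' [dp' rg]]]]].
exact: (rig_retract hi hr ri dp sd dp').
Qed.

Lemma trig_summand X M N : summand X M -> trig M N -> trig X N.
Proof.
move=> sm t; have [P1 [P0 [d [p dp]]]] := min_pres X.
exists P1, P0, d, p; split; first exact: min_presW.
by case: dp (min_presW dp) => _ _ _ [_ sd] dp'; exact: trig_pres sm dp' sd t.
Qed.

(** Lift [h] along [g] by projectivity of [P1], factor the lift through [d], and compose with
    [g]. *)
Lemma rig_surj P1 P0 (d : 'Hom(P1, P0)) N N' (g : 'Hom(N, N')) :
  projective P1 -> is_hom g -> surj g -> rig d N -> rig d N'.
Proof.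
move=> P1p hg gs rg h hh; have [h' [hh' e]] := P1p _ _ g h hg gs hh.
have [f [hf ef]] := rg _ hh'; exists (g \o f)%VF; split; first by auto.
by rewrite -comp_lfunA -ef e.
Qed.

Lemma trig_surj M N N' (g : 'Hom(N, N')) : is_hom g -> surj g -> trig M N -> trig M N'.
Proof.
move=> hg gs [P1 [P0 [d [p [dp rg]]]]]; exists P1, P0, d, p; split=> //.
by apply: rig_surj hg gs rg; case: dp => -[].
Qed.

Lemma rig_dsum P1 P0 (d : 'Hom(P1, P0)) N N' : rig d N -> rig d N' -> rig d (dsum N N').
Proof.
move=> r r' h hh.
have [|f [hf ef]] := r (dfst \o h)%VF; first by auto.
have [|f' [hf' ef']] := r' (dsnd \o h)%VF; first by auto.
exists (pairh f f'); split; first by auto.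
apply/lfunP=> x; rewrite comp_lfunE pairhE -!comp_lfunE -ef -ef' !comp_lfunE dfstE dsndE.
by case: (h x).
Qed.

(** The two hypotheses may come from different presentations of [M]; both are first moved to one
    minimal presentation. *)
Lemma trig_dsum M N N' : trig M N -> trig M N' -> trig M (dsum N N').
Proof.
move=> t t'; have [P1 [P0 [d [p dp]]]] := min_pres M.
have sd : superfluous (lker d) by case: dp => _ _ _ [].
exists P1, P0, d, p; split; first exact: min_presW.
by apply: rig_dsum; exact: trig_pres (summand_refl M) (min_presW dp) sd _.
Qed.

Lemma surj_summand X M : summand X M -> exists g : 'Hom(M, X), is_hom g /\ surj g.
Proof.
move=> /summandP[i [r [hi hr ri]]]; exists r; split=> // y.
by exists (i y); rewrite -comp_lfunE ri id_lfunE.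
Qed.

Lemma trig_summandr M N N' : summand N' N -> trig M N -> trig M N'.
Proof. by move=> /surj_summand[g [hg gs]]; exact: trig_surj gs. Qed.

Lemma trig_isol M M' N : iso M M' -> trig M N -> trig M' N.
Proof. by move=> e; apply: trig_summand; exact: summand_iso e (summand_refl M). Qed.
Lemma trig_isor M N N' : iso N N' -> trig M N -> trig M N'.
Proof. by move=> e; apply: trig_summandr; exact: summand_iso e (summand_refl N). Qed.

End Projective.

(** * Composition operators on spaces of linear maps *)

Section Composition.
Variable k : fieldType.
Implicit Types U V W : vectType k.

Definition postc U V W (g : 'Hom(V, W)) : 'Hom('Hom(U, V), 'Hom(U, W)) :=
  linfun (fun f : 'Hom(U, V) => (g \o f)%VF).
Lemma postcE U V W (g : 'Hom(V, W)) (f : 'Hom(U, V)) : postc U g f = (g \o f)%VF.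
Proof.
by rewrite linfunE // => c x y; rewrite comp_lfunDr comp_lfunZr.
Qed.
Definition prec U V W (g : 'Hom(U, V)) : 'Hom('Hom(V, W), 'Hom(U, W)) :=
  linfun (fun f : 'Hom(V, W) => (f \o g)%VF).
Lemma precE U V W (g : 'Hom(U, V)) (f : 'Hom(V, W)) : prec W g f = (f \o g)%VF.
Proof.
by rewrite linfunE // => c x y; rewrite comp_lfunDl comp_lfunZl.
Qed.

Lemma dim_img_inj V W (f : 'Hom(V, W)) (U : {vspace V}) :
  {in U, forall x, f x = 0 -> x = 0} -> \dim (f @: U) = \dim U.
Proof.
move=> h; apply: limg_dim_eq; apply/eqP; rewrite -subv0; apply/subvP=> x /memv_capP[xU].
by rewrite memv_ker => /eqP/(h x xU)->; rewrite mem0v.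
Qed.

Lemma dim_inj_le V W (f : 'Hom(V, W)) (U : {vspace V}) (U' : {vspace W}) :
  {in U, forall x, f x \in U'} -> {in U, forall x, f x = 0 -> x = 0} ->
  (\dim U <= \dim U')%N.
Proof.
move=> h1 /dim_img_inj <-; apply: dimvS; apply/subvP=> _ /memv_imgP[x xU ->].
exact: h1.
Qed.

End Composition.

Section EigenVector.
Import VectorInternalTheory.
Variable k : closedFieldType.

Lemma eigenvector (V : vectType k) (f : 'Hom(V, V)) : dim V != 0%N ->
  exists c x, x != 0 /\ f x = c *: x.
Proof.
move=> dV; pose A := f2mx f.
have [c rc] : exists c, root (char_poly A) c.
  by apply/closed_rootP; rewrite size_char_poly eqSS.
move: rc; rewrite -eigenvalue_root_char => /eigenvalueP[v ev v0].
exists c, (r2v v); split; first by apply: contra v0 => /eqP e; rewrite -[v]r2vK e linear0.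
by rewrite unlock /= r2vK ev linearZ.
Qed.

End EigenVector.

(** * Multiplicities of indecomposables and the Krull-Schmidt theorem *)

Section KrullSchmidt.
Variables (k : closedFieldType) (C : falgType k).
Implicit Types M N P Q X Y Z G : fdmod C.

Definition dimhom M N : nat := \dim (homs M N).

(** The maps that are not split monomorphisms. For indecomposable [Y] this is the radical of Hom(Y,
    M), a subspace because End(Y) is local. *)
Definition radical Y M (f : 'Hom(Y, M)) : Prop :=
  is_hom f /\ forall g : 'Hom(M, Y), is_hom g -> ~ bijective (g \o f)%VF.

Lemma indec_not0 Y : indecomposable Y -> ~ bijective (0 : 'Hom(Y, Y)).
Proof.
by move=> [[x nx] _] [g gK _]; apply: nx; apply: (can_inj gK); rewrite !zero_lfunE.
Qed.

Lemma indec_dim Y : indecomposable Y -> dim Y != 0%N.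
Proof. by move=> [[x nx] _]; apply/eqP=> /dim0_zero/(_ x). Qed.

Lemma radical0 Y M : indecomposable Y -> radical (0 : 'Hom(Y, M)).
Proof.
move=> Yi; split=> [|g hg]; first exact: is_hom0.
by rewrite comp_lfun0r; exact: indec_not0.
Qed.

Lemma radicalD Y M (f f' : 'Hom(Y, M)) : indecomposable Y ->
  radical f -> radical f' -> radical (f + f').
Proof.
move=> Yi [hf rf] [hf' rf']; split=> [|g hg]; first by auto.
rewrite comp_lfunDr => b.
by have [||/rf|/rf'] := indec_local Yi _ _ b; auto.
Qed.

Lemma radicalZ Y M (f : 'Hom(Y, M)) c : radical f -> radical (c *: f).
Proof.
move=> [hf rf]; split=> [|g hg]; first exact: is_homZ.
by rewrite -comp_lfunZr comp_lfunZl; apply: rf; exact: is_homZ.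
Qed.

Lemma radv_ex Y M : exists W : {vspace 'Hom(Y, M)},
  indecomposable Y -> forall f, f \in W <-> radical f.
Proof.
have [Yi|nY] := pselect (indecomposable Y); last by exists 0%VS.
have [|c x y rx ry|W hW] := @vspace_of_pred _ 'Hom(Y, M) (@radical Y M).
- exact: radical0.
- by apply: radicalD => //; exact: radicalZ.
by exists W.
Qed.

Definition radv Y M := sval (cid (radv_ex Y M)).
Lemma radvP Y M (f : 'Hom(Y, M)) : indecomposable Y -> f \in radv Y M <-> radical f.
Proof. by move=> Yi; apply: (svalP (cid (radv_ex Y M)) Yi). Qed.

(* For Y indecomposable this is the multiplicity of Y in M, because
   End(Y)/rad End(Y) = k; for other Y the space radv Y M is arbitrary. *)
Definition mu Y M : nat := (\dim (homs Y M) - \dim (radv Y M))%N.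

Lemma radv_sub Y M : indecomposable Y -> (radv Y M <= homs Y M)%VS.
Proof. by move=> Yi; apply/subvP=> f /(radvP _ Yi)[hf _]; apply/homsP. Qed.

(** Subspaces compatible with the two projections are left arbitrary, so that the formula applies
    both to all homomorphisms and to the radical ones. *)
Lemma dim_hom_dsum Y M N (W : {vspace 'Hom(Y, dsum M N)})
    (W1 : {vspace 'Hom(Y, M)}) (W2 : {vspace 'Hom(Y, N)}) :
  (forall f, f \in W <-> (dfst \o f)%VF \in W1 /\ (dsnd \o f)%VF \in W2) ->
  \dim W = (\dim W1 + \dim W2)%N.
Proof.
move=> hW; pose T1 := @postc _ Y _ _ (@dinl _ _ M N); pose T2 := @postc _ Y _ _ (@dinr _ _ M N).
have i1 : {in W1, forall x, T1 x = 0 -> x = 0}.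
  move=> x _ e; rewrite -[x]comp_lfun1l -(dfst_inl M N) -comp_lfunA.
  by move: e; rewrite postcE => ->; rewrite comp_lfun0r.
have i2 : {in W2, forall x, T2 x = 0 -> x = 0}.
  move=> x _ e; rewrite -[x]comp_lfun1l -(dsnd_inr M N) -comp_lfunA.
  by move: e; rewrite postcE => ->; rewrite comp_lfun0r.
rewrite -(dim_img_inj i1) -(dim_img_inj i2) -dimv_disjoint_sum.
  congr (\dim _); apply/vspaceP=> f; apply/idP/memv_addP.
    move=> /hW[f1 f2]; exists (T1 (dfst \o f)%VF); first exact: memv_img.
    exists (T2 (dsnd \o f)%VF); first exact: memv_img.
    by rewrite !postcE !comp_lfunA -comp_lfunDl dsum_id comp_lfun1l.
  move=> [_ /memv_imgP[x xW ->] [_ /memv_imgP[y yW ->] ->]]; apply/hW.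
  rewrite !postcE !comp_lfunDr !comp_lfunA dfst_inl dsnd_inr dfst_inr dsnd_inl.
  by rewrite !comp_lfun1l !comp_lfun0l addr0 add0r.
apply/eqP; rewrite -subv0; apply/subvP=> f /memv_capP[/memv_imgP[x xW ->] /memv_imgP[y yW e]].
rewrite memv0; apply/eqP; suff -> : x = 0 by rewrite lf0.
rewrite -[x]comp_lfun1l -(dfst_inl M N) -comp_lfunA; move: e; rewrite !postcE => ->.
by rewrite comp_lfunA dfst_inr comp_lfun0l.
Qed.

Lemma dsum_homE Y M N (f : 'Hom(Y, dsum M N)) :
  f = ((dinl \o (dfst \o f)) + (dinr \o (dsnd \o f)))%VF.
Proof. by rewrite !comp_lfunA -comp_lfunDl dsum_id comp_lfun1l. Qed.

Lemma mu_dsum Y M N : indecomposable Y -> mu Y (dsum M N) = (mu Y M + mu Y N)%N.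
Proof.
move=> Yi; rewrite /mu (@dim_hom_dsum Y M N _ (homs Y M) (homs Y N)).
  rewrite (@dim_hom_dsum Y M N _ (radv Y M) (radv Y N)).
    by rewrite subnDA addnC -addnBA ?dimvS ?radv_sub // addnC -addnBA ?dimvS ?radv_sub.
  move=> f; split=> [/(radvP _ Yi)[hf rf] | [/(radvP _ Yi)[hf rf] /(radvP _ Yi)[hg rg]]].
    by split; apply/(radvP _ Yi); split; auto => g hg; rewrite comp_lfunA; auto.
  apply/(radvP _ Yi); rewrite (dsum_homE f); split=> [|g hh]; first by auto.
  rewrite comp_lfunDr => b; rewrite !(comp_lfunA g) in b.
  have [||/rf|/rg] := indec_local Yi _ _ b; auto.
move=> f; split=> [/homsP hf|[/homsP hf /homsP hg]]; last first.
  by apply/homsP; rewrite (dsum_homE f); auto.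
by split; apply/homsP; auto.
Qed.

Lemma dim_homs_iso Y M N (f : 'Hom(M, N)) (W : {vspace 'Hom(Y, M)}) (W' : {vspace 'Hom(Y, N)}) :
  bijective f -> (forall g, g \in W -> (f \o g)%VF \in W') -> (\dim W <= \dim W')%N.
Proof.
move=> /bij_linv[fK _] h; apply: (@dim_inj_le _ _ _ (postc Y f)) => [g gW | g gW].
  by rewrite postcE h.
rewrite postcE => e; apply/lfunP=> x; rewrite zero_lfunE -(fK (g x)).
by rewrite -[f (g x)]comp_lfunE e zero_lfunE lf0.
Qed.

Lemma mu_iso Y M N : indecomposable Y -> iso M N -> mu Y M = mu Y N.
Proof.
move=> Yi; suff h M' N' (f : 'Hom(M', N')) : is_hom f -> bijective f ->
    (dimhom Y M' <= dimhom Y N' /\ \dim (radv Y M') <= \dim (radv Y N'))%N.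
  move=> [f [hf bf]]; have [a b] := h _ _ _ hf bf.
  have [a' b'] := h _ _ _ (is_hom_inv hf bf) (bij_inv_lfun bf).
  rewrite /mu; congr (_ - _)%N; apply/eqP; rewrite eqn_leq.
    by rewrite [X in (X && _)]a.
  by rewrite b.
move=> hf bf; split; apply: (dim_homs_iso bf) => g.
  by move/homsP=> hg; apply/homsP; auto.
move/(radvP _ Yi)=> [hg rg]; apply/(radvP _ Yi); split=> [|u hu]; first by auto.
by rewrite comp_lfunA; apply: rg; auto.
Qed.

(** Over an algebraically closed field every endomorphism f has an eigenvalue c. As f - c kills a
    nonzero vector it is radical, so End(Y) is its radical plus the line of the identity. *)
Lemma mu_self Y : indecomposable Y -> mu Y Y = 1%N.
Proof.
move=> Yi; rewrite /mu.
have -> : homs Y Y = (radv Y Y + <[\1%VF]>)%VS.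
  apply/vspaceP=> f; apply/idP/memv_addP=> [/homsP hf | [g /(radvP _ Yi)[hg _] [_ /vlineP[c ->] ->]]].
    have [c [x [x0 e]]] := eigenvector f (indec_dim Yi).
    exists (f - c *: \1%VF); last first.
      by exists (c *: \1%VF); rewrite ?memvZ ?memv_line // subrK.
    apply/(radvP _ Yi); split=> [|g hg [g' gK _]]; first by apply: is_homB => //; exact: is_homZ.
    case/eqP: x0; apply: (can_inj gK).
    by rewrite !comp_lfunE sub_lfunE scale_lfunE id_lfunE e subrr !lf0.
  by apply/homsP/is_homD => //; exact: is_homZ.
rewrite dimv_disjoint_sum.
  have i1 : (\1%VF : 'Hom(Y, Y)) != 0.
    by apply/eqP=> e; apply: (indec_not0 Yi); rewrite -e; exact: bij_id_lfun.
  by rewrite dim_vline i1 addnC addnK.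
apply/eqP; rewrite -subv0; apply/subvP=> f /memv_capP[/(radvP _ Yi)[_ rf] /vlineP[c e]].
have [c0|c0] := eqVneq c 0; first by rewrite e c0 scale0r mem0v.
case: (rf (c^-1 *: \1%VF)); first exact: is_homZ.
rewrite e -comp_lfunZl -comp_lfunZr scalerA mulVf // scale1r comp_lfun1l.
exact: bij_id_lfun.
Qed.

Lemma indec_summand_iso X Y : indecomposable X -> indecomposable Y -> summand Y X -> iso Y X.
Proof.
move=> [_ Xi] [[y ny] _] [Z e]; have [/iso0_zero/(_ y)//|z] := Xi _ _ e.
apply: iso_sym; apply: (iso_trans e); apply: iso_trans (dsum0 Y).
by apply: dsum_iso; [exact: iso_refl|].
Qed.

Lemma mu_indec X Y : indecomposable X -> indecomposable Y -> mu Y X = `[< iso Y X >].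
Proof.
move=> Xi Yi; case: asboolP => [e|ne]; first by rewrite -(mu_iso Yi e) mu_self.
apply/eqP; rewrite subn_eq0 dimvS //; apply/subvP=> f /homsP hf.
apply/(radvP _ Yi); split=> // g hg b; apply: ne.
exact/indec_summand_iso/(retract_summand hf hg).
Qed.

Lemma mu_gt0 Y M : indecomposable Y -> (0 < mu Y M)%N <-> summand Y M.
Proof.
move=> Yi; split=> [|[Z e]]; last by rewrite (mu_iso Yi e) mu_dsum // mu_self.
rewrite subn_gt0 => lt.
have /subvPn[f /homsP hf nf] : ~~ (homs Y M <= radv Y M)%VS.
  by apply: contraL lt => /dimvS; rewrite -leqNgt.
have [[g [hg bg]]|h] := pselect (exists g : 'Hom(M, Y), is_hom g /\ bijective (g \o f)%VF).
  exact: (retract_summand hf hg).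
by case/negP: nf; apply/(radvP _ Yi); split=> // g hg bg; apply: h; exists g.
Qed.

Lemma mu_eq0 Y M : indecomposable Y -> mu Y M = 0%N <-> ~ summand Y M.
Proof.
by move=> Yi; rewrite -mu_gt0 // lt0n; split=> [->|/negP]; rewrite ?negbK // => /eqP.
Qed.

Lemma mu0 Y : indecomposable Y -> mu Y (mod0 C) = 0%N.
Proof.
move=> Yi; have := mu_iso Yi (dsum0 (mod0 C)); rewrite mu_dsum // => /eqP.
by rewrite -[X in _ == X]addn0 eqn_add2l => /eqP.
Qed.

Lemma indec_iso X Y : iso X Y -> indecomposable X -> indecomposable Y.
Proof.
move=> e [[x nx] Xi]; split.
  have [f [_ [g gK _]]] := e; exists (f x) => fx; apply: nx.
  by rewrite -(gK x) fx -(lf0 f) gK.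
by move=> Z W e'; apply: Xi; exact: iso_trans e e'.
Qed.

Lemma zeroP M : (forall x : M, x = 0) \/ exists x : M, x <> 0.
Proof.
have [h|h] := pselect (exists x : M, x <> 0); [by right | left=> x].
by apply: contra_notP h => nx; exists x.
Qed.

Lemma indec_summand_ex M : (exists x : M, x <> 0) -> exists Y, indecomposable Y /\ summand Y M.
Proof.
elim/ltn_ind: (dim M) {-2}M (erefl (dim M)) => n IH {}M dM M0.
have [Mi|nM] := pselect (indecomposable M); first by exists M; split=> //; exact: summand_refl.
have [X [Z [e nX nZ]]] : exists X Z, [/\ iso M (dsum X Z), ~ iso X (mod0 C) & ~ iso Z (mod0 C)].
  apply: contra_notP nM => h; split=> // X Z e; apply: contra_notP h => /not_orP[nX nZ].
  by exists X, Z.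
have Z0 : dim Z != 0%N by apply/eqP=> /dim0_zero/zero_iso.
have [||Y [Yi YX]] := IH (dim X) _ X (erefl _).
- by rewrite -dM (iso_dim e) dim_dsum -[ltnLHS]addn0 ltn_add2l lt0n.
- by have [/zero_iso|//] := zeroP X.
exists Y; split=> //; apply: (summand_trans YX); exists Z.
exact: e.
Qed.

(** Splitting off an indecomposable summand lowers the dimension. With this induction most facts on
    decompositions need no indexed families of summands. *)
Lemma KS_ind (Pr : fdmod C -> Prop) :
  Pr (mod0 C) -> (forall Y M, indecomposable Y -> Pr M -> Pr (dsum Y M)) ->
  (forall M N, iso M N -> Pr M -> Pr N) -> forall M, Pr M.
Proof.
move=> P0 PD Pi M; elim/ltn_ind: (dim M) {-2}M (erefl (dim M)) => n IH {}M dM.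
have [/zero_iso/iso_sym e|/indec_summand_ex[Y [Yi [Z e]]]] := zeroP M; first exact: Pi e P0.
apply: Pi (iso_sym e) _; apply: PD => //; apply: (IH (dim Z)) => //.
by rewrite -dM (iso_dim e) dim_dsum -[ltnLHS]add0n ltn_add2r lt0n indec_dim.
Qed.

(** An indecomposable summand of [M] has positive multiplicity in [N], so it splits off both sides
    and the inequality survives. Equal multiplicities then give the uniqueness half of
    Krull-Schmidt. *)
Lemma mu_le_summand M N : (forall Y, indecomposable Y -> (mu Y M <= mu Y N)%N) -> summand M N.
Proof.
elim/KS_ind: M N => [N _|Y M Yi IH N le|M M' e IH N le].
- by exists N; apply/iso_sym; apply: iso_trans (dsumC _ _) (dsum0 _).
- have : (0 < mu Y N)%N by apply: leq_trans (le _ Yi); rewrite mu_dsum // mu_self.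
  case/(mu_gt0 _ Yi) => N' e; have [|Z e'] := IH N'.
    by move=> X Xi; have := le X Xi; rewrite (mu_iso Xi e) !mu_dsum // leq_add2l.
  exists Z; apply: (iso_trans e); apply: iso_trans (dsumA _ _ _).
  by apply: dsum_iso; [exact: iso_refl|].
apply: (summand_iso e); apply: IH => Y Yi; rewrite (mu_iso Yi e); exact: le.
Qed.

Lemma mu_eq_iso M N : (forall Y, indecomposable Y -> mu Y M = mu Y N) -> iso M N.
Proof.
move=> h; have [Z e] : summand M N by apply: mu_le_summand => Y Yi; rewrite h.
apply: iso_sym; apply: (iso_trans e); apply: iso_trans (dsum0 M).
apply: dsum_iso; first exact: iso_refl.
have [/zero_iso//|/indec_summand_ex[Y [Yi /(mu_gt0 _ Yi)]]] := zeroP Z.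
have := h _ Yi; rewrite (mu_iso Yi e) mu_dsum // => /eqP.
by rewrite -[X in X == _]addn0 eqn_add2l => /eqP <-.
Qed.

Lemma dsum_cancel M N Z : iso (dsum M Z) (dsum N Z) -> iso M N.
Proof.
move=> e; apply: mu_eq_iso => Y Yi; have := mu_iso Yi e; rewrite !mu_dsum // => /eqP.
by rewrite eqn_add2r => /eqP.
Qed.

Lemma summand_dsum_indec Y M N : indecomposable Y ->
  summand Y (dsum M N) -> summand Y M \/ summand Y N.
Proof.
by move=> Yi; rewrite -!mu_gt0 // mu_dsum // addn_gt0 => /orP.
Qed.

Lemma not_summand0 Y : indecomposable Y -> ~ summand Y (mod0 C).
Proof. by move=> Yi; apply/(mu_eq0 _ Yi)/mu0. Qed.

Lemma KS_summand_ind (Pr : fdmod C -> Prop) M :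
  Pr (mod0 C) -> (forall X Y, Pr X -> Pr Y -> Pr (dsum X Y)) ->
  (forall X Y, iso X Y -> Pr X -> Pr Y) ->
  (forall Y, indecomposable Y -> summand Y M -> Pr Y) -> Pr M.
Proof.
move=> P0 PD Pi; elim/KS_ind: M => [//|Y M Yi IH h|M N e IH h].
  apply: PD; first by apply: h => //; exact: summand_dsuml.
  by apply: IH => Z Zi s; apply: h => //; exact: summand_trans s (summand_dsumr _ _).
by apply: (Pi _ _ e); apply: IH => Y Yi s; apply: h => //; exact: iso_summand e s.
Qed.

Lemma mu_isol Y Y' M : indecomposable Y -> iso Y Y' -> mu Y M = mu Y' M.
Proof.
move=> Yi e; have Yi' := indec_iso e Yi.
elim/KS_ind: M => [|X M Xi IH|M N e' IH]; first by rewrite !mu0.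
  rewrite !mu_dsum // IH !(mu_indec Xi) //; congr (nat_of_bool _ + _)%N.
  by apply: asbool_equiv_eq; split=> h; [apply: iso_trans (iso_sym e) h | apply: iso_trans e h].
by rewrite -!(mu_iso _ e').
Qed.

Section AdditiveInvariant.
Variable (V : zmodType).
(** Equivalently, a homomorphism from the split Grothendieck group of modules to [V]. *)
Definition additive_inv (phi : fdmod C -> V) : Prop :=
  (forall M N, iso M N -> phi M = phi N) /\ (forall M N, phi (dsum M N) = phi M + phi N).

Lemma additive_inv0 phi : additive_inv phi -> phi (mod0 C) = 0.
Proof.
move=> [pi pD]; apply: (addrI (phi (mod0 C))).
by rewrite -pD addr0; apply: pi; exact: dsum0.
Qed.

Lemma additive_inv_ext phi psi M : additive_inv phi -> additive_inv psi ->
  (forall Y, indecomposable Y -> summand Y M -> phi Y = psi Y) -> phi M = psi M.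
Proof.
move=> ap as_ h; apply: (@KS_summand_ind (fun M => phi M = psi M)) h.
- by rewrite !additive_inv0.
- by move=> X Y eX eY; rewrite ap.2 as_.2 eX eY.
by move=> X Y e eX; rewrite -(ap.1 _ _ e) -(as_.1 _ _ e).
Qed.

Lemma additive_inv_sum phi n (X : 'I_n -> fdmod C) M : additive_inv phi ->
  (forall i, indecomposable (X i)) -> (forall i j, iso (X i) (X j) -> i = j) ->
  (forall Y, indecomposable Y -> summand Y M -> exists i, iso Y (X i)) ->
  phi M = \sum_i phi (X i) *+ mu (X i) M.
Proof.
move=> ap Xi Xn h; apply: (additive_inv_ext (psi := fun M => \sum_i phi (X i) *+ mu (X i) M)) => //.
  split=> [N N' e|N N'].
    by apply: eq_bigr => i _; rewrite (mu_iso (Xi i) e).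
  by rewrite -big_split; apply: eq_bigr => i _; rewrite mu_dsum // mulrnDr.
move=> Y Yi /(h _ Yi)[i e]; rewrite (bigD1 i) //= big1 ?addr0.
  by rewrite mu_indec //; case: asboolP => [_|[]]; [exact: ap.1 | exact: iso_sym].
move=> j ji; rewrite mu_indec //; case: asboolP => // e'.
by case/eqP: ji; apply: Xn; exact: iso_trans e' e.
Qed.
End AdditiveInvariant.

Lemma mu_ext (phi : fdmod C -> nat) Y M : indecomposable Y ->
  (forall M N, iso M N -> phi M = phi N) ->
  (forall M N, phi (dsum M N) = phi M + phi N)%N ->
  (forall X, indecomposable X -> summand X M -> phi X = mu Y X) -> phi M = mu Y M.
Proof.
(* Additive invariants take values in a group, hence the passage from [nat] to [int]. *)
move=> Yi pi pD h; apply/eqP; rewrite -(Num.Theory.eqr_nat int); apply/eqP.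
apply: (additive_inv_ext (phi := fun M => (phi M)%:R) (psi := fun M => (mu Y M)%:R)).
- by split=> X Z; [move/pi-> | rewrite pD natrD].
- by split=> X Z; [move/(mu_iso Yi)-> | rewrite mu_dsum // natrD].
by move=> X Xi s; rewrite h.
Qed.

Lemma mu_big Y n (X : 'I_n -> fdmod C) : indecomposable Y ->
  mu Y (\big[@dsum k C/mod0 C]_(i < n) X i) = (\sum_(i < n) mu Y (X i))%N.
Proof.
move=> Yi; elim: n X => [|n IH] X; first by rewrite !big_ord0 mu0.
by rewrite !big_ord_recl mu_dsum // IH.
Qed.

Lemma decomposition M : exists n (X : 'I_n -> fdmod C),
  (forall i, indecomposable (X i)) /\ iso M (\big[@dsum k C/mod0 C]_(i < n) X i).
Proof.
elim/KS_ind: M => [|Y M Yi [n [X [Xi e]]]|M N e [n [X [Xi e']]]].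
- by exists 0%N, (fun _ => mod0 C); rewrite big_ord0; split=> [[]|]//; exact: iso_refl.
- exists n.+1, (fun i => if unlift ord0 i is Some j then X j else Y); split=> [i|].
    by case: unliftP.
  rewrite big_ord_recl; apply: dsum_iso; first by rewrite unlift_none; exact: iso_refl.
  apply: (iso_trans e); rewrite [Z in iso _ Z](eq_bigr X) => [|i _]; last by rewrite liftK.
  exact: iso_refl.
by exists n, X; split=> //; exact: iso_trans (iso_sym e) e'.
Qed.

Lemma basicP M : basic M <-> forall Y, indecomposable Y -> (mu Y M <= 1)%N.
Proof.
split=> [[n [X [Xi Xn e]]] Y Yi | h].
  rewrite (mu_iso Yi e) mu_big //.
  have [[i ei]|h] := pselect (exists i, iso Y (X i)).
    rewrite (bigD1 i) //= big1 ?addn0 ?mu_indec ?leq_b1 // => j ji.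
    rewrite mu_indec //; case: asboolP => // ej; case/eqP: ji; apply: Xn.
    exact: iso_trans (iso_sym ej) ei.
  by rewrite big1 // => i _; rewrite mu_indec //; case: asboolP => // e'; case: h; exists i.
have [n [X [Xi e]]] := decomposition M; exists n, X; split=> // i j eij.
apply/eqP; apply: contraT => ne; have := h _ (Xi i).
rewrite (mu_iso (Xi i) e) mu_big // (bigD1 i) //= (bigD1 j) 1?eq_sym //=.
rewrite mu_self // mu_indec //; case: asboolP => // _.
Qed.

Lemma basic_iso M N : iso M N -> basic M -> basic N.
Proof. by move=> e /basicP h; apply/basicP=> Y Yi; rewrite -(mu_iso Yi e) h. Qed.

Lemma basic_support_iso M N : basic M -> basic N ->
  (forall Y, indecomposable Y -> summand Y M <-> summand Y N) -> iso M N.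
Proof.
move=> /basicP bM /basicP bN h; apply: mu_eq_iso => Y Yi.
have := h _ Yi; rewrite -!mu_gt0 //; move: (bM _ Yi) (bN _ Yi).
by case: (mu Y M) => [|[]] //; case: (mu Y N) => [|[]] // _ _ [a b]; [have := b isT | have := a isT].
Qed.

(** An indecomposable is added only if it is not yet a summand. Applied to [R T] this produces the
    basic module of the map [r]. *)
Lemma basic_part M : exists N, basic N /\
  (forall Y, indecomposable Y -> summand Y N <-> summand Y M).
Proof.
elim/KS_ind: M => [|Y M Yi [N [bN h]]|M M' e [N [bN h]]].
- by exists (mod0 C); split=> //; apply/basicP=> Y Yi; rewrite mu0.
- have [s|ns] := pselect (summand Y N).
    exists N; split=> // X Xi; rewrite h //; split=> [s'|/(summand_dsum_indec Xi)[s'|//]].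
      exact: summand_trans s' (summand_dsumr _ _).
    apply/h => //; exact: summand_iso (iso_sym (indec_summand_iso Yi Xi s')) s.
  exists (dsum Y N); split.
    apply/basicP=> X Xi; rewrite mu_dsum // mu_indec //; case: asboolP => [e|_].
      by rewrite (mu_isol _ Xi e) ((mu_eq0 _ Yi).2 ns).
    by rewrite add0n; apply: (basicP N).1.
  move=> X Xi; rewrite -!mu_gt0 // !mu_dsum // !addn_gt0.
  by split=> /orP[->//|/(mu_gt0 _ Xi)/(h _ Xi)/(mu_gt0 _ Xi)->]; rewrite orbT.
exists N; split=> // Y Yi; rewrite h //; split; first exact: iso_summand.
by apply: iso_summand; exact: iso_sym.
Qed.

Lemma num_indec_ex M : exists n, num_indec M n.
Proof.
have [N [bN hN]] := basic_part M; case: (bN) => n [X [Xi Xn e]].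
exists n, X; split=> // [i|Y Yi /(hN _ Yi)/(mu_gt0 _ Yi)].
  split=> //; apply/(hN _ (Xi i))/(mu_gt0 _ (Xi i)).
  by rewrite (mu_iso (Xi i) e) mu_big // (bigD1 i) //= mu_self.
rewrite (mu_iso Yi e) mu_big // => h; apply: contrapT => ne; move: h.
rewrite big1 // => i _; rewrite mu_indec //; case: asboolP => // e'.
by case: ne; exists i.
Qed.

Definition nind M : nat := sval (cid (num_indec_ex M)).
Lemma nindP M : num_indec M (nind M).
Proof. exact: svalP (cid (num_indec_ex M)). Qed.

Lemma num_indec_le M N m n : (forall Y, indecomposable Y -> summand Y M -> summand Y N) ->
  num_indec M m -> num_indec N n -> (m <= n)%N.
Proof.
move=> h [X [Xi Xn _]] [X' [_ _ X'c]].
have f i : {j | iso (X i) (X' j)}.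
  by apply: cid; apply: X'c; [case: (Xi i) | apply: h; case: (Xi i)].
rewrite -(card_ord m) -(card_ord n); apply: (@leq_card _ _ (fun i => sval (f i))) => i j e.
apply: Xn; apply: iso_trans (svalP (f i)) _; rewrite e; exact/iso_sym/(svalP (f j)).
Qed.

Lemma nind_eq M n : num_indec M n -> nind M = n.
Proof.
move=> h; apply/eqP; rewrite eqn_leq.
by rewrite (num_indec_le _ (nindP M) h) // (num_indec_le _ h (nindP M)).
Qed.

Lemma nind_support M N :
  (forall Y, indecomposable Y -> summand Y M <-> summand Y N) -> nind M = nind N.
Proof.
move=> h; apply/eqP; rewrite eqn_leq.
by rewrite !(num_indec_le _ (nindP _) (nindP _)) // => Y Yi /(h _ Yi).
Qed.

Lemma nind_iso M N : iso M N -> nind M = nind N.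
Proof.
move=> e; apply: nind_support => Y Yi; split; first exact: iso_summand.
by apply: iso_summand; exact: iso_sym.
Qed.

Lemma nind_dsum_indec Y M : indecomposable Y -> ~ summand Y M -> nind (dsum Y M) = (nind M).+1.
Proof.
move=> Yi ns; apply: nind_eq; have [X [Xi Xn Xc]] := nindP M.
exists (fun i => if unlift ord0 i is Some j then X j else Y); split.
- move=> i; case: unliftP => [j _|_]; last by split=> //; exact: summand_dsuml.
  by have [Xj s] := Xi j; split=> //; exact: summand_trans s (summand_dsumr _ _).
- move=> i j; case: unliftP => [i' ->|->]; case: unliftP => [j' ->|->] // e.
  + by rewrite (Xn _ _ e).
  + by case: ns; apply: summand_iso e _; case: (Xi i').
  by case: ns; apply: summand_iso (iso_sym e) _; case: (Xi j').
move=> Z Zi /(summand_dsum_indec Zi)[s|/(Xc _ Zi)[i e]].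
  by exists ord0; rewrite unlift_none; exact: indec_summand_iso.
by exists (lift ord0 i); rewrite liftK.
Qed.

Lemma in_add_indec Y M : indecomposable Y -> in_add Y M <-> summand Y M.
Proof.
move=> Yi; split=> [[n [Z [Zs e]]]|s].
  have := mu_self Yi; rewrite (mu_iso Yi e) mu_big // => h.
  have [i si] : exists i, summand Y (Z i).
    apply: contrapT => ne; move: h; rewrite big1 // => i _.
    by apply/mu_eq0 => // s; apply: ne; exists i.
  exact: summand_trans si (Zs i).
exists 1%N, (fun _ => Y); split=> //; rewrite big_ord_recl big_ord0.
exact/iso_sym/dsum0.
Qed.

Lemma same_addP M N : same_add M N <->
  forall Y, indecomposable Y -> summand Y M <-> summand Y N.
Proof.
split=> [h Y Yi|h X]; first by rewrite -!in_add_indec.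
suff H A A' : (forall Y, indecomposable Y -> summand Y A -> summand Y A') ->
    in_add X A -> in_add X A'.
  by split; apply: H => Y Yi /(h _ Yi).
move=> hA [n [Z [Zs e]]]; have [m [W [Wi e']]] := decomposition X.
exists m, W; split=> // i; apply: hA => //.
have [j sj] : exists j, summand (W i) (Z j).
  apply: contrapT => ne; have: (0 < mu (W i) X)%N.
    by rewrite (mu_iso (Wi i) e') mu_big // (bigD1 i) //= mu_self.
  rewrite (mu_iso (Wi i) e) mu_big // big1 // => j _.
  by apply/mu_eq0 => // s; apply: ne; exists j.
exact: summand_trans sj (Zs j).
Qed.

End KrullSchmidt.

(** * Tau-rigidity as a factorization condition *)

Section TauRigid.
Variables (k : fieldType) (C : falgType k).
Implicit Types M N P Q X Y Z G : fdmod C.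

Lemma separating_form (V : vectType k) (W : {vspace V}) v : v \notin W ->
  exists l : 'Hom(V, k^o), l v != 0 /\ {in W, forall w, l w = 0}.
Proof.
move=> nv; pose T := (\1 - projv W)%VF.
have Tv : T v != 0.
  apply: contra nv; rewrite sub_lfunE id_lfunE subr_eq0 => /eqP->.
  exact: memv_proj.
have [i ci] : exists i, coord (vbasis {:V}) i (T v) != 0.
  apply/existsP; apply: contraT; rewrite negb_exists => /forallP h.
  case/eqP: Tv; rewrite (coord_vbasis (memvf (T v))) big1 // => i _.
  by move: (h i); rewrite negbK => /eqP->; rewrite scale0r.
have lc : linear (fun x => coord (vbasis {:V}) i (T x) : k^o).
  by move=> c x y; rewrite !linearP.
exists (linfun (fun x => coord (vbasis {:V}) i (T x) : k^o)).
rewrite linfunE //; split=> // w wW; rewrite linfunE // sub_lfunE id_lfunE.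
by rewrite projv_id // subrr linear0.
Qed.

Lemma ractB (X : rmod C) (x y : X) a : ract (x - y) a = ract x a - ract y a.
Proof. by rewrite addrC -scaleN1r ract_linearl scaleN1r addrC. Qed.

(** The quotient lives on the image of 1 - (projection to [L]), with the action computed on any
    preimage. It supplies the cokernel that defines the transpose. *)
Lemma rquot_ex (Y : rmod C) (L : {vspace Y}) :
  (forall y c, y \in L -> ract y c \in L) ->
  exists (X : rmod C) (q : 'Hom(Y, X)),
    [/\ forall y c, q (ract y c) = ract (q y) c, surj q & lker q = L].
Proof.
move=> LC; pose T := (\1 - projv L)%VF.
pose q : 'Hom(Y, subvs_of (limg T)) :=
  ((linfun (vsproj (limg T)) : 'Hom(Y, subvs_of (limg T))) \o T)%VF.
have qE y : vsval (q y) = T y by rewrite comp_lfunE lfunE vsprojK ?mem_limg.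
have qs : surj q.
  move=> x; case/memv_imgP: (subvsP x) => y _ e; exists y.
  by apply: val_inj; rewrite /= qE.
have qk : lker q = L.
  apply/vspaceP=> y; rewrite memv_ker -(inj_eq val_inj) /= qE sub_lfunE id_lfunE.
  rewrite subr_eq0; apply/eqP/idP=> [->|/projv_id->//]; exact: memv_proj.
have qV x : q ((q^-1)%VF x) = x.
  by rewrite limg_lfunVK //; have [y <-] := qs x; exact: mem_limg.
pose act (x : subvs_of (limg T)) c := q (ract ((q^-1)%VF x) c).
have actE y c : act (q y) c = q (ract y c).
  apply/eqP; rewrite -subr_eq0 -lfB -memv_ker qk -ractB; apply: LC.
  by rewrite -qk memv_ker lfB qV subrr.
have a1 x : linear (act x).
  by move=> c a b; rewrite /act ract_linearr linearP.
clearbody act.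
have a2 a : linear (act^~ a).
  move=> c x y; have [x' <-] := qs x; have [y' <-] := qs y.
  by rewrite -linearP !actE ract_linearl linearP.
have a3 x : act x 1 = x by have [y <-] := qs x; rewrite actE ract1.
have a4 a b x : act x (a * b) = act (act x a) b.
  by have [y <-] := qs x; rewrite !actE ractM.
by exists (RMod a1 a2 a3 a4), q; split=> // y c; rewrite -actE.
Qed.

(* For X = coker Hom(d, C), the space Hom(M, D X) is dual to coker Hom(d, M). *)
Lemma tau_rigidP M : tau_rigid M <-> trig M M.
Proof.
split=> [[N [[X [[P1 [P0 [d [p [dp [q [qr qs qk]]]]]]] iNX]] hz]]|].
  exists P1, P0, d, p; split; first exact: min_presW.
  have [[P1p P0p] [hd hp] _ _] := dp; move=> h hh.
  (* If [h] does not factor through [d], a linear form [l] separates it from the maps that do. From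
     [l] one builds a homomorphism [F] from [M] to D X; it is zero by hypothesis, although it
     detects [h]. *)
  have [|nh] := boolP (h \in (prec M d @: homs P0 M)%VS).
    by case/memv_imgP=> f /homsP hf ->; exists f; rewrite precE.
  have [l [lh lW]] := separating_form nh.
  have qV x : q ((q^-1)%VF x) = x.
    by rewrite limg_lfunVK //; have [y <-] := qs x; exact: mem_limg.
  pose phi (m : M) (x : X) := l (genh m \o (vsval ((q^-1)%VF x) : 'Hom(P1, C)))%VF.
  (* The chosen preimage does not matter: two preimages differ by a map factoring through [d], and
     [l] kills the result. *)
  have phiq m g : phi m (q g) = l (genh m \o (vsval g : 'Hom(P1, C)))%VF.
    apply/eqP; rewrite -subr_eq0 -lfB -comp_lfunNr -comp_lfunDr.
    have /(qk _).1[f ef] : q ((q^-1)%VF (q g) - g) = 0 by rewrite lfB qV subrr.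
    have -> : (vsval ((q^-1)%VF (q g)) : 'Hom(P1, C)) - vsval g
            = ((vsval f : 'Hom(P0, C)) \o d)%VF by rewrite -ef.
    rewrite lW // comp_lfunA -precE memv_img //; apply/homsP/is_hom_comp.
      exact: genh_hom.
    exact/homsP/(subvsP f).
  have genhL c m m' : genh (c *: m + m') = c *: genh m + genh m'.
    by apply/lfunP=> a; rewrite add_lfunE scale_lfunE !genhE mactD mactZ.
  have phiL m : linear (phi m).
    by move=> c x y; rewrite /phi !linearP /= comp_lfunDr -comp_lfunZr linearP.
  have phiL' : linear (fun m => linfun (phi m) : dual X).
    move=> c m m'; apply/lfunP=> x.
    rewrite add_lfunE scale_lfunE !linfunE // /phi genhL comp_lfunDl -comp_lfunZl.
    by rewrite linearP.
  pose F : 'Hom(M, dual X) := linfun (fun m => linfun (phi m) : dual X).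
  have FE m x : (F m : 'Hom(X, k^o)) x = phi m x by rewrite /F linfunE // linfunE.
  have hF : is_hom F.
    move=> a m; apply/(@lfunP _ X k^o) => x; have [g <-] := qs x.
    rewrite comp_lfunE (linfunE (ract_linearl _)) !FE -qr !phiq.
    congr (l _); apply/lfunP=> y.
    by rewrite !comp_lfunE hom_reg_actE !genhE mactM.
  have [i [hi /bij_linv[iK iVK]]] := iNX.
  have hiV : is_hom (i^-1)%VF by apply: is_hom_inv => //; exists (i^-1)%VF.
  have Fz : F = 0.
    have e0 := hz _ (is_hom_comp hiV hF); apply/lfun_ext0=> m.
    by rewrite -(iVK (F m)) -[(i^-1)%VF _]comp_lfunE e0 zero_lfunE lf0.
  have lz (g : 'Hom(P1, regmod C)) m : is_hom g -> l (genh m \o g)%VF = 0.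
    move=> /homsP hg; have := phiq m (vsproj _ g); rewrite vsprojK // => <-.
    by rewrite -FE Fz !zero_lfunE.
  have [s [sh sE]] := dual_basis P1p.
  (* The dual basis writes [h] as a sum of maps P1 -> C -> M; since [F] is zero, [l] vanishes on
     each of them. *)
  case/eqP: lh; have -> : h = \sum_(u <- s) (genh (h u.2) \o u.1)%VF.
    apply/lfunP=> x; rewrite {1}(sE x) lf_sum sum_lfunE; apply: eq_bigr => u _.
    by rewrite comp_lfunE genhE hh.
  by rewrite lf_sum big_seq big1 // => u /sh; exact: lz.
move=> t; have [P1 [P0 [d [p dp]]]] := min_pres M.
have [[P1p P0p] [hd hp] _ [_ sd]] := dp.
have rg := trig_pres (summand_refl M) (min_presW dp) sd t.
pose im (g : hom_reg P1) :=
  exists f : hom_reg P0, vsval g = ((vsval f : 'Hom(P0, regmod C)) \o d)%VF.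
have [||L LP] := @vspace_of_pred _ (hom_reg P1) im.
- by exists 0; rewrite !linear0 comp_lfun0l.
- move=> c x y [f ef] [f' ef']; exists (c *: f + f').
  by rewrite !linearP /= ef ef' comp_lfunDl -comp_lfunZl.
have [|X [q [qr qs qk]]] := @rquot_ex (hom_reg P1) L.
  move=> g c /(LP _)[f ef]; apply/(LP _); exists (ract f c).
  apply/(@lfunP _ P1 C) => x.
  by rewrite !comp_lfunE !hom_reg_actE ef comp_lfunE.
have trX : is_transpose M X.
  exists P1, P0, d, p; split=> //; exists q; split=> // g.
  split=> [/eqP|/(LP g) gL]; first by rewrite -memv_ker qk => /LP.
  by apply/eqP; rewrite -memv_ker qk.
exists (dual X); split; first by exists X; split=> //; exact: iso_refl.
move=> F hF.
have qd (f : 'Hom(P0, regmod C)) : is_hom f -> q (vsproj _ (f \o d)%VF) = 0.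
  move=> hf; apply/eqP; rewrite -memv_ker qk; apply/(LP _); exists (vsproj _ f).
  by rewrite !vsprojK //; apply/homsP; auto.
(* [F] is read as a pairing of Hom(P1, C) with [M] that is balanced over [C] and vanishes on the
   maps factoring through [d]. *)
pose b (g : hom_reg P1) (m : M) : k^o := (F m : 'Hom(X, k^o)) (q g).
have bmact g m c : b g (mact c m) = b (ract g c) m.
  by rewrite /b hF comp_lfunE (linfunE (ract_linearl _)) qr.
have [s [sh sE]] := dual_basis P1p; have [s' [sh' sE']] := dual_basis P0p.
have inH P (g : 'Hom(P, regmod C)) : is_hom g -> vsval (vsproj (homs P (regmod C)) g) = g.
  by move=> hg; rewrite vsprojK //; apply/homsP.
have expand (g : 'Hom(P1, regmod C)) : is_hom g ->
    g = \sum_(u <- s) (amulr (g u.2 : C) \o (u.1 : 'Hom(P1, C)))%VF.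
  move=> hg; apply/lfunP=> x; rewrite {1}(sE x) lf_sum sum_lfunE; apply: eq_bigr => u _.
  by rewrite comp_lfunE lfunE hg.
have bexp (g : hom_reg P1) m :
    b g m = \sum_(u <- s) b (vsproj _ u.1) (mact ((vsval g : 'Hom(P1, C)) u.2) m).
  have /homsP hg := subvsP g.
  have e : g = \sum_(u <- s) ract (vsproj _ u.1 : hom_reg P1) ((vsval g : 'Hom(P1, C)) u.2).
    apply: val_inj; rewrite /= linear_sum /= {1}(expand _ hg) !big_seq.
    apply: eq_bigr => u us; apply/(@lfunP _ P1 C) => x.
    by rewrite hom_reg_actE comp_lfunE lfunE inH //; exact: sh.
  rewrite {1}/b {1}e !lf_sum; apply: eq_bigr => u _.
  by rewrite bmact.
have b0 g m : b g m = 0.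
  (* The map P1 -> C -> M defined by [g] and [m] equals [f \o d]. Expanding [f] in the dual basis of
     [P0] turns b g m into a sum of pairings with maps v.1 d, all killed by [q]. *)
  have [|f [hf ef]] := rg (genh m \o (vsval g : 'Hom(P1, C)))%VF.
    by apply: is_hom_comp; [exact: genh_hom | exact/homsP/(subvsP g)].
  have gE x : mact ((vsval g : 'Hom(P1, C)) x) m =
      \sum_(v <- s') mact (v.1 (d x) : C) (f v.2).
    have <- : f (d x) = mact ((vsval g : 'Hom(P1, C)) x) m.
      by rewrite -comp_lfunE -ef comp_lfunE genhE.
    by rewrite {1}(sE' (d x)) lf_sum; apply: eq_bigr => v _; rewrite hf.
  rewrite bexp; under eq_bigr do rewrite gE.
  have bsum h I (r : seq I) (G : I -> M) : b h (\sum_(i <- r) G i) = \sum_(i <- r) b h (G i).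
    by rewrite /b lf_sum sum_lfunE.
  under eq_bigr do rewrite bsum.
  rewrite exchange_big /= big_seq big1 // => v vs.
  have hv : @is_hom _ _ P1 (regmod C) (v.1 \o d)%VF by apply: is_hom_comp => //; exact: sh'.
  have : b (vsproj (homs P1 (regmod C)) (v.1 \o d)%VF) (f v.2) = 0 by rewrite /b qd ?lf0 //; exact: sh'.
  rewrite bexp inH // => e; rewrite -[RHS]e; under [RHS]eq_bigr do rewrite comp_lfunE.
  by [].
apply/lfun_ext0=> m; apply/(@lfunP _ X k^o) => x; have [g <-] := qs x.
by rewrite zero_lfunE; exact: b0.
Qed.
End TauRigid.

(** * Generation, traces, Nakayama's lemma and test pairs *)

Section LocalNakayama.
Variables (k : closedFieldType) (C : falgType k).
Implicit Types M N P Q X Y Z G U : fdmod C.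

(** [M] is a quotient of a module in add U: only the indecomposable summands of [G] are constrained,
    not their multiplicities. *)
Definition genby U M : Prop := exists G (f : 'Hom(G, M)),
  [/\ forall Z, indecomposable Z -> summand Z G -> summand Z U, is_hom f & surj f].

Lemma genby0 U : genby U (mod0 C).
Proof.
exists (mod0 C), \1%VF; split=> [Z Zi /(not_summand0 Zi)//||y]; first exact: is_hom1.
by exists y; rewrite id_lfunE.
Qed.

Lemma genby_dsum U M N : genby U M -> genby U N -> genby U (dsum M N).
Proof.
move=> [G [f [hG hf fs]]] [G' [f' [hG' hf' fs']]].
exists (dsum G G'), (pairh (f \o dfst) (f' \o dsnd))%VF; split; auto.
  by move=> Z Zi /(summand_dsum_indec Zi)[/(hG _ Zi)|/(hG' _ Zi)].
move=> [x y]; have [x' <-] := fs x; have [y' <-] := fs' y; exists (x', y').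
by rewrite pairhE !comp_lfunE dfstE dsndE.
Qed.

Lemma genby_surj U M N (g : 'Hom(M, N)) : is_hom g -> surj g -> genby U M -> genby U N.
Proof.
move=> hg gs [G [f [hG hf fs]]]; exists G, (g \o f)%VF; split; auto.
by move=> y; have [x <-] := gs y; have [z <-] := fs x; exists z; rewrite comp_lfunE.
Qed.

Lemma genby_summand U M N : summand N M -> genby U M -> genby U N.
Proof. by move=> /surj_summand[g [hg gs]]; exact: genby_surj gs. Qed.

Lemma genby_iso U M N : iso M N -> genby U M -> genby U N.
Proof. by move=> e; apply: genby_summand; exact: summand_iso e (summand_refl M). Qed.

Lemma genby_refl U : genby U U.
Proof.
by exists U, \1%VF; split=> // y; exists y; rewrite id_lfunE.
Qed.

Lemma genby_trans U V M : genby U V -> genby V M -> genby U M.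
Proof.
move=> gV [G [f [hG hf fs]]]; apply: (genby_surj hf fs).
apply: KS_summand_ind; [exact: genby0 | exact: genby_dsum | exact: genby_iso |].
by move=> Y Yi /(hG _ Yi) s; exact: genby_summand s gV.
Qed.

(** The dual of [radical]: maps into [Y] that are not split epimorphisms. *)
Definition cradical G Y (f : 'Hom(G, Y)) : Prop :=
  is_hom f /\ forall s : 'Hom(Y, G), is_hom s -> ~ bijective (f \o s)%VF.

Lemma cradical_comp G G' Y (f : 'Hom(G, Y)) (g : 'Hom(G', G)) :
  is_hom g -> cradical f -> cradical (f \o g)%VF.
Proof.
by move=> hg [hf rf]; split=> [|s hs]; [auto | rewrite -comp_lfunA; auto].
Qed.

Lemma cradical_copair G G' Y (f : 'Hom(G, Y)) (f' : 'Hom(G', Y)) : indecomposable Y ->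
  cradical f -> cradical f' -> cradical (copairh f f').
Proof.
move=> Yi [hf rf] [hf' rf']; split=> [|s hs]; first by auto.
rewrite /copairh comp_lfunDl -!comp_lfunA => b.
by have [||/rf|/rf'] := indec_local Yi _ _ b; auto.
Qed.

Section Trace.
Variables U Y : fdmod C.
Hypothesis Yi : indecomposable Y.

(** The trace of add U in [Y]; it is stable under End(Y) and is all of [Y] exactly when [U]
    generates [Y]. *)
Definition trace (y : Y) : Prop := exists G (h : 'Hom(G, Y)) g,
  [/\ forall Z, indecomposable Z -> summand Z G -> summand Z U, is_hom h & h g = y].

Lemma trace0 : trace 0.
Proof.
by exists (mod0 C), 0, 0; split=> [Z Zi /(not_summand0 Zi)//||]; rewrite ?lf0.
Qed.
Lemma traceD x y : trace x -> trace y -> trace (x + y).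
Proof.
move=> [G [f [g [hG hf <-]]]] [G' [f' [g' [hG' hf' <-]]]].
exists (dsum G G'), (copairh f f'), (g, g'); split; auto; last by rewrite copairhE.
by move=> Z Zi /(summand_dsum_indec Zi)[/(hG _ Zi)|/(hG' _ Zi)].
Qed.
Lemma trace_endo (e : 'Hom(Y, Y)) y : is_hom e -> trace y -> trace (e y).
Proof.
move=> he [G [f [g [hG hf <-]]]].
by exists G, (e \o f)%VF, g; split; rewrite ?comp_lfunE; auto.
Qed.

Lemma trace_genby : (forall y, trace y) -> genby U Y.
Proof.
move=> h; have H (s : seq Y) : exists G (f : 'Hom(G, Y)),
    [/\ forall Z, indecomposable Z -> summand Z G -> summand Z U, is_hom f
      & {subset s <= limg f}].
  elim: s => [|y s [G [f [hG hf fs]]]].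
    by exists (mod0 C), 0; split=> // Z Zi /(not_summand0 Zi).
  have [G' [f' [g' [hG' hf' e]]]] := h y.
  exists (dsum G G'), (copairh f f'); split; auto.
    by move=> Z Zi /(summand_dsum_indec Zi)[/(hG _ Zi)|/(hG' _ Zi)].
  move=> x; rewrite inE => /predU1P[->|/fs/memv_imgP[z _ ->]].
    have -> : y = copairh f f' (0, g') by rewrite copairhE lf0 add0r.
    exact: mem_limg.
  have -> : f z = copairh f f' (z, 0) by rewrite copairhE lf0 addr0.
  exact: mem_limg.
have [G [f [hG hf fs]]] := H (vbasis {:Y}); exists G, f; split=> //.
apply/surj_limg/eqP; rewrite eqEsubv subvf -(span_basis (vbasisP {:Y})).
exact/span_subvP.
Qed.

(* y lies in trace + End(Y) x1 + ... + End(Y) xn *)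
Fixpoint gen_trace (xs : seq Y) (y : Y) : Prop :=
  if xs is x :: xs' then exists e : 'Hom(Y, Y), is_hom e /\ gen_trace xs' (y - e x)
  else trace y.

Lemma trace_gen_trace xs y : trace y -> gen_trace xs y.
Proof.
elim: xs y => [//|x xs IH] y ty; exists 0; split; first exact: is_hom0.
by rewrite zero_lfunE subr0; exact: IH.
Qed.
Lemma gen_traceD xs x y : gen_trace xs x -> gen_trace xs y -> gen_trace xs (x + y).
Proof.
elim: xs x y => [|z xs IH] x y; first exact: traceD.
move=> [e [he h]] [e' [he' h']]; exists (e + e'); split; first by auto.
by rewrite add_lfunE opprD addrACA; exact: IH.
Qed.
Lemma gen_trace_endo xs (u : 'Hom(Y, Y)) y : is_hom u -> gen_trace xs y -> gen_trace xs (u y).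
Proof.
move=> hu; elim: xs y => [|z xs IH] y; first exact: trace_endo.
move=> [e [he h]]; exists (u \o e)%VF; split; first by auto.
by rewrite comp_lfunE -lfB; exact: IH.
Qed.
Lemma gen_trace_span xs y : y \in <<xs>>%VS -> gen_trace xs y.
Proof.
elim: xs y => [|x xs IH] y; first by rewrite span_nil memv0 => /eqP->; exact: trace0.
rewrite span_cons => /memv_addP[_ /vlineP[c ->] [v /IH h ->]].
exists (c *: \1%VF); split; first exact: is_homZ.
by rewrite scale_lfunE id_lfunE addrAC subrr add0r.
Qed.

(** Summands of [G] coming from [U] are sent into the trace. On a summand isomorphic to [Y], the
    vector is e x plus terms in the other generators, so its image is j x plus such terms, with j =
    f i e not invertible because [f] is radical. Sums of non-invertible endomorphisms stay
    non-invertible since End(Y) is local. *)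
Lemma cradical_gen_trace x xs G (f : 'Hom(G, Y)) g :
  (forall y, gen_trace (x :: xs) y) -> cradical f ->
  (forall Z, indecomposable Z -> summand Z G -> iso Z Y \/ summand Z U) ->
  exists j : 'Hom(Y, Y), [/\ is_hom j, ~ bijective j & gen_trace xs (f g - j x)].
Proof.
move=> gen rf hG; move: f g rf.
apply: (@KS_summand_ind _ _ (fun G => forall (f : 'Hom(G, Y)) g, cradical f ->
  exists j : 'Hom(Y, Y), [/\ is_hom j, ~ bijective j & gen_trace xs (f g - j x)]) G).
- move=> f g _; exists 0; split; [exact: is_hom0 | exact: indec_not0 |].
  rewrite (mod0_eq0 g) zero_lfunE lf0 subr0; exact/trace_gen_trace/trace0.
- move=> X Z IX IZ f [a b] rf.
  have [j [hj nj gj]] := IX _ a (cradical_comp (@dinl_hom _ _ X Z) rf).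
  have [j' [hj' nj' gj']] := IZ _ b (cradical_comp (@dinr_hom _ _ X Z) rf).
  exists (j + j'); split; first by auto.
    by move=> bj; have [||/nj|/nj'] := indec_local Yi _ _ bj.
  have -> : f (a, b) - (j + j') x
      = ((f \o dinl)%VF a - j x) + ((f \o dinr)%VF b - j' x).
    rewrite !comp_lfunE addrACA -opprD -lfD add_lfunE dinlE dinrE.
    by congr (f _ - _); congr (_, _); rewrite /= ?addr0 ?add0r.
  exact: gen_traceD.
- move=> X Z [i [hi bi]] IX f g rf; have [iK iVK] := bij_linv bi.
  have [j [hj nj gj]] := IX _ ((i^-1)%VF g) (cradical_comp hi rf).
  by exists j; split=> //; rewrite comp_lfunE iVK in gj.
move=> Z Zi /(hG _ Zi)[/iso_sym[i [hi bi]]|sZ] f g rf; last first.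
  exists 0; split; [exact: is_hom0 | exact: indec_not0 |].
  rewrite zero_lfunE subr0; apply: trace_gen_trace.
  exists Z, f, g; split=> //; last by case: rf.
  by move=> W Wi s; exact: summand_trans s sZ.
have [iK iVK] := bij_linv bi; have [e [he ge]] := gen ((i^-1)%VF g).
have [hf nf] := rf; exists (f \o (i \o e))%VF; split; [by auto | by apply: nf; auto |].
have hfi : is_hom (f \o i)%VF by auto.
by have := gen_trace_endo hfi ge; rewrite lfB !comp_lfunE iVK.
Qed.

(* Nakayama's lemma for Y as a module over its local endomorphism ring. *)
Lemma local_nakayama G (f : 'Hom(G, Y)) : surj f -> cradical f ->
  (forall Z, indecomposable Z -> summand Z G -> iso Z Y \/ summand Z U) -> genby U Y.
Proof.
move=> fs rf hG; apply: trace_genby.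
suff H xs : (forall y, gen_trace xs y) -> forall y, trace y.
  apply: (H (vbasis {:Y})) => y; apply: gen_trace_span.
  by rewrite (span_basis (vbasisP _)) memvf.
elim: xs => [//|x xs IH] gen; apply: IH.
(* For [g] above the first generator [x], the vector x - j x is expressed by the other generators
   and the trace. As [j] is not invertible, 1 - j is, so [x] is redundant. *)
have [g eg] := fs x; have [j [hj nj]] := cradical_gen_trace g gen rf hG.
rewrite eg => gx.
have [|||bj|//] := @indec_local _ _ Y (\1 - j)%VF j Yi _ _ _; auto.
  by rewrite subrK; exact: bij_id_lfun.
have [uK _] := bij_linv bj; have hu : is_hom ((\1 - j)^-1)%VF by apply: is_hom_inv; auto.
have gxs : gen_trace xs x.
  by have := gen_trace_endo hu gx; rewrite -{1}[x]id_lfunE -sub_lfunE uK.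
move=> y; have [e [he ge]] := gen y.
by rewrite -(subrK (e x) y); apply: gen_traceD => //; exact: gen_trace_endo.
Qed.

End Trace.

(** * A test pair detecting one module of a tau-rigid family *)

Section TestPair.
Variables (t : nat) (X : 'I_t -> fdmod C) (I : pred 'I_t).
Hypothesis Xi : forall i, indecomposable (X i).
Hypothesis Xn : forall i j, iso (X i) (X j) -> i = j.

Definition in_family G : Prop := forall Z, indecomposable Z -> summand Z G ->
  exists2 i, I i & iso Z (X i).

Lemma in_family_dsum M N : in_family M -> in_family N -> in_family (dsum M N).
Proof. by move=> hM hN Z Zi /(summand_dsum_indec Zi)[/(hM _ Zi)|/(hN _ Zi)]. Qed.

Lemma in_family_summand M N : summand N M -> in_family M -> in_family N.
Proof. by move=> s h Z Zi sZ; apply: h => //; exact: summand_trans sZ s. Qed.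

Lemma in_family_self i : I i -> in_family (X i).
Proof. by move=> Ii Z Zi s; exists i => //; exact: indec_summand_iso. Qed.

Lemma in_family_ind (Pr : fdmod C -> Prop) G :
  Pr (mod0 C) -> (forall M N, Pr M -> Pr N -> Pr (dsum M N)) ->
  (forall M N, iso M N -> Pr M -> Pr N) -> (forall i, I i -> Pr (X i)) ->
  in_family G -> Pr G.
Proof.
move=> P0 PD Pi PX hG; apply: KS_summand_ind => // Y Yi /(hG _ Yi)[i Ii e].
by apply: Pi (iso_sym e) _; exact: PX.
Qed.

(* Among the modules of the family that generate all X i, choose U0 of least
   dimension, a summand X j of U0, and a radical map f into X j with the largest
   image. If f were onto, Nakayama's lemma would show that the complement of X j
   in U0 already generates the family. *)
Lemma test_pair i0 : I i0 -> exists j G (f : 'Hom(G, X j)),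
  [/\ I j, in_family G, is_hom f, ~ surj f &
    forall i (h : 'Hom(X i, X j)), I i -> is_hom h -> i <> j \/ ~ bijective h ->
      (limg h <= limg f)%VS].
Proof.
move=> Ii0; pose gens U := forall i, I i -> genby U (X i).
pose ok n := `[< exists U, [/\ in_family U, gens U & dim U = n] >].
have ok_ex : exists n, ok n.
  pose U := \big[@dsum k C/mod0 C]_(i < t) (if I i then X i else mod0 C).
  have sU Z : indecomposable Z -> summand Z U <-> exists2 i, I i & iso Z (X i).
    move=> Zi; rewrite -mu_gt0 // mu_big //; split=> [|[i Ii e]].
      move=> h; apply: contrapT => ne; move: h; rewrite big1 // => i _.
      case: ifP => Ii; last exact: mu0.
      by rewrite mu_indec //; case: asboolP => // e; case: ne; exists i.
    by rewrite (bigD1 i) //= Ii mu_indec //; case: asboolP.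
  exists (dim U); apply/asboolP; exists U; split=> // [Z Zi /(sU _ Zi)//|i Ii].
  apply: genby_summand (genby_refl U); by apply/(sU _ (Xi i)); exists i.
case: (ex_minnP ok_ex) => n /asboolP[U0 [fU0 gU0 dU0]] nmin.
have [Y [Yi [U1 e]]] : exists Y, indecomposable Y /\ summand Y U0.
  apply: indec_summand_ex; have [z|//] := zeroP U0.
  have [G [f [hG _ fs]]] := gU0 _ Ii0; have [[x nx] _] := Xi i0.
  have [zG|] := zeroP G; last first.
    move=> /indec_summand_ex[Z [Zi /(hG _ Zi)]] /(iso_summand (zero_iso z)).
    by move=> /(not_summand0 Zi).
  by case: nx; have [g <-] := fs x; rewrite (zG g) lf0.
have [j Ij eYj] := fU0 _ Yi (ex_intro _ U1 e).
have ej : iso U0 (dsum (X j) U1).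
  by apply: (iso_trans e); apply: dsum_iso => //; exact: iso_refl.
have fU1 : in_family U1.
  by apply: in_family_summand fU0; apply: iso_summand (iso_sym e) (summand_dsumr _ _).
pose rad m := `[< exists G (f : 'Hom(G, X j)), [/\ in_family G, cradical f & \dim (limg f) = m] >].
have rad_ex : exists m, rad m.
  exists 0%N; apply/asboolP; exists (mod0 C), 0; split.
  - by move=> Z Zi /(not_summand0 Zi).
  - by split=> [|s hs]; rewrite ?comp_lfun0l; [exact: is_hom0 | exact: indec_not0].
  by rewrite lim0g dimv0.
have rad_le m : rad m -> (m <= dim (X j))%N.
  by move=> /asboolP[G [f [_ _ <-]]]; rewrite -dimvf dimvS ?subvf.
case: (ex_maxnP rad_ex rad_le) => m /asboolP[G [f [fG rf df]]] mmax.
exists j, G, f; split=> //; first by case: rf.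
  move=> fs; have gG : genby U0 G.
    apply: in_family_ind fG; [exact: genby0 | exact: genby_dsum | exact: genby_iso |].
    by move=> i Ii; exact: gU0.
  have [G' [g [hG' hg gs]]] := gG.
  have gj : genby U1 (X j).
    apply: (local_nakayama (Xi j) (f := (f \o g)%VF)).
    - by move=> y; have [x <-] := fs y; have [z <-] := gs x; exists z; rewrite comp_lfunE.
    - exact: cradical_comp.
    move=> Z Zi /(hG' _ Zi)/(iso_summand ej)/(summand_dsum_indec Zi)[s|]; last by right.
    by left; exact: indec_summand_iso.
  (* Now [U1] generates [X j], hence [U0], hence the whole family; this contradicts the minimality
     of [dim U0] because [X j] is nonzero. *)
  have gU1 : genby U1 U0.
    by apply: genby_iso (iso_sym ej) _; apply: genby_dsum => //; exact: genby_refl.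
  have : ok (dim U1).
    apply/asboolP; exists U1; split=> // i Ii; exact: genby_trans gU1 (gU0 _ Ii).
  move/nmin; rewrite -dU0 (iso_dim ej) dim_dsum leqNgt => /negP; apply.
  by rewrite -[ltnLHS]add0n ltn_add2r lt0n indec_dim.
move=> i h Ii hh hij.
have rh : cradical h.
  split=> // s hs bs; case: hij => [ne|nb].
    by apply: ne; apply/Xn/iso_sym/indec_summand_iso => //; exact: retract_summand bs.
  (* A bijective [h \o s] makes [h] onto and [X j] a summand of [X i]. Then i = j, and a surjection
     between spaces of equal dimension is bijective. *)
  apply: nb; have [v vK vVK] := bs.
  have sh : surj h by move=> y; exists (s (v y)); rewrite -comp_lfunE vVK.
  have [eij|ne] := pselect (i = j); last first.
    by case: ne; apply/Xn/iso_sym/indec_summand_iso => //; exact: retract_summand bs.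
  by apply: surj_dim_bij => //; rewrite eij.
(* Joining [h] to [f] gives a radical map whose source is still in the family, so the maximality of
   dim (im f) puts im h inside im f. *)
have rc := cradical_copair (Xi j) rf rh.
have lf : (limg f <= limg (copairh f h))%VS.
  apply: limg_sub => x; have -> : f x = copairh f h (x, 0) by rewrite copairhE lf0 addr0.
  exact: mem_limg.
have lh : (limg h <= limg (copairh f h))%VS.
  apply: limg_sub => x; have -> : h x = copairh f h (0, x) by rewrite copairhE lf0 add0r.
  exact: mem_limg.
apply: (subv_trans lh); suff /eqP <- : limg f == limg (copairh f h) by exact: subvv.
rewrite eqEdim lf df; apply: mmax; apply/asboolP.
by exists (dsum G (X i)), (copairh f h); split=> //; apply: in_family_dsum => //; exact: in_family_self.
Qed.

End TestPair.
End LocalNakayama.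

Section Superfluous.
Variables (k : fieldType) (C : falgType k).
Implicit Types M N P Q W X Y Z G : fdmod C.

Lemma superfluous_img M N (f : 'Hom(M, N)) K :
  is_hom f -> superfluous K -> superfluous (f @: K)%VS.
Proof.
move=> hf sK L hL e; have hpre : submod (f @^-1: L)%VS.
  by move=> a x; rewrite -!memv_preim hf; exact: hL.
have pf : (f @^-1: L)%VS = fullv.
  apply: sK => //; apply/vspaceP=> x; rewrite memvf.
  have: f x \in (L + f @: K)%VS by rewrite e memvf.
  case/memv_addP=> u uL [_ /memv_imgP[v vK ->] ex].
  apply/memv_addP; exists (x - v); last by exists v; rewrite ?subrK.
  by rewrite -memv_preim lfB ex addrK.
rewrite -e; apply/esym/addv_idPl/subvP=> _ /memv_imgP[v _ ->].
by rewrite memv_preim pf memvf.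
Qed.

Lemma superfluous_add M (K K' : {vspace M}) :
  submod K -> superfluous K -> superfluous K' -> superfluous (K + K')%VS.
Proof.
move=> hK sK sK' L hL; rewrite addvA => e; apply: sK => //; apply: sK' => //.
exact: submod_add.
Qed.

(** Uniqueness of the projective cover of the common image: the lifts in both directions compose to
    endomorphisms compatible with [u] or [v], which superfluity makes bijective. *)
Lemma same_image_iso P P' W (u : 'Hom(P, W)) (v : 'Hom(P', W)) :
  projective P -> projective P' -> is_hom u -> is_hom v -> limg u = limg v ->
  superfluous (lker u) -> superfluous (lker v) -> iso P P'.
Proof.
move=> Pp Pp' hu hv e su sv.
have [|f [hf ef]] := proj_lift Pp hv hu; first by rewrite e subvv.
have [|g [hg eg]] := proj_lift Pp' hu hv; first by rewrite e subvv.
have gf : bijective (g \o f)%VF.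
  by apply: (superfluous_endo _ su); [auto | rewrite comp_lfunA eg ef].
have fg : bijective (f \o g)%VF.
  by apply: (superfluous_endo _ sv); [auto | rewrite comp_lfunA ef eg].
exists f; split=> //; apply: surj_dim_bij.
  by case: fg => h _ K y; exists (g (h y)); rewrite -comp_lfunE K.
have : injective f.
  by case: gf => h K _ x y exy; rewrite -(K x) -(K y) !comp_lfunE exy.
move/lker0P/eqP => k0; have := dim_limg f; rewrite k0 dimv0 add0n => <-.
by rewrite -dimvf dimvS ?subvf.
Qed.

(* Both sides are projective covers of the pullback of p and p'. *)
Lemma schanuel M P1 P0 Q1 Q0 (d : 'Hom(P1, P0)) (p : 'Hom(P0, M))
    (d' : 'Hom(Q1, Q0)) (p' : 'Hom(Q0, M)) :
  pres d p -> superfluous (lker d) -> pres d' p' -> superfluous (lker d') ->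
  iso (dsum P0 Q1) (dsum Q0 P1).
Proof.
move=> [[P1p P0p] [hd hp] [ps dk]] sd [[Q1p Q0p] [hd' hp'] [ps' dk']] sd'.
have [a [ha ea]] := P0p _ _ p' p hp' ps' hp.
have [b [hb eb]] := Q0p _ _ p p' hp ps hp'.
have aE x : p' (a x) = p x by rewrite -comp_lfunE ea.
have bE x : p (b x) = p' x by rewrite -comp_lfunE eb.
have pd x : p (d x) = 0 by apply/eqP; rewrite -memv_ker -dk mem_limg.
have pd' x : p' (d' x) = 0 by apply/eqP; rewrite -memv_ker -dk' mem_limg.
(* The image of [u] is the pullback because two vectors with the same image under [p'] differ by an
   element of im d'; its kernel is a copy of ker d'. The map [v] is the mirror image, with kernel a
   copy of ker d. *)
pose u : 'Hom(dsum P0 Q1, dsum P0 Q0) := pairh dfst (copairh a d').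
pose v : 'Hom(dsum Q0 P1, dsum P0 Q0) := pairh (copairh b d) dfst.
have uE x y : u (x, y) = (x, a x + d' y) by rewrite pairhE copairhE dfstE.
have vE x y : v (x, y) = (b x + d y, x) by rewrite pairhE copairhE dfstE.
have lu : forall z : dsum P0 Q0, z \in limg u <-> p z.1 = p' z.2.
  move=> [x y]; split=> [/memv_imgP[[x' y'] _]|/= e].
    by rewrite uE => -[-> ->] /=; rewrite lfD aE pd' addr0.
  have : y - a x \in limg d' by rewrite dk' memv_ker lfB aE e subrr.
  case/memv_imgP=> y' _ ey; have -> : (x, y) = u (x, y').
    by rewrite uE -ey addrC subrK.
  exact: mem_limg.
have lv : forall z : dsum P0 Q0, z \in limg v <-> p z.1 = p' z.2.
  move=> [x y]; split=> [/memv_imgP[[x' y'] _]|/= e].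
    by rewrite vE => -[-> ->] /=; rewrite lfD bE pd addr0.
  have : x - b y \in limg d by rewrite dk memv_ker lfB bE e subrr.
  case/memv_imgP=> y' _ ey; have -> : (x, y) = v (y, y').
    by rewrite vE -ey addrC subrK.
  exact: mem_limg.
apply: (same_image_iso (u := u) (v := v)); try exact: projective_dsum.
- by rewrite /u; auto.
- by rewrite /v; auto.
- by apply/vspaceP=> z; apply/idP/idP => [/lu/lv|/lv/lu].
- have -> : lker u = (dinr @: lker d')%VS.
    apply/vspaceP=> -[x y]; rewrite memv_ker uE; apply/eqP/memv_imgP=> [[-> e]|[y']].
      exists y; last by rewrite dinrE.
      by move: e; rewrite lf0 add0r => /eqP; rewrite -memv_ker.
    by rewrite memv_ker dinrE => /eqP e [-> ->]; rewrite lf0 e addr0.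
  by apply: superfluous_img => //; exact: dinr_hom.
have -> : lker v = (dinr @: lker d)%VS.
  apply/vspaceP=> -[x y]; rewrite memv_ker vE; apply/eqP/memv_imgP=> [[e ex]|[y']].
    exists y; last by rewrite dinrE ex.
    by move: e; rewrite ex lf0 add0r => /eqP; rewrite -memv_ker.
  by rewrite memv_ker dinrE => /eqP e [-> ->]; rewrite lf0 e addr0.
by apply: superfluous_img => //; exact: dinr_hom.
Qed.

Lemma pres_dsum M N P1 P0 Q1 Q0 (d : 'Hom(P1, P0)) (p : 'Hom(P0, M))
    (d' : 'Hom(Q1, Q0)) (p' : 'Hom(Q0, N))
    (dd := pairh (d \o dfst)%VF (d' \o dsnd)%VF : 'Hom(dsum P1 Q1, dsum P0 Q0))
    (pp := pairh (p \o dfst)%VF (p' \o dsnd)%VF : 'Hom(dsum P0 Q0, dsum M N)) :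
  pres d p -> superfluous (lker d) -> pres d' p' -> superfluous (lker d') ->
  pres dd pp /\ superfluous (lker dd).
Proof.
move=> [[P1p P0p] [hd hp] [ps dk]] sd [[Q1p Q0p] [hd' hp'] [ps' dk']] sd'.
have ddE x y : dd (x, y) = (d x, d' y) by rewrite pairhE !comp_lfunE dfstE dsndE.
have ppE x y : pp (x, y) = (p x, p' y) by rewrite pairhE !comp_lfunE dfstE dsndE.
split.
  split; [by split; exact: projective_dsum | by rewrite /dd /pp; auto 8 |].
  split=> [[x y]|].
    by have [x' <-] := ps x; have [y' <-] := ps' y; exists (x', y').
  apply/vspaceP=> -[x y]; rewrite memv_ker ppE; apply/memv_imgP/eqP.
    move=> [[x' y'] _]; rewrite ddE => -[-> ->].
    by congr (_, _); apply/eqP; rewrite -memv_ker -?dk -?dk' mem_limg.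
  move=> [/eqP + /eqP]; rewrite -!memv_ker -dk -dk' => /memv_imgP[x' _ ->].
  by move=> /memv_imgP[y' _ ->]; exists (x', y'); rewrite ?memvf.
have -> : lker dd = (dinl @: lker d + dinr @: lker d')%VS.
  apply/vspaceP=> -[x y]; rewrite memv_ker ddE; apply/eqP/memv_addP.
    move=> [/eqP ex /eqP ey]; exists (dinl x); first by rewrite memv_img ?memv_ker.
    exists (dinr y); first by rewrite memv_img ?memv_ker.
    by rewrite dinlE dinrE; congr (_, _); rewrite /= ?addr0 ?add0r.
  move=> [_ /memv_imgP[x' + ->] [_ /memv_imgP[y' + ->]]].
  rewrite !memv_ker dinlE dinrE => /eqP ex /eqP ey [-> ->].
  by rewrite /= addr0 add0r ex ey.
apply: superfluous_add; last 2 first.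
- by apply: superfluous_img => //; exact: dinl_hom.
- by apply: superfluous_img => //; exact: dinr_hom.
move=> a _ /memv_imgP[x xd ->]; rewrite -dinl_hom; apply: memv_img.
exact: submod_lker.
Qed.

End Superfluous.

(** * Dimensions of Hom spaces, g-vectors and their linear independence *)

Section DimHom.
Variables (k : closedFieldType) (C : falgType k).
Implicit Types M N P Q W X Y Z G : fdmod C.

Lemma dimhom_dsum M M' N : dimhom (dsum M M') N = (dimhom M N + dimhom M' N)%N.
Proof.
pose T1 := @prec _ _ _ N (@dfst _ _ M M'); pose T2 := @prec _ _ _ N (@dsnd _ _ M M').
have i1 : {in homs M N, forall x, T1 x = 0 -> x = 0}.
  move=> x _ e; rewrite -[x]comp_lfun1r -(dfst_inl M M') comp_lfunA.
  by move: e; rewrite precE => ->; rewrite comp_lfun0l.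
have i2 : {in homs M' N, forall x, T2 x = 0 -> x = 0}.
  move=> x _ e; rewrite -[x]comp_lfun1r -(dsnd_inr M M') comp_lfunA.
  by move: e; rewrite precE => ->; rewrite comp_lfun0l.
rewrite /dimhom -(dim_img_inj i1) -(dim_img_inj i2) -dimv_disjoint_sum.
  congr (\dim _); apply/vspaceP=> f; apply/idP/memv_addP.
    move=> /homsP hf; exists (T1 (f \o dinl)%VF).
      by apply/memv_img/homsP; auto.
    exists (T2 (f \o dinr)%VF); first by apply/memv_img/homsP; auto.
    by rewrite !precE -!comp_lfunA -comp_lfunDr dsum_id comp_lfun1r.
  move=> [_ /memv_imgP[x /homsP hx ->] [_ /memv_imgP[y /homsP hy ->] ->]].
  by apply/homsP; rewrite !precE; auto.
apply/eqP; rewrite -subv0; apply/subvP=> f /memv_capP[/memv_imgP[x xW ->] /memv_imgP[y yW e]].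
rewrite memv0; apply/eqP; suff -> : x = 0 by rewrite lf0.
rewrite -[x]comp_lfun1r -(dfst_inl M M') comp_lfunA; move: e; rewrite !precE => ->.
by rewrite -comp_lfunA dsnd_inl comp_lfun0r.
Qed.

Lemma dimhom_iso M M' N : iso M M' -> dimhom M N = dimhom M' N.
Proof.
suff H A B : iso A B -> (dimhom B N <= dimhom A N)%N.
  by move=> e; apply/eqP; rewrite eqn_leq !H //; exact: iso_sym.
move=> [f [hf bf]]; have [fK fVK] := bij_linv bf.
apply: (@dim_inj_le _ _ _ (prec N f)) => g /homsP hg; rewrite precE.
  by apply/homsP; auto.
by move=> e; apply/lfunP=> x; rewrite -(fVK x) -comp_lfunE e !zero_lfunE.
Qed.

(** Hom(-, N) is left exact, and [rig] is the missing surjectivity in 0 -> Hom(M, N) -> Hom(P0, N)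
    -> Hom(P1, N) -> 0. *)
Lemma dimhom_pres M P1 P0 (d : 'Hom(P1, P0)) (p : 'Hom(P0, M)) N :
  pres d p -> rig d N -> dimhom P0 N = (dimhom M N + dimhom P1 N)%N.
Proof.
move=> [[P1p P0p] [hd hp] [ps dk]] rg.
rewrite /dimhom -(limg_ker_dim (prec N d) (homs P0 N)); congr (_ + _)%N.
  rewrite -(dim_img_inj (f := prec N p) (U := homs M N)).
    congr (\dim _); apply/vspaceP=> f; apply/memv_capP/memv_imgP.
      rewrite memv_ker precE => -[/homsP hf /eqP fd].
      have pV y : p ((p^-1)%VF y) = y.
        by rewrite limg_lfunVK //; have [x <-] := ps y; exact: mem_limg.
      have fp x : f ((p^-1)%VF (p x)) = f x.
        apply/eqP; rewrite -subr_eq0 -lfB.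
        have : (p^-1)%VF (p x) - x \in limg d by rewrite dk memv_ker lfB pV subrr.
        by case/memv_imgP=> z _ ->; rewrite -comp_lfunE fd zero_lfunE.
      exists (f \o (p^-1))%VF; last by rewrite precE; apply/lfunP=> x; rewrite !comp_lfunE fp.
      apply/homsP=> a y; have [x <-] := ps y.
      by rewrite !comp_lfunE -hp !fp hf.
    move=> [g /homsP hg ->]; rewrite precE; split; first by apply/homsP; auto.
    rewrite memv_ker precE -comp_lfunA; apply/eqP/lfun_ext0=> x.
    have -> : (g \o (p \o d))%VF x = g (p (d x)) by rewrite !comp_lfunE.
    have : d x \in lker p by rewrite -dk mem_limg.
    by rewrite memv_ker => /eqP->; rewrite lf0.
  move=> g _; rewrite precE => e; apply/lfun_ext0=> y; have [x <-] := ps y.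
  by rewrite -comp_lfunE e zero_lfunE.
congr (\dim _); apply/vspaceP=> h; apply/memv_imgP/homsP.
  by move=> [f /homsP hf ->]; rewrite precE; auto.
by move=> /rg[f [hf ->]]; exists f; rewrite ?precE //; apply/homsP.
Qed.

(** * g-vectors *)

Section GVector.
Variables (n : nat) (PP : 'I_n -> fdmod C).
Hypothesis PPi : forall i, indecomposable (PP i).
Hypothesis PPn : forall i j, iso (PP i) (PP j) -> i = j.
Hypothesis PPc : forall Y, indecomposable Y -> summand Y (regmod C) -> exists i, iso Y (PP i).

Lemma proj_indec P Y : projective P -> indecomposable Y -> summand Y P -> exists i, iso Y (PP i).
Proof.
move=> /projective_summand_free[m sP] Yi /summand_trans/(_ sP).
elim: m {P sP} => [/(not_summand0 Yi)//|m IH] /(summand_dsum_indec Yi)[|/IH//].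
exact: PPc.
Qed.

(** For projective [P], the class of [P] in K_0(proj C) in the basis of indecomposable projectives;
    rational entries give access to ranks. *)
Definition mv P : 'rV[rat]_n := \row_j (mu (PP j) P)%:R.

Lemma additive_mv : additive_inv mv.
Proof.
split=> [M N e|M N]; apply/rowP=> j; rewrite !mxE; first by rewrite (mu_iso _ e).
by rewrite mu_dsum // natrD.
Qed.

Lemma proj_inv_sum (V : zmodType) (phi : fdmod C -> V) P : additive_inv phi -> projective P ->
  phi P = \sum_j phi (PP j) *+ mu (PP j) P.
Proof.
by move=> ap Pp; apply: additive_inv_sum => // Y Yi; exact: proj_indec.
Qed.

Lemma gvec_ex M : exists v : 'rV[rat]_n, exists P1 P0 (d : 'Hom(P1, P0)) (p : 'Hom(P0, M)),
  [/\ pres d p, superfluous (lker d) & v = mv P0 - mv P1].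
Proof.
have [P1 [P0 [d [p dp]]]] := min_pres M; exists (mv P0 - mv P1), P1, P0, d, p.
by split=> //; [exact: min_presW | case: dp => _ _ _ []].
Qed.

Definition gvec M : 'rV[rat]_n := sval (cid (gvec_ex M)).

Lemma gvec_pres M P1 P0 (d : 'Hom(P1, P0)) (p : 'Hom(P0, M)) :
  pres d p -> superfluous (lker d) -> gvec M = mv P0 - mv P1.
Proof.
move=> dp sd; rewrite /gvec; case: cid => _ /= [Q1 [Q0 [d' [p' [dp' sd' ->]]]]].
have [pi pD] := additive_mv; have := pi _ _ (schanuel dp sd dp' sd'); rewrite !pD => e.
by apply/eqP; rewrite subr_eq addrAC eq_sym subr_eq e addrC.
Qed.

Lemma additive_gvec : additive_inv gvec.
Proof.
split=> [M N [f [hf bf]]|M N].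
  have [P1 [P0 [d [p [dp sd e]]]]] := svalP (cid (gvec_ex M)).
  rewrite [gvec M]e; apply/esym; apply: (gvec_pres (d := d) (p := (f \o p)%VF)) => //.
  case: dp => [Pp [hd hp] [ps dk]]; have [fK fVK] := bij_linv bf.
  split=> //; first by auto.
  split=> [y|].
    have [x ex] := ps ((f^-1)%VF y); exists x.
    by rewrite comp_lfunE ex fVK.
  rewrite dk; apply/vspaceP=> x; rewrite !memv_ker comp_lfunE.
  apply/eqP/eqP=> [->|fx]; first by rewrite lf0.
  by rewrite -(fK (p x)) fx lf0.
have [P1 [P0 [d [p [dp sd e]]]]] := svalP (cid (gvec_ex M)).
have [Q1 [Q0 [d' [p' [dp' sd' e']]]]] := svalP (cid (gvec_ex N)).
have [dpp sdd] := pres_dsum dp sd dp' sd'.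
rewrite (gvec_pres dpp sdd) !(additive_mv.2) [gvec M]e [gvec N]e'.
by rewrite opprD addrACA.
Qed.

Definition dimcol N : 'cV[rat]_n := \col_j (dimhom (PP j) N)%:R.

Lemma mv_dimcol P N : projective P -> (mv P *m dimcol N) 0 0 = (dimhom P N)%:R.
Proof.
move=> Pp; rewrite (@proj_inv_sum _ (fun P => (dimhom P N)%:R : rat) P) //; last first.
  by split=> [X Y e|X Y]; rewrite ?dimhom_dsum ?natrD // (dimhom_iso _ e).
by rewrite mxE; apply: eq_bigr => j _; rewrite !mxE mulr_natl.
Qed.

(** The Auslander-Reiten formula: the pairing is dim Hom(M, N) - dim Hom(N, tau M), and [trig] is
    the vanishing of the second term. *)
Lemma gvec_dimcol M N : trig M N -> (gvec M *m dimcol N) 0 0 = (dimhom M N)%:R.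
Proof.
move=> t; have [P1 [P0 [d [p dp]]]] := min_pres M.
have sd : superfluous (lker d) by case: dp => _ _ _ [].
have rg := trig_pres (summand_refl M) (min_presW dp) sd t.
rewrite (gvec_pres (min_presW dp) sd) mulmxBl mxE [X in _ + X]mxE.
have [[P1p P0p] _ _] := min_presW dp.
rewrite !mv_dimcol // (dimhom_pres (min_presW dp) rg).
by rewrite natrD addrK.
Qed.

Section Independence.
Variables (t s : nat) (X : 'I_t -> fdmod C) (Q : 'I_s -> fdmod C).
Hypothesis Xi : forall i, indecomposable (X i).
Hypothesis Xn : forall i j, iso (X i) (X j) -> i = j.
Hypothesis Xt : forall i j, trig (X i) (X j).
Hypothesis Qi : forall i, indecomposable (Q i).
Hypothesis Qn : forall i j, iso (Q i) (Q j) -> i = j.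
Hypothesis Qp : forall i, projective (Q i).
Hypothesis QX : forall i j, hom_zero (Q i) (X j).

Definition gmx : 'M[rat]_(t + s, n) := col_mx (\matrix_i gvec (X i)) (\matrix_i mv (Q i)).

(* For the test pair f : G -> X j, pair the relation with the linear form
   dim Hom(-, X j) - dim Hom(-, im f). On the members of the family it only sees X j. *)
Lemma gvec_relation_zero (a : 'rV[rat]_t) (b : 'rV[rat]_s) :
  \sum_i a 0 i *: gvec (X i) + \sum_j b 0 j *: mv (Q j) = 0 -> a = 0.
Proof.
move=> rel; apply: contrapT => na.
have [i0 ai0] : exists i, a 0 i != 0.
  apply: contrapT => ne; apply: na; apply/rowP=> i; rewrite mxE; apply/eqP.
  by apply: contraT => ai; case: ne; exists i.
(* Searching the test pair inside the support of the relation ensures that the coefficient of its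
   target [X j] is nonzero. *)
pose I : pred 'I_t := fun i => a 0 i != 0.
have [j [G [f [Ij fG hf nf fmax]]]] := @test_pair _ _ _ X I Xi Xn i0 ai0.
pose N := subm (submod_limg hf).
have gs : surj (corestr (submod_limg hf) f).
  move=> y; case/memv_imgP: (subvsP y) => x _ e; exists x.
  by apply: val_inj; rewrite /= corestrE ?mem_limg.
have hg : is_hom (corestr (submod_limg hf) f).
  by apply: corestr_hom => // x; exact: mem_limg.
(* N = im f is a quotient of a module built from the family, and [trig] passes to sums and
   quotients. Likewise maps from [Q l] to N lift to [G] and vanish. *)
have tN i : trig (X i) N.
  apply: (trig_surj hg gs); apply: in_family_ind fG => //.
  - by have [P1 [P0 [d [p [dp rg]]]]] := Xt i i; exists P1, P0, d, p; split=> // h hh;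
      exists 0; split; [exact: is_hom0 | apply/lfunP=> x; rewrite comp_lfunE zero_lfunE (mod0_eq0 (h x))].
  - by move=> M M'; exact: trig_dsum.
  - by move=> M M' e; exact: trig_isor.
have zN l : hom_zero (Q l) N.
  move=> h hh; have [h' [hh' <-]] := Qp hg gs hh.
  suff -> : h' = 0 by rewrite comp_lfun0r.
  move: h' hh'; rewrite -/(hom_zero (Q l) G); apply: in_family_ind fG => //.
  - by move=> h' _; apply/lfunP=> x; rewrite zero_lfunE (mod0_eq0 (h' x)).
  - move=> M M' zM zM' h' hh'; rewrite (dsum_homE h').
    have -> : (dfst \o h')%VF = 0 by apply: zM; auto.
    have -> : (dsnd \o h')%VF = 0 by apply: zM'; auto.
    by rewrite !comp_lfun0r addr0.
  move=> M M' [e [he be]] zM h' hh'; have [eK eVK] := bij_linv be.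
  have heV := is_hom_inv he be.
  rewrite -[h']comp_lfun1l; have -> : \1%VF = (e \o e^-1)%VF.
    by apply/lfunP=> x; rewrite comp_lfunE eVK id_lfunE.
  have e0 : (e^-1 \o h')%VF = 0 by apply: zM; auto.
  by rewrite -comp_lfunA e0 comp_lfun0r.
have dQ l Z : hom_zero (Q l) Z -> dimhom (Q l) Z = 0%N.
  move=> z; apply/eqP; rewrite dimv_eq0 -subv0; apply/subvP=> h /homsP/z->.
  exact: mem0v.
pose w := dimcol (X j) - dimcol N.
pose T i := @postc _ (X i) _ _ (incl (submod_limg hf)).
have Tinj i : {in homs (X i) N, forall g, T i g = 0 -> g = 0}.
  move=> g _; rewrite postcE => e; apply/lfunP=> x; apply: (@incl_inj _ _ _ _ (submod_limg hf)).
  by rewrite -comp_lfunE e !zero_lfunE lf0.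
have Tsub i : (T i @: homs (X i) N <= homs (X i) (X j))%VS.
  apply/subvP=> _ /memv_imgP[g /homsP hg' ->]; rewrite postcE; apply/homsP.
  by apply: is_hom_comp => //; exact: incl_hom.
(* The identity of [X j] does not factor through N, because [f] is not onto. *)
have dlt : (dimhom (X j) N < dimhom (X j) (X j))%N.
  rewrite /dimhom -(dim_img_inj (@Tinj j)) ltn_neqAle dimvS ?Tsub // andbT.
  apply/negP=> /eqP e; have : (\1%VF : 'Hom(X j, X j)) \in (T j @: homs (X j) N)%VS.
    have /eqP -> : (T j @: homs (X j) N)%VS == homs (X j) (X j) by rewrite eqEdim Tsub e leqnn.
    by apply/homsP; exact: is_hom1.
  case/memv_imgP=> g _; rewrite postcE => e1; apply: nf => y.
  have : y \in limg f by rewrite -[y]id_lfunE e1 comp_lfunE inclE subvsP.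
  by case/memv_imgP=> x _ ->; exists x.
(* For a member other than [X j], every map to [X j] lands in im f by the choice of the test
   pair. *)
have deq i : I i -> i != j -> dimhom (X i) N = dimhom (X i) (X j).
  move=> Ii ij; rewrite /dimhom -(dim_img_inj (@Tinj i)); congr (\dim _).
  apply/eqP; rewrite eqEsubv Tsub; apply/subvP=> h /homsP hh.
  have hl x : h x \in limg f.
    apply: (subvP (fmax i h Ii hh _)); [by left; apply/eqP | exact: mem_limg].
  have <- : T i (corestr (submod_limg hf) h) = h by rewrite postcE incl_corestr.
  by apply/memv_img/homsP; exact: corestr_hom.
have gw i : (gvec (X i) *m w) 0 0 = (dimhom (X i) (X j))%:R - (dimhom (X i) N)%:R.
  by rewrite mulmxBr mxE [X in _ + X]mxE !gvec_dimcol.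
have qw l : (mv (Q l) *m w) 0 0 = 0.
  by rewrite mulmxBr mxE [X in _ + X]mxE !mv_dimcol // !dQ // subrr.
have := congr1 (fun v : 'rV[rat]_n => (v *m w) 0 0) rel.
rewrite /= mul0mx [RHS]mxE mulmxDl mxE !mulmx_suml !summxE.
rewrite [X in _ + X]big1 => [|l _]; last by rewrite -scalemxAl mxE qw mulr0.
rewrite addr0 (bigD1 j) //= big1 => [|i ij].
  rewrite addr0 -scalemxAl mxE gw => /eqP; rewrite mulf_eq0 (negPf Ij) /= subr_eq0.
  by rewrite Num.Theory.eqr_nat => /eqP e; rewrite e ltnn in dlt.
rewrite -scalemxAl mxE gw; have [->|ai] := eqVneq (a 0 i) 0; first by rewrite mul0r.
by rewrite deq // subrr mulr0.
Qed.

(** Once the coefficients of the [X i] vanish, the rest is a relation between distinct unit vectors,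
    since each [Q j] is isomorphic to exactly one of the [PP l]. *)
Theorem gvec_independent : row_free gmx.
Proof.
apply: inj_row_free => v; rewrite -[v]hsubmxK mul_row_col !mulmx_sum_row => rel.
have a0 : lsubmx v = 0.
  apply: (@gvec_relation_zero _ (rsubmx v)); rewrite -[RHS]rel.
  by congr (_ + _); apply: eq_bigr => i _; rewrite rowK.
suff b0 : rsubmx v = 0 by rewrite a0 b0 row_mx0.
move: rel; rewrite a0 big1 ?add0r => [rel|i _]; last by rewrite mxE scale0r.
apply/rowP=> j; rewrite mxE; have [l el] := proj_indec (@Qp j) (Qi j) (summand_refl _).
have := congr1 (fun u : 'rV[rat]_n => u 0 l) rel.
rewrite summxE [RHS]mxE (bigD1 j) //= big1 => [|i ij]; last first.
  rewrite rowK !mxE mu_indec //; case: asboolP => [e|_]; last by rewrite mulr0.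
  by case/eqP: ij; apply: Qn; apply: iso_trans (iso_sym e) (iso_sym el).
rewrite addr0 rowK !mxE mu_indec //; case: asboolP => [_|[]]; last exact: iso_sym.
by rewrite mulr1.
Qed.

Lemma tau_rigid_pair_le : (t + s <= n)%N.
Proof. by move: gvec_independent => /eqP <-; exact: rank_leq_col. Qed.

End Independence.
End GVector.
End DimHom.

(** * Additive functors between module categories *)

Section AdditiveFunctor.
Variables (k : fieldType) (C D : falgType k) (F : fdmod C -> fdmod D).
Variable (Fm : forall M N : fdmod C, 'Hom(M, N) -> 'Hom(F M, F N)).
Definition additive_functor : Prop :=
  [/\ forall (M N : fdmod C) (f : 'Hom(M, N)), is_hom f -> is_hom (Fm f),
      forall M : fdmod C, Fm (\1%VF : 'Hom(M, M)) = \1%VF,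
      forall (M N P : fdmod C) (f : 'Hom(N, P)) (g : 'Hom(M, N)),
        is_hom f -> is_hom g -> Fm (f \o g)%VF = (Fm f \o Fm g)%VF
    & forall (M N : fdmod C) (f g : 'Hom(M, N)),
        is_hom f -> is_hom g -> Fm (f + g) = Fm f + Fm g].
Hypothesis Ff : additive_functor.

Lemma functor0 (M N : fdmod C) : Fm (0 : 'Hom(M, N)) = 0.
Proof.
have [_ _ _ FD] := Ff; apply: (addrI (Fm 0)); rewrite addr0 -FD ?addr0 //;
  exact: is_hom0.
Qed.

Lemma functor_iso (M N : fdmod C) : iso M N -> iso (F M) (F N).
Proof.
have [Fh F1 Fc FD] := Ff; move=> /isoP[f [g [hf hg gf fg]]].
by apply/isoP; exists (Fm f), (Fm g); split; auto; rewrite -Fc // (gf, fg) F1.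
Qed.

Lemma functor_dsum (M X Y : fdmod C) : iso M (dsum X Y) -> iso (F M) (dsum (F X) (F Y)).
Proof.
have [Fh F1 Fc FD] := Ff.
move=> /iso_dsumP[i [p [j [q [[hi hp hj hq] [pi qj pj qi] e]]]]].
apply/iso_dsumP; exists (Fm i), (Fm p), (Fm j), (Fm q); split; first by split; auto.
  by split; rewrite -Fc // (pi, qj, pj, qi) ?F1 ?functor0.
by rewrite -!Fc // -FD ?e ?F1; auto.
Qed.

Lemma functor_summand (X M : fdmod C) : summand X M -> summand (F X) (F M).
Proof. by move=> [Y /functor_dsum e]; exists (F Y). Qed.

Lemma functor_zero (M : fdmod C) : (forall x : M, x = 0) -> forall x : F M, x = 0.
Proof.
have [Fh F1 Fc FD] := Ff; move=> z x.
have e : (\1%VF : 'Hom(M, M)) = 0 by apply/lfunP=> y; rewrite (z (\1%VF y)) zero_lfunE.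
by rewrite -[x]id_lfunE -F1 e functor0 zero_lfunE.
Qed.

End AdditiveFunctor.

Section Inj.
Variables (k : fieldType) (C : falgType k).
(** A version of [retract_summand] that names the complement, needed to identify what A contains
    besides B. *)
Lemma retract_dsum (X M : fdmod C) (i : 'Hom(X, M)) (r : 'Hom(M, X)) (hr : is_hom r) :
  is_hom i -> (r \o i = \1)%VF -> iso M (dsum X (subm (submod_lker hr))).
Proof.
move=> hi ri; have riE x : r (i x) = x by rewrite -comp_lfunE ri id_lfunE.
pose e := (\1 - (i \o r))%VF; have he : is_hom e by rewrite /e; auto.
have eE x : e x = x - i (r x) by rewrite sub_lfunE id_lfunE comp_lfunE.
have eK x : e x \in lker r by rewrite memv_ker eE lfB riE subrr.
apply/iso_dsumP; exists i, r, (incl _), (corestr (submod_lker hr) e).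
split; first by split; auto; exact: corestr_hom.
  split=> //.
  - apply/lfunP=> x; rewrite id_lfunE comp_lfunE; apply: val_inj.
    rewrite /= corestrE // eE inclE.
    by have := subvsP x; rewrite memv_ker => /eqP->; rewrite lf0 subr0.
  - apply/lfun_ext0=> x; rewrite comp_lfunE inclE.
    by have := subvsP x; rewrite memv_ker => /eqP.
  apply/lfun_ext0=> x; rewrite comp_lfunE; apply: val_inj.
  by rewrite /= corestrE // eE riE subrr.
by rewrite incl_corestr // /e addrC subrK.
Qed.
End Inj.

(** * Restriction, inflation and the functor E *)

Section OnePoint.
Variables (k : fieldType) (B : falgType k) (P0 : fdmod B).
Local Notation A := (opext P0).
Implicit Types (T : fdmod A) (M N Q : fdmod B) (a : A) (b : B).

Local Notation eB := (eB P0).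
Local Notation inc := (opext_incl P0).
Definition eO : A := (0, 0, 1).

Lemma incM b b' : inc (b * b') = inc b * inc b'.
Proof. by congr (_, _, _); rewrite /= ?mactr0 ?scaler0 ?addr0 ?mulr0. Qed.
Lemma inc_linear : linear inc.
Proof. by move=> c x y; congr (_, _, _); rewrite /= ?scaler0 ?addr0. Qed.
Lemma mul_eB a : a * eB = inc a.1.1.
Proof. by congr (_, _, _); rewrite /= ?mulr1 ?mactr0 ?scale0r ?addr0 ?mulr0. Qed.
Lemma eB_inc b : eB * inc b = inc b.
Proof. by rewrite /Defs.eB -incM mul1r. Qed.
Lemma inc_eB b : inc b * eB = inc b.
Proof. by rewrite mul_eB. Qed.
Lemma eO_mul a : eO * a = (a.2 : k) *: eO.
Proof.
congr (_, _, _); rewrite /= ?mul0r ?scaler0 ?mactl0 ?add0r ?mul1r //.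
by rewrite [RHS]mulr1.
Qed.
Lemma eBO : eB + eO = 1.
Proof. by congr (_, _, _); rewrite /= ?addr0 ?add0r. Qed.
Lemma eB_eO : eB * eO = 0.
Proof. by congr (_, _, _); rewrite /= ?mulr0 ?mactr0 ?scaler0 ?addr0 ?mul0r. Qed.
Lemma eO_eB : eO * eB = 0.
Proof. by rewrite eO_mul scale0r. Qed.

(** Since a e_B is the B-entry of the matrix [a], only that entry acts on vectors fixed by e_B. In
    particular e_B T is stable under all of A. *)
Lemma fix_act T a (x : T) : mact eB x = x -> mact a x = mact (inc a.1.1) x.
Proof. by move=> e; rewrite -{1}e -mactM mul_eB. Qed.

(** * The restriction functor R T = e_B T *)

Section Restriction.
Variable T : fdmod A.
Definition Rspace : {vspace T} := limg (actl T eB).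
Lemma RspaceP (x : T) : x \in Rspace <-> mact eB x = x.
Proof.
split=> [/memv_imgP[y _ ->]|<-]; last by rewrite -actlE mem_limg.
by rewrite actlE -mactM eB_inc.
Qed.
Lemma Rspace_fix (x : subvs_of Rspace) : mact eB (vsval x) = vsval x.
Proof. exact/RspaceP/subvsP. Qed.
Lemma Rspace_inc b (x : T) : mact (inc b) x \in Rspace.
Proof. by apply/RspaceP; rewrite -mactM eB_inc. Qed.
Lemma Rspace_submod : submod Rspace.
Proof. by move=> a x /RspaceP/fix_act->; exact: Rspace_inc. Qed.

Definition Ract b (x : subvs_of Rspace) : subvs_of Rspace := vsproj Rspace (mact (inc b) (vsval x)).
Lemma RactE b x : vsval (Ract b x) = mact (inc b) (vsval x).
Proof. by rewrite vsprojK // Rspace_inc. Qed.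
Fact Ract_linearl x : linear (Ract^~ x).
Proof.
move=> c b b'; apply/val_inj; rewrite /= !RactE inc_linear.
by rewrite mact_linearl.
Qed.
Fact Ract_linearr b : linear (Ract b).
Proof. by move=> c x y; apply/val_inj; rewrite /= !RactE mact_linearr. Qed.
Fact Ract1 x : Ract 1 x = x.
Proof. by apply/val_inj; rewrite /= RactE Rspace_fix. Qed.
Fact RactM b b' x : Ract (b * b') x = Ract b (Ract b' x).
Proof. by apply/val_inj; rewrite /= !RactE incM mactM. Qed.
Definition Rmod : fdmod B := FdMod Ract_linearl Ract_linearr Ract1 RactM.

Definition Rval : 'Hom(Rmod, T) := linfun (fun x : subvs_of Rspace => vsval x).
Lemma RvalE (x : subvs_of Rspace) : Rval x = vsval x.
Proof. by rewrite linfunE. Qed.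
Lemma Rval_inj : injective Rval.
Proof. by move=> x y; rewrite !RvalE => /val_inj. Qed.
Lemma Rval_fix (x : Rmod) : mact eB (Rval x) = Rval x.
Proof. by rewrite RvalE Rspace_fix. Qed.
Lemma Rval_mact b (x : Rmod) : Rval (mact b x) = mact (inc b) (Rval x).
Proof. by rewrite !RvalE RactE. Qed.
Lemma Rproj_ex : exists f : 'Hom(T, Rmod), forall x, Rval (f x) = mact eB x.
Proof.
exists ((linfun (vsproj Rspace) : 'Hom(T, subvs_of Rspace)) \o actl T eB)%VF => x.
by rewrite RvalE comp_lfunE lfunE vsprojK actlE ?Rspace_inc.
Qed.
Definition Rproj : 'Hom(T, Rmod) := sval (cid Rproj_ex).
Lemma RprojE (x : T) : Rval (Rproj x) = mact eB x.
Proof. exact: (svalP (cid Rproj_ex)). Qed.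
Lemma RprojK (x : Rmod) : Rproj (Rval x) = x.
Proof. by apply: Rval_inj; rewrite RprojE Rval_fix. Qed.
Lemma RvalK (x : T) : mact eB x = x -> Rval (Rproj x) = x.
Proof. by rewrite RprojE. Qed.
Lemma Rproj_inc b (x : T) : Rproj (mact (inc b) x) = mact b (Rproj x).
Proof. by apply: Rval_inj; rewrite Rval_mact !RprojE -!mactM eB_inc inc_eB. Qed.
End Restriction.
Arguments Rval {T}.

Definition Rmap T T' (f : 'Hom(T, T')) : 'Hom(Rmod T, Rmod T') :=
  (Rproj T' \o (f \o Rval))%VF.
Lemma RmapE T T' (f : 'Hom(T, T')) x : is_hom f -> Rval (Rmap f x) = f (Rval x).
Proof. by move=> hf; rewrite comp_lfunE RprojE comp_lfunE -hf Rval_fix. Qed.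
Lemma Rmap_functor : additive_functor Rmap.
Proof.
split=> [M N f hf|M|M N P f g hf hg|M N f g hf hg].
- by move=> b x; apply: Rval_inj; rewrite Rval_mact !RmapE // Rval_mact hf.
- by apply/lfunP=> x; apply: Rval_inj; rewrite RmapE ?id_lfunE.
- by apply/lfunP=> x; apply: Rval_inj; rewrite comp_lfunE !RmapE ?comp_lfunE; auto.
by rewrite /Rmap comp_lfunDl comp_lfunDr.
Qed.
Lemma Rmap_hom T T' (f : 'Hom(T, T')) : is_hom f -> is_hom (Rmap f).
Proof. by have [h _ _ _] := Rmap_functor; exact: h. Qed.

Lemma Rmap_surj T T' (f : 'Hom(T, T')) : is_hom f -> surj f -> surj (Rmap f).
Proof.
move=> hf fs y; have [x ex] := fs (Rval y); exists (Rproj T x).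
by apply: Rval_inj; rewrite RmapE // RprojE hf ex Rval_fix.
Qed.

Lemma Rmap_exact T T' T'' (d : 'Hom(T, T')) (p : 'Hom(T', T'')) : is_hom d -> is_hom p ->
  limg d = lker p -> limg (Rmap d) = lker (Rmap p).
Proof.
move=> hd hp dk; apply/vspaceP=> y; rewrite memv_ker.
have -> : (Rmap p y == 0) = (Rval y \in lker p).
  by rewrite memv_ker -(inj_eq (@Rval_inj T'')) RmapE // lf0.
rewrite -dk; apply/memv_imgP/memv_imgP=> [[x _ ->]|[x _ ex]].
  by exists (Rval x); rewrite ?memvf // RmapE.
exists (Rproj T x); first exact: memvf.
by apply: Rval_inj; rewrite RmapE // RprojE hd -ex Rval_fix.
Qed.

(** * Modules over B as modules over A *)

(** [Rcor] and [Rext] are the two directions of the adjunction between Hom_A(inflate Q, T) and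
    Hom_B(Q, R T); [Q] and its inflation share one vector space. *)
Definition Rcor Q T (f : 'Hom(Q, T)) : 'Hom(Q, Rmod T) := (Rproj T \o f)%VF.
Lemma RcorE Q T (f : 'Hom(inflate P0 Q, T)) x : is_hom f -> Rval (Rcor (Q := Q) f x) = f x.
Proof. by move=> hf; rewrite comp_lfunE RprojE -hf /= mact1. Qed.
Lemma Rcor_hom Q T (f : 'Hom(inflate P0 Q, T)) : is_hom f -> is_hom (Rcor (Q := Q) f).
Proof. by move=> hf b x; apply: Rval_inj; rewrite Rval_mact !RcorE // -hf. Qed.
Definition Rext Q T (h : 'Hom(Q, Rmod T)) : 'Hom(inflate P0 Q, T) := (Rval \o h)%VF.
Lemma RextE Q T (h : 'Hom(Q, Rmod T)) x : Rext h x = Rval (h x).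
Proof. exact: comp_lfunE. Qed.
Lemma Rext_hom Q T (h : 'Hom(Q, Rmod T)) : is_hom h -> is_hom (Rext h).
Proof.
by move=> hh a x; rewrite !RextE hh Rval_mact (@fix_act T a) ?Rval_fix.
Qed.

Definition infm M N (f : 'Hom(M, N)) : 'Hom(inflate P0 M, inflate P0 N) := f.
Lemma infm_functor : additive_functor infm.
Proof. by split=> // M N f hf a x; exact: hf. Qed.

Lemma inflate_fix M (x : inflate P0 M) : mact eB x = x.
Proof. exact: mact1. Qed.

Lemma R_inflate M : iso M (Rmod (inflate P0 M)).
Proof.
exists (Rcor (Q := M) (\1%VF : 'Hom(inflate P0 M, inflate P0 M))).
split; first by apply: Rcor_hom; exact: is_hom1.
exists (fun x => (Rval x : inflate P0 M)) => x; last apply: Rval_inj;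
  by rewrite RcorE ?id_lfunE //; exact: is_hom1.
Qed.

Lemma inflate_R T : (forall x : T, mact eB x = x) -> iso T (inflate P0 (Rmod T)).
Proof.
move=> h; apply: iso_sym; exists (Rext (\1%VF : 'Hom(Rmod T, Rmod T))).
split; first by apply: Rext_hom; exact: is_hom1.
exists (fun x => Rproj T x) => x; rewrite RextE id_lfunE; first exact: RprojK.
exact: RvalK.
Qed.

Lemma fix_hom T T' (f : 'Hom(T, T')) : is_hom f -> injective f ->
  (forall x : T', mact eB x = x) -> forall x : T, mact eB x = x.
Proof. by move=> hf fi h x; apply: fi; rewrite hf h. Qed.

Lemma fix_summand T T' : summand T T' ->
  (forall x : T', mact eB x = x) -> forall x : T, mact eB x = x.
Proof.
move=> /summandP[i [r [hi hr ri]]]; apply: (fix_hom hi).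
by apply: (can_inj (g := r)) => x; rewrite -comp_lfunE ri id_lfunE.
Qed.

(** Inflation is left adjoint to [R], and [R] preserves surjections. *)
Lemma inflate_projective Q : projective Q -> projective (inflate P0 Q).
Proof.
move=> Qp M N g f hg gs hf.
have [h [hh eh]] := Qp _ _ _ _ (Rmap_hom hg) (Rmap_surj hg gs) (Rcor_hom hf).
exists (Rext h); split; first exact: Rext_hom.
apply/lfunP=> x; rewrite comp_lfunE RextE -RmapE // -[Rmap g _]comp_lfunE eh.
exact: RcorE.
Qed.

Lemma hom_zero_inflate Q T : hom_zero (inflate P0 Q) T <-> hom_zero Q (Rmod T).
Proof.
split=> z f hf.
  have := z _ (Rext_hom hf) => e; apply/lfunP=> x; apply: Rval_inj.
  by rewrite -RextE e !zero_lfunE lf0.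
have := z _ (Rcor_hom hf) => e; apply/lfunP=> x.
by rewrite -RcorE // e !zero_lfunE lf0.
Qed.

(** * The functor E *)

Definition eU : U P0 := vsproj (eBA P0) eB.
Lemma mem_eBA x : (x \in eBA P0) = (eB * x == x).
Proof.
apply/memv_imgP/eqP=> [[y _ ->]|<-]; first by rewrite lfunE /= mulrA -incM mulr1.
by exists x; rewrite ?memvf // lfunE.
Qed.
Lemma eUE : vsval eU = eB.
Proof. by rewrite vsprojK // mem_eBA -incM mulr1. Qed.
Lemma U_fix (u : U P0) : eB * vsval u = vsval u.
Proof. by apply/eqP; rewrite -mem_eBA subvsP. Qed.
Lemma eU_bract (u : U P0) : bract eU (vsval u) = u.
Proof. by apply: val_inj; rewrite /= U_ractE eUE U_fix. Qed.
Lemma eU_inc b : bract eU (inc b) = mact b eU.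
Proof. by apply: val_inj; rewrite /= U_ractE U_lactE eUE eB_inc inc_eB. Qed.

Section Adjunction.
Variable M : fdmod B.
Local Notation E := (functE P0 M).
Definition appl (f : E) : 'Hom(U P0, M) := vsval f.
Lemma appl_hom (f : E) : is_hom (appl f).
Proof. by apply/homsP; exact: subvsP. Qed.
Lemma appl_mact a (f : E) u : appl (mact a f) u = appl f (bract u a).
Proof. exact: hom_bimod_actE. Qed.
Lemma appl_inj (f g : E) : (forall u, appl f u = appl g u) -> f = g.
Proof. by move=> h; apply/val_inj/lfunP. Qed.
Lemma applE (f : E) u : appl f u = appl (mact (vsval u) f) eU.
Proof. by rewrite appl_mact eU_bract. Qed.
Lemma appl0 u : appl 0 u = 0.
Proof. by rewrite /appl linear0 zero_lfunE. Qed.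

Lemma applD (f g : E) u : appl (f + g) u = appl f u + appl g u.
Proof. by rewrite /appl linearD add_lfunE. Qed.

(** The value of f t at u is the value of u (f t) = f (u t) at e_B, and u t lies in e_B T, where [f]
    vanishes. *)
Lemma functE_faithful T (f : 'Hom(T, E)) : is_hom f -> Rmap f = 0 -> f = 0.
Proof.
move=> hf e; apply/lfun_ext0=> t; apply: appl_inj => u; rewrite appl0 applE -hf.
have h : mact eB (mact (vsval u : A) t) = mact (vsval u : A) t by rewrite -mactM U_fix.
by rewrite -(RvalK h) -RmapE // e zero_lfunE lf0 appl0.
Qed.

Definition Eval : 'Hom(Rmod E, M) := linfun (fun x : Rmod E => appl (Rval x) eU).
Lemma EvalE x : Eval x = appl (Rval x) eU.
Proof.
rewrite linfunE // => c y z.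
by rewrite linearP /appl linearP add_lfunE scale_lfunE.
Qed.
Lemma Eval_hom : is_hom Eval.
Proof.
move=> b x; rewrite !EvalE Rval_mact appl_mact eU_inc; exact: appl_hom.
Qed.

Section Transpose.
Variables (T : fdmod A) (g : 'Hom(Rmod T, M)).
Hypothesis hg : is_hom g.
Definition transp_fun (t : T) : 'Hom(U P0, M) :=
  (g \o (Rproj T \o linfun (fun u : U P0 => mact (vsval u : A) t)))%VF.
Lemma transp_funE t u : transp_fun t u = g (Rproj T (mact (vsval u : A) t)).
Proof.
rewrite !comp_lfunE linfunE // => c x y.
by rewrite linearP mact_linearl.
Qed.
Lemma transp_fun_hom t : is_hom (transp_fun t).
Proof.
move=> b u; rewrite !transp_funE [vsval (mact b u)]U_lactE mactM -hg.
by rewrite Rproj_inc.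
Qed.
(** The adjunct T -> E M of g : R T -> M; the counit is [Eval]. *)
Definition transp : 'Hom(T, E) := linfun (fun t => vsproj (homs (U P0) M) (transp_fun t)).
Lemma transpE t u : appl (transp t) u = g (Rproj T (mact (vsval u : A) t)).
Proof.
rewrite linfunE => [|c x y].
  by rewrite /appl vsprojK ?transp_funE //; apply/homsP; exact: transp_fun_hom.
rewrite -linearP; congr (vsproj _ _); apply/lfunP=> v.
by rewrite add_lfunE scale_lfunE !transp_funE mact_linearr !linearP.
Qed.
Lemma transp_hom : is_hom transp.
Proof.
by move=> a t; apply: appl_inj => u; rewrite appl_mact !transpE U_ractE mactM.
Qed.
Lemma Eval_transp : (Eval \o Rmap transp)%VF = g.
Proof.
apply/lfunP=> x; rewrite comp_lfunE EvalE RmapE ?transpE ?eUE; last exact: transp_hom.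
by rewrite Rval_fix RprojK.
Qed.
End Transpose.

(** An element of e_B (E M) is determined by its value at e_B, which gives injectivity. Surjectivity
    follows because the isomorphism R(inflate M) -> M factors through the counit. *)
Lemma Eval_bij : bijective Eval.
Proof.
have [i [hi /bij_linv[iK iVK]]] := R_inflate M.
have i_inj : injective Eval.
  move=> x y e; apply: Rval_inj; apply: appl_inj => u.
  have h (z : Rmod E) : appl (Rval z) u = mact (vsval u).1.1 (Eval z).
    rewrite EvalE -appl_hom -eU_inc -appl_mact applE; congr (appl _ _).
    by apply: fix_act; exact: Rval_fix.
  by rewrite !h e.
have Es : surj Eval.
  move=> y; have hiV : is_hom (i^-1)%VF by apply: is_hom_inv => //; exists (i^-1)%VF.
  exists (Rmap (transp (i^-1)%VF) (i y)); rewrite -comp_lfunE Eval_transp //.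
have Ek : lker Eval == 0%VS by apply/lker0P.
exists (Eval^-1)%VF; first exact: lker0_lfunK.
by move=> y; rewrite limg_lfunVK //; have [x <-] := Es y; exact: mem_limg.
Qed.

Lemma R_functE : iso (Rmod E) M.
Proof. by exists Eval; split; [exact: Eval_hom | exact: Eval_bij]. Qed.

Lemma functE_full T (h : 'Hom(Rmod T, Rmod E)) : is_hom h ->
  exists f : 'Hom(T, E), is_hom f /\ Rmap f = h.
Proof.
move=> hh; have hg : is_hom (Eval \o h)%VF by apply: is_hom_comp => //; exact: Eval_hom.
exists (transp (Eval \o h)%VF); split; first exact: transp_hom.
apply/lfunP=> x; apply: (bij_inj Eval_bij).
by rewrite -comp_lfunE Eval_transp // comp_lfunE.
Qed.
End Adjunction.

Definition Em M N (f : 'Hom(M, N)) : 'Hom(functE P0 M, functE P0 N) :=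
  linfun (fun x => vsproj (homs (U P0) N) (f \o appl x)%VF).
Lemma EmE M N (f : 'Hom(M, N)) x u : is_hom f -> appl (Em f x) u = f (appl x u).
Proof.
move=> hf; rewrite linfunE => [|c y z].
  rewrite /appl vsprojK ?comp_lfunE //; apply/homsP; apply: is_hom_comp => //.
  exact: appl_hom.
rewrite -linearP; congr (vsproj _ _); apply/lfunP=> v.
rewrite add_lfunE scale_lfunE !comp_lfunE.
by rewrite /appl linearP add_lfunE scale_lfunE linearP.
Qed.
Lemma Em_functor : additive_functor Em.
Proof.
split=> [M N f hf|M|M N P f g hf hg|M N f g hf hg].
- by move=> a x; apply: appl_inj => u; rewrite appl_mact !EmE // appl_mact.
- by apply/lfunP=> x; apply: appl_inj => u; rewrite EmE ?id_lfunE.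
- by apply/lfunP=> x; apply: appl_inj => u; rewrite comp_lfunE !EmE ?comp_lfunE; auto.
apply/lfunP=> x; apply: appl_inj => u; rewrite EmE; last by auto.
by rewrite [X in _ = appl X _]add_lfunE applD !EmE // add_lfunE.
Qed.

(** * R T as a tensor product *)

Section Tensor.
Variable T : fdmod A.
Definition tensor_map : 'Hom(U P0, 'Hom(T, Rmod T)) :=
  linfun (fun u : U P0 => (Rproj T \o actl T (vsval u : A))%VF).
Lemma tensor_mapE u x : tensor_map u x = Rproj T (mact (vsval u : A) x).
Proof.
rewrite linfunE ?comp_lfunE ?actlE // => c v w; apply/lfunP=> y.
rewrite add_lfunE scale_lfunE !comp_lfunE !actlE linearP mact_linearl.
by rewrite linearP.
Qed.

Lemma R_tensor : is_functR T (Rmod T).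
Proof.
exists tensor_map; split=> [u a m|b u m|Z s sb].
- by rewrite !tensor_mapE U_ractE mactM.
- by rewrite !tensor_mapE [vsval (mact b u)]U_lactE mactM Rproj_inc.
exists (s eU \o Rval)%VF; split=> [u m|g eg].
  rewrite comp_lfunE tensor_mapE RprojE -mactM U_fix.
  by rewrite -{1}(eU_bract u) sb.
apply/lfunP=> x; rewrite comp_lfunE eg tensor_mapE eUE.
by rewrite Rval_fix RprojK.
Qed.

Lemma tensor_iso X : is_functR T X -> iso (Rmod T) X.
Proof.
move=> [t [tb tm tu]].
have [|g [eg _]] := tu (Rmod T) tensor_map.
  by move=> u a m; rewrite !tensor_mapE U_ractE mactM.
pose g' := (t eU \o Rval)%VF.
have g'E x : g' x = t eU (Rval x) by rewrite comp_lfunE.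
have eg' u m : t u m = g' (tensor_map u m).
  by rewrite g'E tensor_mapE RprojE -mactM U_fix -{1}(eU_bract u) tb.
exists g'; split.
  by move=> b x; rewrite !g'E Rval_mact -tb eU_inc tm.
exists g => x; first by rewrite g'E -eg tensor_mapE eUE Rval_fix RprojK.
have [h [_ hu]] := tu _ _ tb.
have e1 : h = (g' \o g)%VF by apply: hu => u m; rewrite comp_lfunE -eg -eg'.
have e2 : h = \1%VF by apply: hu => u m; rewrite id_lfunE.
by rewrite -[g' _]comp_lfunE -e1 e2 id_lfunE.
Qed.
End Tensor.

End OnePoint.
Arguments Rval {k B P0 T}.

(** * The new projective, its simple top, and minimal presentations over A *)

Section NewProjective.
Variables (k : closedFieldType) (B : falgType k) (P0 : fdmod B).
Local Notation A := (opext P0).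
Implicit Types (T N S : fdmod A) (M Q : fdmod B).

Local Notation eB := (eB P0).
Local Notation eO := (eO P0).
Local Notation inc := (opext_incl P0).

Definition projB : 'Hom(regmod A, inflate P0 (regmod B)) := linfun (fun x : A => x.1.1).
Lemma projBE (x : A) : projB x = x.1.1.
Proof. by rewrite linfunE. Qed.
Lemma projB_hom : is_hom projB.
Proof. by move=> a x; rewrite !projBE. Qed.
Definition incB : 'Hom(inflate P0 (regmod B), regmod A) := linfun (fun b : B => inc b).
Lemma incBE (b : B) : incB b = inc b.
Proof. by rewrite linfunE //; exact: inc_linear. Qed.
Lemma incB_hom : is_hom incB.
Proof.
move=> a b; rewrite !incBE; congr (_, _, _); rewrite /= ?mulr0 //.
by rewrite mactr0 scale0r addr0.
Qed.
Lemma projB_incB : (projB \o incB = \1)%VF.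
Proof. by apply/lfunP=> b; rewrite comp_lfunE projBE incBE id_lfunE. Qed.

(* The projective A e_oo = (0, P0, k) at the new vertex. *)
Definition Ptl : fdmod A := subm (submod_lker projB_hom).

Lemma regA_iso : iso (regmod A) (dsum (inflate P0 (regmod B)) Ptl).
Proof. exact: retract_dsum incB_hom projB_incB. Qed.

Lemma Ptl_ker (x : Ptl) : (vsval x : A).1.1 = 0.
Proof. by have := subvsP x; rewrite memv_ker projBE => /eqP. Qed.
Lemma mem_Ptl (x : A) : x.1.1 = 0 -> x \in lker projB.
Proof. by move=> e; rewrite memv_ker projBE e. Qed.

Lemma Ptl_act (a : A) (x : Ptl) : vsval (mact a x : Ptl) = a * (vsval x : A).
Proof. exact: (@subm_actE _ _ (regmod A) _ (submod_lker projB_hom) a x). Qed.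

Definition Ptop : Ptl := vsproj _ (eO : regmod A).
Lemma PtopE : vsval Ptop = eO.
Proof. by rewrite vsprojK //; exact: mem_Ptl. Qed.

Lemma Ptl_gen (x : Ptl) : x = mact (vsval x : A) Ptop.
Proof.
apply: subvs_inj; rewrite Ptl_act PtopE; have := Ptl_ker x.
case: (vsval x) => [[b p] c] /= ->; congr (_, _, _); rewrite /= ?mul0r ?mulr1 //.
by rewrite mactl0 add0r scale1r.
Qed.
Lemma Ptl_eO (x : Ptl) : mact eO x = ((vsval x : A).2 : k) *: Ptop.
Proof. by apply: subvs_inj; rewrite Ptl_act eO_mul linearZ /= PtopE. Qed.
Lemma Ptop_eO : mact eO Ptop = Ptop.
Proof. by rewrite Ptl_eO PtopE scale1r. Qed.
Lemma Ptop_neq0 : Ptop <> 0.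
Proof.
move=> e; have := PtopE; rewrite e linear0 => -[] /eqP.
by rewrite eq_sym oner_eq0.
Qed.

(** The space e_oo Ptl is the line of [Ptop], and [Ptop] generates. In a decomposition write [Ptop]
    as (x0, y0); then (x0, 0) is also fixed by e_oo, hence a multiple of (x0, y0), so x0 or y0 is
    zero and with it the summand it generates. *)
Lemma indec_Ptl : indecomposable Ptl.
Proof.
split=> [|X Y [f [hf /bij_linv[fK fVK]]]]; first by exists Ptop; exact: Ptop_neq0.
have hV : is_hom (f^-1)%VF by apply: is_hom_inv => //; exists (f^-1)%VF.
case ev: (f Ptop) => [x0 y0].
have [ex ey] : mact eO x0 = x0 /\ mact eO y0 = y0.
  by have := hf eO Ptop; rewrite Ptop_eO ev => -[<- <-].
have gen x y : exists a : A, (x, y) = (mact a x0, mact a y0).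
  exists (vsval ((f^-1)%VF (x, y)) : A).
  by rewrite -[LHS]fVK [X in f X]Ptl_gen hf ev.
have [c ec] : exists c, (x0, 0) = c *: (x0, y0) :> dsum X Y.
  have e1 : mact eO ((x0, 0) : dsum X Y) = (x0, 0) by rewrite /= ex mactr0.
  exists ((vsval ((f^-1)%VF (x0, 0)) : A).2 : k).
  by rewrite -[in LHS]e1 -{1}[(x0, 0)]fVK -hf Ptl_eO linearZ /= ev.
have [c0|c0] := eqVneq c 0; [left|right]; apply: zero_iso => z.
  have x00 : x0 = 0 by move: ec; rewrite c0 scale0r => -[].
  by have [a [-> _]] := gen z 0; rewrite x00 mactr0.
have y00 : y0 = 0.
  by move: ec => -[_ /esym/eqP]; rewrite scaler_eq0 (negPf c0) => /eqP.
by have [a [_ ->]] := gen 0 z; rewrite y00 mactr0.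
Qed.

Lemma R_Ptl : iso P0 (Rmod Ptl).
Proof.
pose i (p : P0) : A := (0, p, 0).
have iL : linear (fun p : P0 => vsproj (lker projB) (i p)).
  move=> c p q; rewrite -linearP; congr (vsproj _ _).
  by congr (_, _, _); rewrite /= ?scaler0 ?addr0.
pose f : 'Hom(inflate P0 P0, Ptl) := linfun (fun p : P0 => vsproj (lker projB) (i p)).
have fE p : vsval (f p) = i p by rewrite /f linfunE // vsprojK //; exact: mem_Ptl.
have hf : is_hom f.
  move=> a p; apply: subvs_inj; rewrite Ptl_act !fE; congr (_, _, _); rewrite /= ?mulr0 //.
  by rewrite scale0r addr0.
exists (Rcor (Q := P0) f); split; first exact: Rcor_hom.
exists (fun x : Rmod Ptl => (vsval (Rval x) : A).1.2) => x; first by rewrite RcorE // fE.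
apply: Rval_inj; rewrite RcorE //; apply: subvs_inj; rewrite fE.
have := Rval_fix x => /(congr1 (@vsval _ _ _)); rewrite Ptl_act; have := Ptl_ker (Rval x).
case: (vsval (Rval x)) => [[b p] c] /= -> -[_ e]; rewrite mul0r => <-.
by congr (_, _, _).
Qed.

Section Proj.
Hypothesis P0p : projective P0.

(** [R] sends the regular module A to B + P0; this is where the projectivity of [P0] enters. *)
Lemma R_free n : projective (Rmod (freemod A n)).
Proof.
elim: n => [|n IH].
  apply: projective_iso (@projective0 _ B); apply: zero_iso.
  by apply: functor_zero (@Rmap_functor _ _ P0) _ _; exact: mod0_eq0.
have e := functor_dsum (@Rmap_functor _ _ P0) (iso_refl (freemod A n.+1)).
apply: projective_iso e _; apply: projective_dsum => //.
apply: projective_iso (functor_dsum (@Rmap_functor _ _ P0) regA_iso) _.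
apply: projective_dsum.
  exact: projective_iso (iso_sym (R_inflate P0 (regmod B))) (@projective_reg _ B).
exact: projective_iso (iso_sym R_Ptl) P0p.
Qed.

Lemma R_projective T : projective T -> projective (Rmod T).
Proof.
move=> /projective_summand_free[n s].
exact: projective_summand (functor_summand (@Rmap_functor _ _ P0) s) (@R_free n).
Qed.

Lemma indec_projA T : projective T -> indecomposable T ->
  iso T Ptl \/ forall x : T, mact eB x = x.
Proof.
move=> /projective_summand_free[n s] Ti.
have sA : summand T (regmod A).
  elim: n s => [/(not_summand0 Ti)//|n IH] /(summand_dsum_indec Ti)[//|/IH//].
case: (summand_dsum_indec Ti (iso_summand regA_iso sA)) => {}s.
  by right; apply: fix_summand s _; exact: inflate_fix.
by left; exact: indec_summand_iso indec_Ptl Ti s.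
Qed.

(** Any other indecomposable projective is fixed by e_B, hence inflated from a projective B-module,
    which [is_Ptilde] excludes. *)
Lemma Ptilde_iso Pt : is_Ptilde Pt -> iso Pt Ptl.
Proof.
move=> [Pi Pp nP]; have [//|h] := indec_projA Pp Pi.
by case: (nP _ (R_projective Pp)); exact: inflate_R.
Qed.

(** e_B S is a submodule of the simple [S]. Were it everything, the image s of [Ptop] would satisfy
    s = e_oo s = e_oo e_B s = 0, although it generates [S]. *)
Lemma top_eB Pt S : is_Ptilde Pt -> is_top Pt S -> simple S -> forall x : S, mact eB x = 0.
Proof.
move=> /Ptilde_iso/iso_sym[i [hi bi]] [p [hp ps _]] [[s0 ns0] Ss] x.
have mx : mact eB x \in limg (actl S eB) by rewrite -actlE mem_limg.
have sub : submod (limg (actl S eB)) := @Rspace_submod _ _ _ S.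
have [e0|full] := Ss _ sub; first by move: mx; rewrite e0 memv0 => /eqP.
have fix_ (y : S) : mact eB y = y.
  have yl : y \in limg (actl S eB) by rewrite full memvf.
  exact/(@RspaceP _ _ _ S).
have gs : surj (p \o i)%VF.
  have [iK iVK] := bij_linv bi.
  by move=> y; have [z <-] := ps y; exists ((i^-1)%VF z); rewrite comp_lfunE iVK.
have hg : is_hom (p \o i)%VF by auto.
have g0 : (p \o i)%VF Ptop = 0.
  rewrite -Ptop_eO hg -[(p \o i)%VF Ptop]fix_ -mactM eO_eB.
  exact: mactl0.
by case: ns0; have [z <-] := gs s0; rewrite (Ptl_gen z) hg g0 mactr0.
Qed.

(** * Minimal presentations over A *)

(* Because e_oo rad A = 0. *)
Lemma superfluous_eO T (K : {vspace T}) x : submod K -> superfluous K -> x \in K -> mact eO x = 0.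
Proof.
move=> hK sK xK; apply/eqP; apply: contraT => nx.
have [|l [ly _]] := @separating_form _ T 0%VS (mact eO x); first by rewrite memv0.
set y := mact eO x in nx ly; have yK : y \in K by exact: hK.
have ey : mact eO y = y.
  by rewrite /y -mactM eO_mul scale1r.
(* ker g is a submodule because e_oo a is a scalar multiple of e_oo, and the line of y, contained in
   [K], complements it. Superfluity would make ker g everything, while g y = l y is nonzero. *)
pose g := (l \o actl T eO)%VF; have gE z : g z = l (mact eO z) by rewrite comp_lfunE actlE.
have sg : submod (lker g).
  move=> a z; rewrite !memv_ker !gE -mactM eO_mul mactZl linearZ => /eqP /= ->.
  by rewrite scaler0.
have : lker g = fullv.
  apply: sK => //; apply/vspaceP=> z; rewrite memvf; apply/memv_addP.
  pose c : k := (g z : k) / l y.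
  exists (z - c *: y); last by exists (c *: y); rewrite ?memvZ ?subrK.
  rewrite memv_ker lfB linearZ /= [g y]gE ey; apply/eqP.
  have -> : c *: (l y : k^o) = c * (l y : k) by [].
  by rewrite /c divfK // subrr.
move=> e; have : y \in lker g by rewrite e memvf.
by rewrite memv_ker gE ey (negPf ly).
Qed.

Lemma eO0_eB T (x : T) : mact eO x = 0 -> mact eB x = x.
Proof. by move=> e; rewrite -[RHS]mact1 -(eBO P0) mactDl e addr0. Qed.

(** Superfluity is used twice: e_oo kills ker p = im d, so e_oo T1 lies in ker d; it also kills ker
    d, and e_oo is idempotent, so e_oo T1 = 0. *)
Lemma min_pres_fix T T1 T0 (d : 'Hom(T1, T0)) (p : 'Hom(T0, T)) :
  min_proj_pres d p -> forall x : T1, mact eB x = x.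
Proof.
move=> [_ [hd hp] [ps dk] [sp sd]] x; apply: eO0_eB.
have dx : d x \in lker p by rewrite -dk mem_limg.
have : mact eO x \in lker d.
  by rewrite memv_ker hd (superfluous_eO (submod_lker hp) sp dx).
move/(superfluous_eO (submod_lker hd) sd).
by rewrite -mactM eO_mul scale1r.
Qed.

(** As e_B fixes [T1], submodules of R T1 are submodules of [T1], so superfluity of ker d survives.
    For ker p it may fail, since e_B can cut off part of the top of [T0]. *)
Lemma R_min_pres T T1 T0 (d : 'Hom(T1, T0)) (p : 'Hom(T0, T)) :
  min_proj_pres d p -> pres (Rmap d) (Rmap p) /\ superfluous (lker (Rmap d)).
Proof.
move=> dp; have fx := min_pres_fix dp; case: dp => [[P1p Qp] [hd hp] [ps dk] [sp sd]].
split.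
  split; [by split; exact: R_projective | by split; exact: Rmap_hom |].
  by split; [exact: Rmap_surj | exact: Rmap_exact].
move=> L hL e.
have hV : submod (Rval @: L)%VS.
  move=> a _ /memv_imgP[y yL ->]; rewrite fix_act ?Rval_fix // -Rval_mact.
  by apply: memv_img; exact: hL.
have full : (Rval @: L)%VS = fullv.
  apply: sd => //; apply/vspaceP=> x; rewrite memvf.
  have : Rproj T1 x \in (L + lker (Rmap d))%VS by rewrite e memvf.
  case/memv_addP=> u uL [v]; rewrite memv_ker => /eqP dv eu.
  rewrite -(RvalK (fx x)) eu lfD memv_add ?memv_img //.
  by rewrite memv_ker -RmapE // dv lf0.
apply/vspaceP=> y; rewrite memvf.
have : Rval y \in (Rval @: L)%VS by rewrite full memvf.
by case/memv_imgP=> z zL /Rval_inj->.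
Qed.

(** As e_B fixes [T1], a map R T1 -> R N comes from a map T1 -> N; it is factored over A and then
    restricted. *)
Lemma rig_R T N T1 T0 (d : 'Hom(T1, T0)) (p : 'Hom(T0, T)) :
  min_proj_pres d p -> rig d N -> rig (Rmap d) (Rmod N).
Proof.
move=> dp rg h hh; have fx := min_pres_fix dp.
have hd : is_hom d by case: dp => _ [].
pose h' := (Rval \o (h \o Rproj T1))%VF.
have h'E x : h' x = Rval (h (Rproj T1 x)) by rewrite !comp_lfunE.
have hh' : is_hom h'.
  by move=> a x; rewrite !h'E fix_act // Rproj_inc hh Rval_mact [RHS]fix_act ?Rval_fix.
have [f [hf ef]] := rg h' hh'; exists (Rmap f); split; first exact: Rmap_hom.
apply/lfunP=> x; apply: Rval_inj.
by rewrite comp_lfunE !RmapE // -[f _]comp_lfunE -ef h'E RprojK.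
Qed.

Lemma trig_R T N : trig T N -> trig (Rmod T) (Rmod N).
Proof.
move=> t; have [P1 [Q [d [p dp]]]] := min_pres T.
have sd : superfluous (lker d) by case: dp => _ _ _ [].
exists (Rmod P1), (Rmod Q), (Rmap d), (Rmap p); split; first by case: (R_min_pres dp).
exact: rig_R dp (trig_pres (summand_refl T) (min_presW dp) sd t).
Qed.

(** Restrict a map h : P1 -> E M, factor it over B, and lift the factor to f' : Q -> E M. The
    difference h - f' d restricts to zero, so it vanishes by [functE_faithful]. *)
Lemma trig_functE T M : trig (Rmod T) M -> trig T (functE P0 M).
Proof.
move=> /(trig_isor (iso_sym (R_functE P0 M))) t; have [P1 [Q [d [p dp]]]] := min_pres T.
exists P1, Q, d, p; split; first exact: min_presW.
have [dR sR] := R_min_pres dp; have rg := trig_pres (summand_refl _) dR sR t.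
have hd : is_hom d by case: dp => _ [].
move=> h hh; have [f [hf ef]] := rg _ (Rmap_hom hh).
have [f' [hf' ef']] := functE_full hf.
exists f'; split=> //; apply/eqP; rewrite -subr_eq0; apply/eqP.
have hz : is_hom (h - (f' \o d))%VF by auto.
apply: (functE_faithful hz).
have [_ _ Rc RD] := @Rmap_functor _ _ P0.
have -> : Rmap (h - (f' \o d))%VF = Rmap h - Rmap (f' \o d)%VF.
  apply/eqP; rewrite eq_sym subr_eq -RD; auto.
  by rewrite subrK.
by rewrite Rc // ef' ef subrr.
Qed.

Lemma hom_fix_zero T S (h : 'Hom(T, S)) : is_hom h -> (forall x : T, mact eB x = x) ->
  (forall x : S, mact eB x = 0) -> h = 0.
Proof. by move=> hh fx z; apply/lfun_ext0=> x; rewrite -(fx x) hh z. Qed.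

(** In a minimal presentation P1 = e_B P1, so it has no nonzero map to [S]. *)
Lemma trig_eB0 T S : (forall x : S, mact eB x = 0) -> trig T S.
Proof.
move=> z; have [P1 [Q [d [p dp]]]] := min_pres T.
exists P1, Q, d, p; split; first exact: min_presW.
move=> h hh; exists 0; split; first exact: is_hom0.
by rewrite comp_lfun0l; apply: hom_fix_zero hh (min_pres_fix dp) z.
Qed.

End Proj.

(** * Transport of multiplicities along inflation and E *)

Section Transport.
Variables (F : fdmod B -> fdmod A) (Fm : forall M N : fdmod B, 'Hom(M, N) -> 'Hom(F M, F N)).
Hypothesis Ff : additive_functor Fm.
Hypothesis FR : forall M, iso (Rmod (F M)) M.
Hypothesis F0 : forall M T, summand T (F M) -> (forall x : Rmod T, x = 0) -> forall x : T, x = 0.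
Let Rf := @Rmap_functor _ _ P0.

Lemma transport_iso M M' : iso (F M) (F M') -> iso M M'.
Proof.
move=> /(functor_iso Rf) e.
exact: iso_trans (iso_sym (FR M)) (iso_trans e (FR M')).
Qed.

(** A decomposition of [F M] restricts to one of [M], so [R] kills one of the summands; [F0] says
    that such a summand is zero. *)
Lemma transport_indec M : indecomposable M -> indecomposable (F M).
Proof.
move=> [[x nx] Mi]; split.
  have [z|//] := zeroP (F M); case: nx.
  have zR := functor_zero Rf z.
  have [f [hf [g gK fK]]] := FR M.
  by rewrite -(fK x) (zR (g x)) lf0.
move=> X Y e; have e' := iso_trans (iso_sym (FR M)) (functor_dsum Rf e).
have [/iso0_zero z|/iso0_zero z] := Mi _ _ e'; [left|right]; apply: zero_iso; apply: (@F0 M _ _ z).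
  by exists Y.
by exists X; apply: iso_trans e (dsumC _ _).
Qed.

Lemma transport_summand M Y : indecomposable Y -> summand Y (F M) ->
  exists X, [/\ indecomposable X, summand X M & iso Y (F X)].
Proof.
move=> Yi; apply: (@KS_summand_ind _ _ (fun M0 => (forall X, indecomposable X ->
  summand X M0 -> summand X M) -> summand Y (F M0) -> exists X, [/\ indecomposable X,
  summand X M & iso Y (F X)]) M) => //.
- move=> _ [Z e]; have z := functor_zero Ff (@mod0_eq0 _ B).
  case: (not_summand0 Yi); exact: iso_summand (zero_iso z) (ex_intro _ Z e).
- move=> M1 M2 h1 h2 sM /(iso_summand (functor_dsum Ff (iso_refl _))).
  move=> /(summand_dsum_indec Yi)[/h1|/h2]; apply=> X Xi s; apply: sM => //.
    exact: summand_trans s (summand_dsuml _ _).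
  exact: summand_trans s (summand_dsumr _ _).
- move=> M1 M2 e h1 sM /(iso_summand (functor_iso Ff (iso_sym e))) s; apply: h1 => // X Xi s'.
  by apply: sM => //; exact: iso_summand e s'.
move=> X Xi sX _ s; exists X; split=> //; exact: indec_summand_iso (transport_indec Xi) Yi s.
Qed.

Lemma transport_mu X M : indecomposable X -> mu (F X) (F M) = mu X M.
Proof.
move=> Xi; have FXi := transport_indec Xi.
apply: (@mu_ext _ _ (fun M => mu (F X) (F M))) => // [M1 M2 e|M1 M2|Y Yi _].
- exact: mu_iso FXi (functor_iso Ff e).
- by rewrite -mu_dsum //; exact: mu_iso FXi (functor_dsum Ff (iso_refl _)).
rewrite !mu_indec //; last exact: transport_indec.
congr nat_of_bool; apply: asbool_equiv_eq; split; first exact: transport_iso.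
by move/(functor_iso Ff).
Qed.

Lemma transport_basic M : basic M -> basic (F M).
Proof.
move=> /basicP b; apply/basicP=> Y Yi; rewrite leqNgt; apply/negP=> h.
have /(mu_gt0 _ Yi) s : (0 < mu Y (F M))%N by exact: ltnW.
have [X [Xi _ e]] := transport_summand Yi s.
move: h; rewrite (mu_isol _ Yi e) transport_mu // ltnNge.
by rewrite b.
Qed.

Lemma transport_nind M : nind (F M) = nind M.
Proof.
apply: nind_eq; have [X [Xi Xn Xc]] := nindP M; exists (fun i => F (X i)); split.
- move=> i; have [Xii s] := Xi i; split; first exact: transport_indec.
  exact (functor_summand Ff s).
- by move=> i j /transport_iso; exact: Xn.
move=> Y Yi /(transport_summand Yi)[Z [Zi s e]]; have [i ei] := Xc _ Zi s.
by exists i; apply: iso_trans e _; exact (functor_iso Ff ei).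
Qed.
End Transport.

Lemma inflate_F0 M T : summand T (inflate P0 M) ->
  (forall x : Rmod T, x = 0) -> forall x : T, x = 0.
Proof.
move=> s z x; have fx := fix_summand s (@inflate_fix _ _ P0 M).
by rewrite -(RvalK (fx x)) (z (Rproj T x)) lf0.
Qed.

Lemma functE_F0 M T : summand T (functE P0 M) ->
  (forall x : Rmod T, x = 0) -> forall x : T, x = 0.
Proof.
move=> /summandP[i [r [hi hr ri]]] z x.
have i0 : i = 0.
  by apply: functE_faithful => //; apply/lfun_ext0=> y; rewrite (z y) lf0.
by rewrite -[x]id_lfunE -ri i0 comp_lfun0r zero_lfunE.
Qed.

Lemma R_inflate_sym M : iso (Rmod (inflate P0 M)) M.
Proof. exact/iso_sym/R_inflate. Qed.

End NewProjective.

(** * Support tau-tilting pairs and their isomorphism classes *)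

Section Pairs.
Variables (k : closedFieldType) (C : falgType k).
Implicit Types M N P Q X Y Z T : fdmod C.

Lemma hom_zero_summandl P P' M : summand P' P -> hom_zero P M -> hom_zero P' M.
Proof.
move=> /summandP[i [r [hi hr ri]]] z f hf.
by rewrite -[f]comp_lfun1r -ri comp_lfunA (z (f \o r)%VF) ?comp_lfun0l; auto.
Qed.
Lemma hom_zero_summandr P M M' : summand M' M -> hom_zero P M -> hom_zero P M'.
Proof.
move=> /summandP[i [r [hi hr ri]]] z f hf.
by rewrite -[f]comp_lfun1l -ri -comp_lfunA (z (i \o f)%VF) ?comp_lfun0r; auto.
Qed.
Lemma hom_zero_isor P M M' : iso M M' -> hom_zero P M -> hom_zero P M'.
Proof. by move=> e; apply: hom_zero_summandr; exact: summand_iso e (summand_refl M). Qed.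

Lemma stau_pairE M P : stau_pair M P <->
  [/\ projective P, trig M M, hom_zero P M & (nind M + nind P)%N = nind (regmod C)].
Proof.
split=> [[Pp /tau_rigidP tM z [m [p [c [hm hp hc e]]]]]|[Pp tM z e]].
  by split=> //; rewrite (nind_eq hm) (nind_eq hp) (nind_eq hc).
split=> //; first exact/tau_rigidP.
exists (nind M), (nind P), (nind (regmod C)).
by split=> //; exact: nindP.
Qed.

Lemma trig_self_summand M N : summand N M -> trig M M -> trig N N.
Proof. by move=> s t; exact: trig_summand s (trig_summandr s t). Qed.

Lemma simple_indec M : simple M -> indecomposable M.
Proof.
move=> [nM sM]; split=> // X Y [f [hf bf]]; have [fK fVK] := bij_linv bf.
have hV : is_hom ((f^-1)%VF \o dinl)%VF by apply: is_hom_comp => //; exact: is_hom_inv.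
have [e|e] := sM _ (submod_limg hV); [left|right]; apply: zero_iso => z.
  have : ((f^-1)%VF \o dinl)%VF z \in limg ((f^-1)%VF \o dinl)%VF by exact: mem_limg.
  rewrite e memv0 comp_lfunE => /eqP e0; have := fVK (dinl z).
  by rewrite e0 lf0 dinlE => -[].
have : (f^-1)%VF (dinr z) \in limg ((f^-1)%VF \o dinl)%VF by rewrite e memvf.
case/memv_imgP=> x _; rewrite comp_lfunE => e1.
have : dinr z = dinl x :> dsum X Y by rewrite -(fVK (dinr z)) e1 fVK.
by rewrite dinlE dinrE => -[].
Qed.

Lemma class_closed (x : stau_tilt C) M P M' P' :
  in_class x M P -> iso M M' -> iso P P' -> in_class x M' P'.
Proof.
rewrite /in_class; case: x => c [N [Q [h ec]]] /=; rewrite ec => -[e1 e2] e3 e4.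
by split; [exact: iso_trans e1 e3 | exact: iso_trans e2 e4].
Qed.

Lemma class_rep (x : stau_tilt C) : exists M P,
  basic_stau_pair M P /\ forall N Q, in_class x N Q <-> iso M N /\ iso P Q.
Proof.
rewrite /in_class; case: x => c [N [Q [h ec]]] /=; exists N, Q.
by rewrite ec.
Qed.

Lemma class_of M P : basic_stau_pair M P ->
  exists x : stau_tilt C, forall N Q, in_class x N Q <-> iso M N /\ iso P Q.
Proof.
move=> h; pose c N Q := iso M N /\ iso P Q.
have hc : exists M0 P0, basic_stau_pair M0 P0 /\ c = (fun N Q => iso M0 N /\ iso P0 Q).
  by exists M, P.
by exists (exist _ c hc).
Qed.

Lemma class_eq (x y : stau_tilt C) M P : in_class x M P -> in_class y M P -> x = y.
Proof.
rewrite /in_class; case: x => c [N [Q [h ec]]]; case: y => c' [N' [Q' [h' ec']]] /=.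
rewrite {1}ec {1}ec' => -[e1 e2] [e1' e2'].
apply: eq_exist => /=; rewrite ec ec'; apply: funext => X; apply: funext => Y.
apply/propext; split=> -[e3 e4].
  by split; [apply: iso_trans e1' (iso_trans (iso_sym e1) e3)
            | apply: iso_trans e2' (iso_trans (iso_sym e2) e4)].
by split; [apply: iso_trans e1 (iso_trans (iso_sym e1') e3)
          | apply: iso_trans e2 (iso_trans (iso_sym e2') e4)].
Qed.

End Pairs.

(** * The maps e and r on pairs, and the count of summands *)

Section Main.
Variables (k : closedFieldType) (B : falgType k) (P0 : fdmod B).
Local Notation A := (opext P0).
Implicit Types (T : fdmod A) (M Q : fdmod B).
Hypothesis P0p : projective P0.
Let Rf := @Rmap_functor _ _ P0.
Local Notation inf := (inflate P0).
Local Notation E := (functE P0).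
Local Notation Pnew := (Ptl P0).

Let inf_indec M : indecomposable M -> indecomposable (inf M) :=
  transport_indec (R_inflate_sym P0) (@inflate_F0 _ _ P0) (M := M).
Let inf_iso M M' : iso (inf M) (inf M') -> iso M M' := transport_iso (R_inflate_sym P0) (M := M) (M' := M').
Let inf_mu X M : indecomposable X -> mu (inf X) (inf M) = mu X M :=
  transport_mu (@infm_functor _ _ P0) (R_inflate_sym P0) (@inflate_F0 _ _ P0) (X := X) M.

Lemma Pnew_not_fixed : ~ (forall x : Pnew, mact (eB P0) x = x).
Proof.
move=> h; apply: (@Ptop_neq0 _ _ P0).
by rewrite -Ptop_eO -(h (mact _ _)) -mactM eB_eO; exact: mactl0.
Qed.

Lemma Pnew_not_inflate M : ~ summand Pnew (inf M).
Proof. by move=> s; apply: Pnew_not_fixed; apply: fix_summand s _; exact: inflate_fix. Qed.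

Lemma mu_Pnew_inflate M : mu Pnew (inf M) = 0%N.
Proof. by apply/(mu_eq0 _ (indec_Ptl P0))/Pnew_not_inflate. Qed.

Section ProjectiveList.
Variables (n : nat) (PB : 'I_n -> fdmod B).
Hypothesis PBi : forall i, indecomposable (PB i).
Hypothesis PBn : forall i j, iso (PB i) (PB j) -> i = j.
Hypothesis PBs : forall i, summand (PB i) (regmod B).
Hypothesis PBc : forall Y, indecomposable Y -> summand Y (regmod B) -> exists i, iso Y (PB i).

Definition PA (i : 'I_n.+1) : fdmod A := if unlift ord0 i is Some j then inf (PB j) else Pnew.

Lemma PAi i : indecomposable (PA i).
Proof. by rewrite /PA; case: unliftP => [j|] _; [exact: inf_indec | exact: indec_Ptl]. Qed.

Lemma PAn i j : iso (PA i) (PA j) -> i = j.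
Proof.
rewrite /PA; case: unliftP => [i' ->|->]; case: unliftP => [j' ->|->] // e.
- by rewrite (PBn (inf_iso e)).
- by case: (@Pnew_not_inflate (PB i')); exact: summand_iso e (summand_refl _).
by case: (@Pnew_not_inflate (PB j')); exact: summand_iso (iso_sym e) (summand_refl _).
Qed.

Lemma PAs i : summand (PA i) (regmod A).
Proof.
apply: iso_summand (iso_sym (regA_iso P0)) _; rewrite /PA; case: unliftP => [j|] _.
  apply: summand_trans (summand_dsuml _ _).
  exact (functor_summand (@infm_functor _ _ P0) (PBs j)).
exact: summand_dsumr.
Qed.

Lemma PAc Y : indecomposable Y -> summand Y (regmod A) -> exists i, iso Y (PA i).
Proof.
move=> Yi /(iso_summand (regA_iso P0))/(summand_dsum_indec Yi)[s|s]; last first.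
  by exists ord0; rewrite /PA unlift_none; exact: indec_summand_iso (indec_Ptl P0) Yi s.
have [X [Xi sX e]] := transport_summand (@infm_functor _ _ P0) (R_inflate_sym P0)
  (@inflate_F0 _ _ P0) Yi s.
have [j ej] := PBc Xi sX; exists (lift ord0 j); rewrite /PA liftK.
by apply: iso_trans e _; exact (functor_iso (@infm_functor _ _ P0) ej).
Qed.

Lemma nind_regA : nind (regmod A) = n.+1.
Proof.
apply: nind_eq; exists PA; split; [|exact: PAn | exact: PAc].
by move=> i; split; [exact: PAi | exact: PAs].
Qed.

(* The matrix of R on Grothendieck groups of projectives, in the bases PA and PB. *)
Definition Rmx : 'M[rat]_(n.+1, n) := \matrix_i mv PB (Rmod (PA i)).

Lemma additive_mvR : additive_inv (fun T => mv PB (Rmod T)).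
Proof.
have [mi mD] := additive_mv PBi; split=> [T T' e|T T'].
  exact: mi (functor_iso Rf e).
by rewrite -mD; apply: mi; exact: functor_dsum Rf _ _ _ (iso_refl _).
Qed.

Lemma mv_Rmx T : projective T -> mv PA T *m Rmx = mv PB (Rmod T).
Proof.
move=> Tp; rewrite (proj_inv_sum PAi PAn PAc additive_mvR Tp) mulmx_sum_row.
by apply: eq_bigr => i _; rewrite rowK mxE scaler_nat.
Qed.

Lemma gvec_Rmx T : gvec PA T *m Rmx = gvec PB (Rmod T).
Proof.
have [T1 [T0 [d [p dp]]]] := min_pres T.
have [dR sR] := R_min_pres P0p dp; rewrite (gvec_pres PBi dR sR).
have sd : superfluous (lker d) by case: dp => _ _ _ [].
rewrite (gvec_pres PAi (min_presW dp) sd) mulmxBl.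
by have [[T1p T0p] _ _] := min_presW dp; rewrite !mv_Rmx.
Qed.

(** Restriction undoes inflation, so the rows of the inflated projectives form the identity
    matrix. *)
Lemma rank_Rmx : \rank Rmx = n.
Proof.
apply/eqP; rewrite eqn_leq rank_leq_col -{1}(mxrank1 rat n); apply: mxrankS.
apply/row_subP=> j; suff -> : row j 1%:M = row (lift ord0 j) Rmx by exact: row_sub.
rewrite rowK row1 /PA liftK; apply/rowP=> l; rewrite !mxE /=.
rewrite (mu_iso (PBi l) (R_inflate_sym P0 (PB j))) mu_indec //.
by case: asboolP => [/PBn->|ne]; [rewrite eqxx | case: eqVneq => // e; case: ne; rewrite e].
Qed.

Lemma sum_mulrn_sub m (V : 'I_m -> 'rV[rat]_n) (c : 'I_m -> nat) p (G : 'M[rat]_(p, n)) :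
  (forall i, V i <= G)%MS -> ((\sum_i V i *+ c i)%R <= G)%MS.
Proof.
move=> h; apply: summx_sub => i _.
have -> : V i *+ c i = (c i)%:R *: V i :> 'rV[rat]_n by rewrite scaler_nat.
exact: scalemx_sub.
Qed.

(* The g-vectors of (T, P) form a basis of Q^(n+1). As R maps K_0(proj A) onto
   K_0(proj B), their images, which are combinations of the g-vectors of
   (R T, Ps), span Q^n. *)
Lemma R_pair_count T P Ps : projective P -> projective Ps -> trig T T -> hom_zero P T ->
  iso P (inf Ps) -> (nind T + nind P)%N = n.+1 -> (nind (Rmod T) + nind Ps)%N = n.
Proof.
move=> Pp Psp tT zP eP cnt.
have tR := trig_R P0p tT.
have zPs : hom_zero Ps (Rmod T).
  apply/hom_zero_inflate; apply: hom_zero_summandl zP.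
  exact: summand_iso eP (summand_refl P).
have [XT [XTi XTn XTc]] := nindP T; have [QP [QPi QPn QPc]] := nindP P.
have [Z [Zi Zn Zc]] := nindP (Rmod T); have [QB [QBi QBn QBc]] := nindP Ps.
pose GA := gmx PA XT QP; pose GB := gmx PB Z QB.
have freeA : row_free GA.
  apply: (gvec_independent PAi PAn PAc) => [i||i j|i||i|i j].
  - by case: (XTi i).
  - exact: XTn.
  - have [_ si] := XTi i; have [_ sj] := XTi j.
    exact: trig_summand si (trig_summandr sj tT).
  - by case: (QPi i).
  - exact: QPn.
  - by have [_ si] := QPi i; exact: projective_summand si Pp.
  have [_ si] := QPi i; have [_ sj] := XTi j.
  exact: hom_zero_summandl si (hom_zero_summandr sj zP).
(* Independence over B gives only this upper bound; the reverse inequality is the spanning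
   argument. *)
have le : (nind (Rmod T) + nind Ps <= n)%N.
  apply: (@tau_rigid_pair_le _ _ _ _ PBi PBn PBc _ _ Z QB) => [i||i j|i||i|i j].
  - by case: (Zi i).
  - exact: Zn.
  - have [_ si] := Zi i; have [_ sj] := Zi j.
    exact: trig_summand si (trig_summandr sj tR).
  - by case: (QBi i).
  - exact: QBn.
  - by have [_ si] := QBi i; exact: projective_summand si Psp.
  have [_ si] := QBi i; have [_ sj] := Zi j.
  exact: hom_zero_summandl si (hom_zero_summandr sj zPs).
apply/eqP; rewrite eqn_leq le /=.
(* The count over A makes n + 1 independent g-vectors in dimension n + 1, hence a basis. *)
have fullA : row_full GA by rewrite /row_full (eqP freeA) cnt.
have rk : \rank (GA *m Rmx) = n by rewrite (eqmxMfull _ fullA) rank_Rmx.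
rewrite -{1}rk; apply: leq_trans (rank_leq_row GB); apply: mxrankS.
have ZG j : (gvec PB (Z j) <= GB)%MS.
  apply: (@submx_trans _ _ _ _ _ _ (\matrix_i gvec PB (Z i))).
    by have := row_sub j (\matrix_i gvec PB (Z i)); rewrite rowK.
  by rewrite /GB /gmx -addsmxE addsmxSl.
have QG j : (mv PB (QB j) <= GB)%MS.
  apply: (@submx_trans _ _ _ _ _ _ (\matrix_i mv PB (QB i))).
    by have := row_sub j (\matrix_i mv PB (QB i)); rewrite rowK.
  by rewrite /GB /gmx -addsmxE addsmxSr.
rewrite /GA /gmx mul_col_mx col_mx_sub; apply/andP; split; apply/row_subP=> i.
  rewrite row_mul rowK gvec_Rmx; have [_ si] := XTi i.
  rewrite (additive_inv_sum (additive_gvec PBi) (fun j => (Zi j).1) Zn).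
    exact: sum_mulrn_sub.
  move=> Y Yi s; apply: Zc => //; apply: summand_trans s _.
  exact (functor_summand Rf si).
have [_ si] := QPi i; rewrite row_mul rowK mv_Rmx; last exact: projective_summand si Pp.
rewrite (additive_inv_sum (additive_mv PBi) (fun j => (QBi j).1) QBn).
  exact: sum_mulrn_sub.
move=> Y Yi s; apply: QBc => //; apply: summand_trans s _.
apply: iso_summand (R_inflate_sym P0 Ps) _; apply: iso_summand (functor_iso Rf eP) _.
exact (functor_summand Rf si).
Qed.

End ProjectiveList.

Lemma R_pair_nind T P Ps : projective P -> projective Ps -> trig T T -> hom_zero P T ->
  iso P (inf Ps) -> (nind T + nind P)%N = nind (regmod A) ->
  (nind (Rmod T) + nind Ps)%N = nind (regmod B).
Proof.
have [PB [h PBn PBc]] := nindP (regmod B).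
have PBi i := (h i).1; have PBs i := (h i).2.
rewrite (nind_regA PBi PBn PBs PBc); exact: R_pair_count PBi PBn PBc T P Ps.
Qed.

Lemma nind_regAS : nind (regmod A) = (nind (regmod B)).+1.
Proof.
have [PB [h PBn PBc]] := nindP (regmod B).
exact: (nind_regA (fun i => (h i).1) PBn (fun i => (h i).2) PBc).
Qed.

Lemma fixed_projective T : projective T -> ~ summand Pnew T -> forall x : T, mact (eB P0) x = x.
Proof.
move=> Tp ns; apply: (@KS_summand_ind _ _ (fun T => forall x : T, mact (eB P0) x = x)).
- by move=> x; rewrite (mod0_eq0 x) mactr0.
- by move=> X Y hX hY [x y]; congr (_, _); [exact: hX | exact: hY].
- move=> X Y [f [hf /bij_linv[fK fVK]]] hX y.
  by rewrite -(fVK y) -hf hX.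
move=> Y Yi s; have [e|//] := indec_projA (projective_summand s Tp) Yi.
by case: ns; exact: summand_iso e s.
Qed.

Lemma basic_inflate Ps : basic (inf Ps) -> basic Ps.
Proof.
move=> /basicP b; apply/basicP=> X Xi; rewrite -inf_mu //.
by apply: b; exact: inf_indec.
Qed.

Lemma basic_summand (D : falgType k) (X Y : fdmod D) : summand X Y -> basic Y -> basic X.
Proof.
move=> [Z e] /basicP b; apply/basicP=> W Wi; apply: leq_trans (b _ Wi).
by rewrite (mu_iso Wi e) mu_dsum // leq_addr.
Qed.

Section Vertex.
Variables Pt S : fdmod A.
Hypothesis hPt : is_Ptilde Pt.
Hypothesis Ss : simple S.
Hypothesis S0 : forall x : S, mact (eB P0) x = 0.
Let Pt_iso : iso Pt Pnew := Ptilde_iso P0p hPt.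
Let Pti : indecomposable Pt := indec_iso (iso_sym Pt_iso) (indec_Ptl P0).
Let Si : indecomposable S := simple_indec Ss.

(** A basic [P] contains Ptilde at most once; what remains is a projective fixed by e_B, hence
    inflated from B. *)
Lemma Pstar_ex P : projective P -> basic P -> exists Ps, [/\ projective Ps, basic Ps &
  iso P (inf Ps) \/ iso P (dsum (inf Ps) Pt)].
Proof.
move=> Pp bP; have [s|ns] := pselect (summand Pnew P).
  have [P' e] := summand_iso (iso_sym Pt_iso) s.
  have sP' : summand P' P by exists Pt; exact: iso_trans e (dsumC _ _).
  have ns : ~ summand Pnew P'.
    move=> /(mu_gt0 _ (indec_Ptl P0)) h; have := (basicP P).1 bP _ (indec_Ptl P0).
    rewrite (mu_iso (indec_Ptl P0) e) mu_dsum; last exact: indec_Ptl.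
    rewrite (mu_indec Pti (indec_Ptl P0)); case: asboolP => [_|[]]; last exact: iso_sym.
    by case: (mu _ _) h.
  have P'p := projective_summand sP' Pp.
  have e' := inflate_R (fixed_projective P'p ns).
  exists (Rmod P'); split; first exact: R_projective.
    by apply: basic_inflate; apply: basic_iso e' (basic_summand sP' bP).
  right; apply: (iso_trans e); apply: iso_trans (dsumC _ _) _.
  exact: dsum_iso e' (iso_refl _).
have e' := inflate_R (fixed_projective Pp ns).
exists (Rmod P); split; [exact: R_projective | | by left].
exact: basic_inflate (basic_iso e' bP).
Qed.

(** The multiplicity of Ptilde in [P], 0 or 1, decides which alternative of [is_Pstar] holds; Ptilde
    is then cancelled by Krull-Schmidt. *)
Lemma Pstar_uniq P Q Q' : is_Pstar Pt P Q -> is_Pstar Pt P Q' -> iso Q Q'.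
Proof.
move=> [Qp h] [Q'p h'].
have muE N : mu Pnew (dsum (inf N) Pt) = 1%N.
  rewrite mu_dsum ?mu_Pnew_inflate ?add0n; last exact: indec_Ptl.
  by rewrite -(mu_iso (indec_Ptl P0) (iso_sym Pt_iso)) mu_self //; exact: indec_Ptl.
case: h h' => [e|e] [e'|e']; have := iso_trans (iso_sym e) e'.
- exact: inf_iso.
- by move/(mu_iso (indec_Ptl P0)); rewrite muE mu_Pnew_inflate.
- by move/(mu_iso (indec_Ptl P0)); rewrite muE mu_Pnew_inflate.
by move/dsum_cancel; exact: inf_iso.
Qed.

Lemma That_uniq T N N' : is_That T N -> is_That T N' -> iso N N'.
Proof.
move=> [bN _ [X [rX aX]]] [bN' _ [X' [rX' aX']]].
have e := iso_trans (iso_sym (tensor_iso rX)) (tensor_iso rX').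
apply: basic_support_iso => // Y Yi.
have aX1 := (same_addP _ _).1 aX Y Yi; have aX2 := (same_addP _ _).1 aX' Y Yi.
rewrite aX1 aX2; split; first exact: iso_summand.
by apply: iso_summand; exact: iso_sym.
Qed.

Lemma R_S_zero (x : Rmod S) : x = 0.
Proof. by apply: Rval_inj; rewrite -Rval_fix S0 lf0. Qed.

Lemma R_functE_S M : iso (Rmod (dsum (E M) S)) M.
Proof.
apply: iso_trans (functor_dsum Rf (iso_refl _)) _.
apply: iso_trans (dsum_iso (R_functE P0 M) (zero_iso R_S_zero)) _.
exact: dsum0.
Qed.

Lemma S_not_functE M : ~ summand S (E M).
Proof. by move=> /functE_F0/(_ R_S_zero) z; case: Ss => -[x nx] _; apply: nx. Qed.

(** Since R (E M + S) is [M], both rigidity and the vanishing from [inf Q] reduce to [M] by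
    adjunction. [E] and inflation preserve numbers of summands, and [S], which is not a summand of
    [E M], accounts for the new vertex. *)
Lemma extend_pair M Q : basic_stau_pair M Q -> basic_stau_pair (dsum (E M) S) (inf Q).
Proof.
move=> [/stau_pairE[Qp tM zQ cnt] bM bQ]; split.
- apply/stau_pairE; split.
  + exact: inflate_projective.
  + apply: trig_dsum; last exact: trig_eB0.
    apply: trig_functE => //; apply: trig_isol tM; exact/iso_sym/R_functE_S.
  + by apply/hom_zero_inflate; apply: hom_zero_isor zQ; exact/iso_sym/R_functE_S.
  rewrite (nind_iso (dsumC _ _)) (nind_dsum_indec Si (@S_not_functE M)) nind_regAS -cnt.
  rewrite (transport_nind (@Em_functor _ _ P0) (R_functE P0) (@functE_F0 _ _ P0)).
  by rewrite (transport_nind (@infm_functor _ _ P0) (R_inflate_sym P0) (@inflate_F0 _ _ P0)).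
- apply/basicP=> Y Yi; rewrite mu_dsum // (mu_indec Si Yi); case: asboolP => [e|_].
    by rewrite (mu_isol _ Yi e) ((mu_eq0 _ Si).2 (@S_not_functE M)).
  rewrite addn0; apply: (basicP _).1 => //.
  exact: transport_basic (@Em_functor _ _ P0) (R_functE P0) (@functE_F0 _ _ P0) M bM.
exact: transport_basic (@infm_functor _ _ P0) (R_inflate_sym P0) (@inflate_F0 _ _ P0) Q bQ.
Qed.

(** Hom(Ptilde, T) is e_oo T: right multiplication A -> T by x, restricted to [Pnew], sends [Ptop]
    to e_oo x. *)
Lemma hom_zero_Pnew_fixed T : hom_zero Pnew T -> forall x : T, mact (eB P0) x = x.
Proof.
move=> z x; apply: eO0_eB.
have hf : is_hom (genh x \o incl (submod_lker (@projB_hom _ _ P0)))%VF.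
  by apply: is_hom_comp; [exact: genh_hom | exact: incl_hom].
have := congr1 (fun f : 'Hom(Pnew, T) => f (Ptop P0)) (z _ hf).
rewrite /= zero_lfunE => <-; rewrite comp_lfunE genhE.
by rewrite [X in _ = mact X _](inclE _ (Ptop P0)) PtopE.
Qed.

Lemma restrict_pair T P : basic_stau_pair T P -> exists That Ps,
  [/\ is_That T That, is_Pstar Pt P Ps & basic_stau_pair That Ps].
Proof.
move=> [/stau_pairE[Pp tT zP cnt] bT bP].
have [That [bTh sTh]] := basic_part (Rmod T); have [Ps [Psp bPs ePs]] := Pstar_ex Pp bP.
have tR := trig_R P0p tT.
have sum : summand That (Rmod T).
  apply: mu_le_summand => Y Yi; have le := (basicP That).1 bTh _ Yi.
  have [->//|h] := posnP (mu Y That); apply: (leq_trans le).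
  by apply/(mu_gt0 _ Yi)/(sTh _ Yi)/(mu_gt0 _ Yi).
have tTh := trig_self_summand sum tR.
exists That, Ps; split.
- split=> //; first exact/tau_rigidP.
  by exists (Rmod T); split; [exact: R_tensor | exact/same_addP].
- by split.
have sP : summand (inf Ps) P.
  case: ePs => [e|e]; first exact: summand_iso e (summand_refl _).
  by exists Pt.
have zPs : hom_zero Ps (Rmod T).
  by apply/hom_zero_inflate; exact: hom_zero_summandl sP zP.
split=> //; apply/stau_pairE; split=> //; first exact: hom_zero_summandr sum zPs.
rewrite (nind_support sTh); case: ePs => [e|e]; first exact: R_pair_nind e cnt.
have sPt : summand Pt P by exists (inf Ps); exact: iso_trans e (dsumC _ _).
(* Here Ptilde is a summand of [P], so [T] is inflated from B and has as many summands as [R T];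
   deleting Ptilde matches |A| = |B| + 1. *)
have fT : forall x : T, mact (eB P0) x = x.
  apply: hom_zero_Pnew_fixed; apply: hom_zero_summandl zP.
  exact: summand_iso Pt_iso sPt.
move: cnt; rewrite (nind_iso (inflate_R fT)) (nind_iso (iso_trans e (dsumC _ _))) nind_regAS.
rewrite nind_dsum_indec // => [|s]; last first.
  by apply: (@Pnew_not_inflate Ps); exact: summand_iso Pt_iso s.
rewrite !(transport_nind (@infm_functor _ _ P0) (R_inflate_sym P0) (@inflate_F0 _ _ P0)).
by rewrite addnS => -[].
Qed.

Lemma Pstar_iso P P' Q : iso P P' -> is_Pstar Pt P Q -> is_Pstar Pt P' Q.
Proof.
by move=> /iso_sym e [Qp [h|h]]; split=> //; [left|right]; exact: iso_trans e h.
Qed.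

Lemma That_iso T T' N : iso T T' -> is_That T N -> is_That T' N.
Proof.
move=> e [bN tN [X [rX aX]]]; split=> //; exists (Rmod T'); split; first exact: R_tensor.
apply/same_addP=> Y Yi; rewrite ((same_addP _ _).1 aX Y Yi).
have e' := iso_trans (iso_sym (tensor_iso rX)) (functor_iso Rf e).
by split; apply: iso_summand => //; exact: iso_sym.
Qed.

Lemma That_extend M : basic M -> tau_rigid M -> is_That (dsum (E M) S) M.
Proof.
move=> bM tM; split=> //; exists (Rmod (dsum (E M) S)); split; first exact: R_tensor.
apply/same_addP=> Y Yi; have e := R_functE_S M.
by split; apply: iso_summand => //; exact: iso_sym.
Qed.

End Vertex.
End Main.

Theorem corollary2p12 (k : closedFieldType) (B : falgType k) (P0 : fdmod B)
    (Pt S : fdmod (opext P0)) :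
  basic_algebra B -> connected_algebra B -> projective P0 ->
  is_Ptilde Pt -> is_top Pt S -> simple S ->
  exists (e : stau_tilt B -> stau_tilt (opext P0))
         (r : stau_tilt (opext P0) -> stau_tilt B),
    [/\ forall x M Q, in_class x M Q ->
          in_class (e x) (dsum (functE P0 M) S) (inflate P0 Q),
        forall y T P, in_class y T P ->
          exists That Pstar,
            [/\ is_That T That /\ (forall N, is_That T N -> iso N That),
                is_Pstar Pt P Pstar /\
                  (forall Q, is_Pstar Pt P Q -> iso Q Pstar)
              & in_class (r y) That Pstar]
      & forall x, r (e x) = x].
Proof.
move=> _ _ P0p hPt tS Ss; have S0 := top_eB P0p hPt tS Ss.
have eP (x : stau_tilt B) : exists y : stau_tilt (opext P0), forall M Q, in_class x M Q ->
    in_class y (dsum (functE P0 M) S) (inflate P0 Q).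
  have [M0 [Q0 [h hx]]] := class_rep x.
  have [y hy] := class_of (extend_pair P0p Ss S0 h).
  exists y => M Q /hx[eM eQ]; apply/hy; split.
    apply: dsum_iso; last exact: iso_refl.
    exact (functor_iso (@Em_functor _ _ P0) eM).
  exact (functor_iso (@infm_functor _ _ P0) eQ).
have rP (y : stau_tilt (opext P0)) : exists x : stau_tilt B, forall T P, in_class y T P ->
    exists That Pstar, [/\ is_That T That, is_Pstar Pt P Pstar & in_class x That Pstar].
  have [T0 [P1 [h hy]]] := class_rep y.
  have [That [Ps [hT hP hp]]] := restrict_pair P0p hPt h.
  have [x hx] := class_of hp; exists x => T P /hy[eT eP'].
  exists That, Ps; split; [exact: That_iso eT hT | exact: Pstar_iso eP' hP |].
  by apply/hx; split; exact: iso_refl.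
(* Each class has one target class that serves all its representatives, so choice yields maps on
   classes. *)
have [e he] := choice eP; have [r hr] := choice rP.
exists e, r; split=> // [y T P /hr[That [Ps [hT hP hc]]]|x].
  exists That, Ps; split=> //.
    by split=> // N hN; exact: That_uniq hN hT.
  by split=> // Q hQ; exact: (Pstar_uniq P0p hPt hQ hP).
have [M [Q [h hx]]] := class_rep x.
have xMQ : in_class x M Q by apply/hx; split; exact: iso_refl.
have [That [Ps [hT hP hc]]] := hr _ _ _ (he _ _ _ xMQ).
(* [M] and [Q] themselves meet the conditions that characterize the image under [r] of the pair (E M
   + S, Q); uniqueness identifies the two classes. *)
have [[Qp tM _ _] bM bQ] := h.
have hQ : is_Pstar Pt (inflate P0 Q) Q by split=> //; left; exact: iso_refl.
apply/esym/(class_eq xMQ)/(class_closed hc).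
  exact: That_uniq hT (That_extend S0 bM tM).
exact: (Pstar_uniq P0p hPt hP hQ).
Qed.
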